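(* For any $\varphi:\mathbb N\to\mathbb C$ define $$|||\varphi|||_{\mathcal M_3}=\sup\big\{\,|||(\bar z^kM_\varphi(z^kx_k))_{k\ge0}|||\,\big\},$$ where the supremum runs over all sequences $(x_k)_{k\ge0}$ in $H^1(S_1)$ with $|||(x_k)|||<1$. Then $$\|\varphi\|_{M_3(\mathbb N)}=|||\varphi|||_{\mathcal M_3}.$$
   Context: $\mathbb N=\{0,1,2,\dots\}$, $m$ is normalized Lebesgue measure on the unit circle. $S_1$ and $S_2$ are the spaces of trace class and Hilbert–Schmidt operators on $\ell_2$. $H^1(S_1)$ (resp. $H^2(S_2)$) is the completion of the $S_1$-valued (resp. $S_2$-valued) analytic polynomials $f(z)=\sum_{n\ge0}x_nz^n$ for the norm $\int\|f(z)\|_{S_1}\,dm(z)$ (resp. $(\int\|f(z)\|_{S_2}^2\,dm(z))^{1/2}$). For a sequence $(x_k)_{k\ge0}$ in $H^1(S_1)$, write $|||(x_k)|||<c$ if there are factorizations $x_k=g\,y_k\,h$ for all $k\geq 0$ (i.e. $x_k(z)=g(z)y_kh(z)$) with $g,h\in H^2(S_2)$, $y_k\in B(\ell_2)$ and $$\|g\|_{H^2(S_2)}\ \sup_k\|y_k\|_{B(\ell_2)}\ \|h\|_{H^2(S_2)}<c,$$ and set $|||(x_k)|||=\inf\{c: |||(x_k)|||<c\}$ (with value $+\infty$ if there is no such $c$). $M_\varphi$ is the multiplier $\sum a_nz^n\mapsto\sum a_n\varphi(n)z^n$, here acting on formal Fourier series with coefficients $a_n\in S_1$; thus $\bar z^kM_\varphi(z^kx_k)$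 has Fourier series $\sum_{n\ge0}\varphi(n+k)\hat x_k(n)z^n$. (If some of these series are not the Fourier series of an element of $H^1(S_1)$, the quantity $|||(\bar z^kM_\varphi(z^kx_k))|||$ is taken to be $+\infty$.) $M_3(\mathbb N)$ is the space of all functions $\varphi:\mathbb N\to\mathbb C$ for which there are Hilbert spaces $H_0,H_1,H_2,H_3$ with $H_0=H_3=\mathbb C$ and bounded functions $\xi_i:\mathbb N\to B(H_i,H_{i-1})$ ($i=1,2,3$) with $\varphi(t_1+t_2+t_3)=\xi_1(t_1)\xi_2(t_2)\xi_3(t_3)$ for all $t_1,t_2,t_3\in\mathbb N$ (identifying $B(\mathbb C,\mathbb C)$ with $\mathbb C$); $\|\varphi\|_{M_3(\mathbb N)}=\inf\{\sup_t\|\xi_1(t)\|\,\sup_t\|\xi_2(t)\|\,\sup_t\|\xi_3(t)\|\}$, the infimum over all such representations ($+\infty$ if there are none). *)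

(* Defs.v *)
From HB Require Import structures.
From mathcomp Require Import all_boot all_order all_algebra.
From mathcomp Require Import all_classical all_reals all_analysis.
From mathcomp Require Import complex.
From mathcomp Require Import ring lra.
Import numFieldNormedType.Exports.
Set Implicit Arguments. Unset Strict Implicit. Unset Printing Implicit Defensive.
Import Order.TTheory GRing.Theory Num.Theory.
Local Open Scope classical_set_scope.
Local Open Scope ring_scope.
Section PreHilbert.
Variables (C : numClosedFieldType) (V : lmodType C).
Variable d : {dot V for Num.conj}.

Definition dotnorm (u : V) : C := sqrtC (d u u).

Lemma dot_CauchySchwarz u v : `|d u v| ^+ 2 <= d u u * d v v.
Proof.
have [->|v0] := eqVneq v 0.
  have -> : d 0 0 = 0 by exact: linear0r.
  by rewrite linear0r normr0 expr0n mulr0.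
have dv : 0 < d v v by rewrite dnorm_gt0.
have dv0 : d v v != 0 by rewrite gt_eqF.
have dvC : (d v v)^* = d v v by rewrite geC0_conj // ltW.
set r := `|d u v| ^+ 2 / d v v.
have r0 : 0 <= r by rewrite divr_ge0 ?exprn_ge0 // ltW.
have E : d u ((d u v / d v v) *: v) = r.
  rewrite linearZr_LR /= rmorphM /= fmorphV /= dvC mulrAC.
  by rewrite [_^* * _]mulrC -normCK.
have := dnorm_ge0 d (u - (d u v / d v v) *: v).
rewrite dnormB dnormZ /= E geC0_conj //.
rewrite normrM normfV (ger0_norm (ltW dv)) exprMn exprVn.
have -> : `|d u v| ^+ 2 / d v v ^+ 2 * d v v = r.
  by rewrite expr2 invfM mulrA mulfVK.
by rewrite opprD addrA addrK subr_ge0 ler_pdivrMr.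
Qed.

Lemma dotnorm_ge0 u : 0 <= dotnorm u.
Proof. exact: sqrt_dnorm_ge0. Qed.

Lemma dotnormD u v : dotnorm (u + v) <= dotnorm u + dotnorm v.
Proof.
rewrite -(@ler_pXn2r _ 2) ?nnegrE ?addr_ge0 ?dotnorm_ge0//.
rewrite sqrrD !sqrtCK dnormD -addrA [leRHS]addrAC -addrA lerD2l [leRHS]addrC.
rewrite [leRHS]addrC lerD2l.
have uv : `|d u v| <= dotnorm u * dotnorm v.
  rewrite -(@ler_pXn2r _ 2) ?nnegrE ?mulr_ge0 ?dotnorm_ge0//.
  by rewrite exprMn !sqrtCK dot_CauchySchwarz.
have re : d u v + (d u v)^* \is Num.real.
  by rewrite CrealE rmorphD /= conjCK addrC.
apply: (le_trans (real_ler_norm re)).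
apply: (le_trans (ler_normD _ _)).
by rewrite norm_conjC -mulr2n lerMn2r uv orbT.
Qed.

Lemma dotnormZ a u : dotnorm (a *: u) = `|a| * dotnorm u.
Proof.
rewrite /dotnorm dnormZ rootCMl ?exprn_ge0//.
by rewrite -[X in _ = X * _](@sqrCK _ `|a|).
Qed.

Lemma dotnorm_eq0 u : dotnorm u = 0 -> u = 0.
Proof. by move=> /eqP; rewrite sqrt_dnorm_eq0 => /eqP. Qed.
End PreHilbert.

Section Herm.
Variables (C : numClosedFieldType) (V : lmodType C) (f : V -> V -> C).
Hypothesis f_lin : forall w, scalar (f ^~ w).
Hypothesis f_conj : forall u v, f u v = (f v u)^*.

Lemma herm_bilinear : bilinear_for *%R (Num.conj \; *%R) f.
Proof.
split=> [w|u] a v w'; first exact: f_lin.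
by rewrite f_conj f_lin rmorphD rmorphM /= -!f_conj.
Qed.

Lemma herm_sym u v : f u v = (-1) ^+ false * (f v u)^*.
Proof. by rewrite mul1r. Qed.
End Herm.
(* Complex Hilbert spaces.  As in [sesquilinear], the inner product is linear in
   its first argument and conjugate linear in the second one. *)
HB.mixin Record isHilbert (R : realType) H of CompleteNormedModule R[i] H := {
  innerp : {dot H for Num.conj};
  normr_innerp : forall u : H, `|u| ^+ 2 = innerp u u }.

#[short(type="hilbertType")]
HB.structure Definition Hilbert (R : realType) :=
  {H of CompleteNormedModule R[i] H & isHilbert R H}.

Section ComplexComplete.
Variable R : realType.

(* [R[i]^o] already has an (R-based, hence unusable here) completeness instance
   attached to [^o], so the normed structure is transferred to [R[i]] itself. *)
HB.instance Definition _ := NormedModule.copy R[i] R[i]^o.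

Local Notation toC := (fun x : R => x%:C%C).

Definition nsq (z : R[i]) : R := complex.Re z ^+ 2 + complex.Im z ^+ 2.

Lemma nsqE (z : R[i]) : (nsq z)%:C%C = `|z| ^+ 2.
Proof. by rewrite normc_def -rmorphXn /= sqr_sqrtr ?addr_ge0 ?sqr_ge0. Qed.

Lemma nsq_ge0 z : 0 <= nsq z. Proof. by rewrite addr_ge0 ?sqr_ge0. Qed.

Lemma normc_lt_nsq z (e : R) : 0 <= e -> (nsq z < e ^+ 2) = (`|z| < e%:C%C).
Proof.
move=> e0; have e0c : 0 <= e%:C%C by rewrite -[0]/(0%:C%C) lecR.
by rewrite -(@ltr_pXn2r _ 2 _ `|z|) ?nnegrE// -nsqE -rmorphXn /= ltcR.
Qed.

Lemma normc_ge_Im (z : R[i]) : `|complex.Im z|%:C%C <= `|z|.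
Proof.
have := normc_ge_Re (z * 'i%C); rewrite normrM [`|'i%C|]normc_def /=.
rewrite expr0n expr1n add0r sqrtr1 mulr1.
by case: z => a b /=; rewrite mulr0 mulr1 sub0r normrN.
Qed.

Lemma coord_cvg (H : normedModType R[i]) (F : set_system H) (phi : H -> R) :
    ProperFilter F -> cauchy F ->
    (forall x y, `|phi x - phi y|%:C%C <= `|x - y|) ->
  cvg (phi @ F).
Proof.
move=> FF /cauchyP Fc phiL.
apply: R_complete; apply/cauchyP => e e0.
have [|x Fx] := Fc e%:C%C; first by rewrite ltcR.
exists (phi x); suff : F (phi @^-1` ball (phi x) e) by [].
apply: filterS Fx => y; rewrite -!ball_normE /= => xy.
by rewrite -ltcR; exact: le_lt_trans (phiL _ _) xy.
Qed.

Lemma Re_lip (x y : R[i]) : `|complex.Re x - complex.Re y|%:C%C <= `|x - y|.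
Proof. by rewrite (le_trans _ (normc_ge_Re _))// raddfB. Qed.

Lemma Im_lip (x y : R[i]) : `|complex.Im x - complex.Im y|%:C%C <= `|x - y|.
Proof. by rewrite (le_trans _ (normc_ge_Im _))// raddfB. Qed.

Lemma complex_complete (F : set_system R[i]) :
  ProperFilter F -> cauchy F -> cvg F.
Proof.
move=> FF Fc.
have /cvg_ex[a aF] := coord_cvg FF Fc Re_lip.
have /cvg_ex[b bF] := coord_cvg FF Fc Im_lip.
apply/cvg_ex; exists (a +i* b)%C; apply/(@cvgrPdist_lt R[i] R[i]) => -[e e'] /=.
rewrite ltcE /= => /andP[/eqP-> e0].
have e20 : 0 < e / 2 by rewrite divr_gt0.
move/cvgrPdist_lt : aF => /(_ _ e20) Fa.
move/cvgrPdist_lt : bF => /(_ _ e20) Fb.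
near=> y.
have ay : `|a - complex.Re y| < e / 2 by near: y; exact: Fa.
have bY : `|b - complex.Im y| < e / 2 by near: y; exact: Fb.
change (`|((a +i* b)%C - y : R[i])| < e%:C%C).
rewrite -normc_lt_nsq ?ltW//.
have -> : nsq ((a +i* b)%C - y) = `|a - complex.Re y| ^+ 2 + `|b - complex.Im y| ^+ 2.
  by rewrite /nsq !raddfB /= !real_normK ?num_real.
have E (x : R) : `|x| < e / 2 -> `|x| ^+ 2 < e ^+ 2 / 2.
  move=> xe; have : `|x| ^+ 2 < (e / 2) ^+ 2.
    by rewrite ltr_pXn2r ?nnegrE ?normr_ge0// ltW.
  have : 0 < e ^+ 2 by rewrite exprn_gt0.
  by rewrite expr_div_n -natrX; lra.
by have := E _ ay; have := E _ bY; lra.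
Unshelve. all: by end_near. Qed.

HB.instance Definition _ := Uniform_isComplete.Build R[i] complex_complete.

Definition complex_ip (z w : R[i]) : R[i] := z * w^*.

Let ip_lin w : scalar (complex_ip ^~ w).
Proof. by move=> a u v; rewrite /complex_ip mulrDl -mulrA. Qed.

Let ip_conj z w : complex_ip z w = (complex_ip w z)^*.
Proof.
suff E (x y : R[i]) : x * y^* = (y * x^*)^* by exact: E.
by rewrite rmorphM /= conjCK mulrC.
Qed.

Let ip_gt0 z : z != 0 -> 0 < complex_ip z z.
Proof.
suff E (x : R[i]) : x != 0 -> 0 < x * x^* by exact: E.
by move=> z0; rewrite -normCK exprn_gt0// normr_gt0.
Qed.

HB.instance Definition _ := bilinear_isBilinear.Build _ _ _ _ _ _ complex_ip
  (herm_bilinear ip_lin ip_conj).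
HB.instance Definition _ := isHermitianSesquilinear.Build _ _ false Num.conj
  complex_ip (herm_sym ip_conj).
HB.instance Definition _ := isDotProduct.Build _ _ complex_ip ip_gt0.

Let ip_norm (z : R[i]) : `|z| ^+ 2 = complex_ip z z.
Proof. exact: normCK. Qed.

HB.instance Definition _ := isHilbert.Build R R[i] ip_norm.
End ComplexComplete.


Section ell2.
Variable R : realType.
Implicit Types (a b : nat -> R) (c : R[i]) (x y : nat -> R[i]).
Local Notation Re := (@complex.Re R).
Local Notation Im := (@complex.Im R).

Definition csummable x := cvgn (series (Re \o x)) /\ cvgn (series (Im \o x)).

Definition csum x : R[i] :=
  (limn (series (Re \o x)) +i* limn (series (Im \o x)))%C.

Definition ell2_pred : {pred nat -> R[i]} :=
  fun x => `[< cvgn (series (fun n => nsq (x n))) >].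

Let dom_cvg a b : (forall n, `|a n| <= b n) ->
  cvgn (series b) -> cvgn (series a).
Proof.
move=> ab cb; apply: normed_cvg; apply: (series_le_cvg _ _ _ cb) => n //=.
exact: le_trans (ab n).
Qed.

Let limP (p q r : R) a b (d : nat -> R) :
  cvgn (series a) -> cvgn (series b) -> cvgn (series d) ->
  cvgn (series (p *: a + q *: b + r *: d)) /\
  limn (series (p *: a + q *: b + r *: d)) =
    p * limn (series a) + q * limn (series b) + r * limn (series d).
Proof.
move=> ca cb cd; rewrite !seriesD.
have ca' := is_cvg_seriesZ (k := p) ca.
have cb' := is_cvg_seriesZ (k := q) cb.
have cd' := is_cvg_seriesZ (k := r) cd.
have cab : cvgn (series (p *: a) + series (q *: b)) by apply: (is_cvgD ca' cb').
split; first by apply: (is_cvgD cab cd').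
by rewrite (limD cab cd') (limD ca' cb') (lim_seriesZ p ca) (lim_seriesZ q cb) (lim_seriesZ r cd).
Qed.

Let ReP c x y : Re \o (fun n => c * x n + y n) =
  Re c *: (Re \o x) + (- Im c) *: (Im \o x) + 1 *: (Re \o y).
Proof.
apply/funext => n; rewrite !fctE /=; case: c (x n) (y n) => [p q] [? ?] [? ?] /=.
by rewrite /GRing.scale /= mul1r mulNr.
Qed.

Let ImP c x y : Im \o (fun n => c * x n + y n) =
  Re c *: (Im \o x) + Im c *: (Re \o x) + 1 *: (Im \o y).
Proof.
apply/funext => n; rewrite !fctE /=; case: c (x n) (y n) => [p q] [? ?] [? ?] /=.
by rewrite /GRing.scale /= mul1r.
Qed.

Lemma csumP c x y : csummable x -> csummable y ->
  csum (fun n => c * x n + y n) = c * csum x + csum y.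
Proof.
move=> [rx ix] [ry iy]; rewrite /csum ReP ImP.
rewrite (limP _ _ _ rx ix ry).2 (limP _ _ _ ix rx iy).2.
by case: c => p q; rewrite !mul1r /= mulNr.
Qed.

Lemma csum_conj x : csummable x -> csum (fun n => (x n)^*) = (csum x)^*.
Proof.
move=> [rx ix]; rewrite /csum.
have -> : Re \o (fun n => (x n)^*) = Re \o x.
  by apply/funext => n /=; case: (x n).
have -> : Im \o (fun n => (x n)^*) = (- 1) *: (Im \o x).
  by apply/funext => n; rewrite !fctE /=; case: (x n) => p q /=; rewrite /GRing.scale /= mulN1r.
by rewrite lim_seriesZ// /GRing.scale /= mulN1r.
Qed.

Let nsqD (z w : R[i]) : nsq (z + w) <= 2 * nsq z + 2 * nsq w.
Proof.
case: z w => [p q] [r s]; rewrite /nsq /=.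
have := sqr_ge0 (p - r); have := sqr_ge0 (q - s); nra.
Qed.

Let nsqM (z w : R[i]) : nsq (z * w) = nsq z * nsq w.
Proof. case: z w => [p q] [r s]; rewrite /nsq /=; ring. Qed.

Fact ell2_closed : submod_closed ell2_pred.
Proof.
split.
  apply/asboolP; rewrite (_ : series _ = cst 0); first exact: is_cvg_cst.
  by apply/funext => n; rewrite /series /= big1// => i _; rewrite /nsq/= expr0n addr0.
move=> c x y /asboolP cx /asboolP cy; apply/asboolP.
have [h _] := limP (2 * nsq c) 2 0 cx cy cy.
apply: dom_cvg h => n; rewrite ger0_norm ?nsq_ge0// !fctE.
by rewrite (le_trans (nsqD _ _))// nsqM /GRing.scale /= mul0r addr0 mulrA.
Qed.

HB.instance Definition _ :=
  GRing.isSubmodClosed.Build _ _ ell2_pred ell2_closed.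

Record ell2 :=
  Ell2 { ell2_val :> nat -> R[i]; ell2_valP : ell2_val \in ell2_pred }.
HB.instance Definition _ := [isSub for ell2_val].
HB.instance Definition _ := [Choice of ell2 by <:].
HB.instance Definition _ := [SubChoice_isSubLmodule of ell2 by <:].
Implicit Types u v w : ell2.

Definition ell2_ip u v : R[i] := csum (fun n => u n * (v n)^*).

Let ip_summable u v : csummable (fun n => u n * (v n)^*).
Proof.
have /asboolP cu := ell2_valP u; have /asboolP cv := ell2_valP v.
have [h _] := limP 1 1 0 cu cv cu.
split; apply: dom_cvg h => n; rewrite !fctE /GRing.scale /= mul0r addr0 !mul1r.
  case: (u n) (v n) => [p q] [r s]; rewrite /nsq /=.
  have := (sqr_ge0 (p - r), sqr_ge0 (q - s), sqr_ge0 (p + r), sqr_ge0 (q + s)).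
  by case=> -[[? ?] ?] ?; rewrite ler_norml; apply/andP; split; nra.
case: (u n) (v n) => [p q] [r s]; rewrite /nsq /=.
have := (sqr_ge0 (p - s), sqr_ge0 (q - r), sqr_ge0 (p + s), sqr_ge0 (q + r)).
by case=> -[[? ?] ?] ?; rewrite ler_norml; apply/andP; split; nra.
Qed.

Let ip_lin w : scalar (ell2_ip ^~ w).
Proof.
move=> c u v; rewrite /ell2_ip -csumP //.
by congr csum; apply/funext => n /=; rewrite mulrDl -mulrA.
Qed.

Let ip_conj u v : ell2_ip u v = (ell2_ip v u)^*.
Proof.
rewrite /ell2_ip -csum_conj//; congr csum; apply/funext => n.
by rewrite rmorphM /= conjCK mulrC.
Qed.

Definition ell2_normsq u : R := limn (series (fun n => nsq (u n))).

Lemma ell2_ip_self u : ell2_ip u u = (ell2_normsq u)%:C%C.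
Proof.
rewrite /ell2_ip /csum; congr (_ +i* _)%C.
  congr (limn (series _)); apply/funext => n /=.
  by case: (u n) => p q; rewrite /nsq /= mulrN opprK.
rewrite (_ : series _ = cst 0); first exact: lim_cst.
apply/funext => n; rewrite /series /= big1// => i _.
by case: (u i) => p q /=; rewrite mulrN mulrC addNr.
Qed.

Let series_ge0 (a : nat -> R) : (forall n, 0 <= a n) ->
  {homo series a : m n / (m <= n)%N >-> m <= n}.
Proof. by move=> a0; apply: nondecreasing_series => n _ _. Qed.

Lemma ell2_partial u n : series (fun n => nsq (u n)) n <= ell2_normsq u.
Proof.
have /asboolP cu := ell2_valP u.
by apply: nondecreasing_cvgn_le => //; apply: series_ge0 => k; exact: nsq_ge0.
Qed.

Lemma ell2_coord u n : nsq (u n) <= ell2_normsq u.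
Proof.
apply: le_trans (ell2_partial u n.+1).
rewrite /series /= big_nat_recr//= lerDr.
by apply: sumr_ge0 => i _; exact: nsq_ge0.
Qed.

Let ip_gt0 u : u != 0 -> 0 < ell2_ip u u.
Proof.
move=> u0; rewrite ell2_ip_self ltcR lt_neqAle.
rewrite (le_trans (nsq_ge0 _) (ell2_coord u 0)) andbT.
apply: contra_neq u0 => un0; apply: val_inj; apply/funext => n /=.
have := ell2_coord u n; rewrite -un0 => le0.
have /eqP := nsqE (u n).
have -> : nsq (u n) = 0 by apply/eqP; rewrite eq_le le0 nsq_ge0.
by rewrite eq_sym expf_eq0 /= normr_eq0 => /eqP.
Qed.

HB.instance Definition _ := bilinear_isBilinear.Build _ _ _ _ _ _ ell2_ip
  (herm_bilinear ip_lin ip_conj).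
HB.instance Definition _ := isHermitianSesquilinear.Build _ _ false Num.conj
  ell2_ip (herm_sym ip_conj).
HB.instance Definition _ := isDotProduct.Build _ _ ell2_ip ip_gt0.

HB.instance Definition _ := Lmodule_isNormed.Build R[i] ell2
  (@dotnormD _ _ ell2_ip) (@dotnormZ _ _ ell2_ip) (@dotnorm_eq0 _ _ ell2_ip).

Let ip_norm u : `|u| ^+ 2 = ell2_ip u u.
Proof. exact: sqrtCK. Qed.

Lemma ell2_normsqE u : `|u| ^+ 2 = (ell2_normsq u)%:C%C.
Proof. by rewrite ip_norm ell2_ip_self. Qed.

Lemma ell2_norm_lt u (e : R) : 0 <= e ->
  (`|u| < e%:C%C) = (ell2_normsq u < e ^+ 2).
Proof.
move=> e0; have e0c : 0 <= e%:C%C by rewrite -[0]/(0%:C%C) lecR.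
by rewrite -(@ltr_pXn2r _ 2) ?nnegrE// ell2_normsqE -rmorphXn /= ltcR.
Qed.

Lemma ell2_norm_le u (e : R) : 0 <= e ->
  (`|u| <= e%:C%C) = (ell2_normsq u <= e ^+ 2).
Proof.
move=> e0; have e0c : 0 <= e%:C%C by rewrite -[0]/(0%:C%C) lecR.
by rewrite -(@ler_pXn2r _ 2) ?nnegrE// ell2_normsqE -rmorphXn /= lecR.
Qed.

Let coord_norm u n : `|u n| <= `|u|.
Proof.
by rewrite -(@ler_pXn2r _ 2) ?nnegrE// ell2_normsqE -nsqE lecR ell2_coord.
Qed.

Lemma ell2_complete (F : set_system ell2) : ProperFilter F -> cauchy F -> cvg F.
Proof.
move=> FF Fc.
have cRe n : cvg ((fun y : ell2 => Re (y n)) @ F).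
  apply: (coord_cvg FF Fc) => u v.
  exact: le_trans (Re_lip _ _) (coord_norm (u - v) n).
have cIm n : cvg ((fun y : ell2 => Im (y n)) @ F).
  apply: (coord_cvg FF Fc) => u v.
  exact: le_trans (Im_lip _ _) (coord_norm (u - v) n).
pose l n : R[i] := (lim ((fun y : ell2 => Re (y n)) @ F) +i*
                    lim ((fun y : ell2 => Im (y n)) @ F))%C.
have bnd u (e : R) : 0 < e -> F (ball u e%:C%C) ->
    forall N, series (fun n => nsq (u n - l n)) N <= e ^+ 2.
  move=> e0 Fu N.
  have cN : (fun y : ell2 => series (fun n => nsq (u n - y n)) N) @ F -->
      series (fun n => nsq (u n - l n)) N.
    rewrite /series /=.
    apply: cvg_big => [|n _]; first exact: add_continuous.
    have nsqB (z w : R[i]) : nsq (z - w) =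
        (Re z - Re w) * (Re z - Re w) + (Im z - Im w) * (Im z - Im w).
      by rewrite /nsq !raddfB /= !expr2.
    have -> : (fun y : ell2 => nsq (u n - y n)) =
      (fun y : ell2 => (Re (u n) - Re (y n)) * (Re (u n) - Re (y n)) +
                       (Im (u n) - Im (y n)) * (Im (u n) - Im (y n))).
      by apply/funext => y; rewrite nsqB.
    rewrite nsqB /=.
    have hR : (fun y : ell2 => Re (u n) - Re (y n)) @ F -->
        Re (u n) - lim ((fun y : ell2 => Re (y n)) @ F).
      by apply: cvgB; [exact: cvg_cst | exact: cRe].
    have hI : (fun y : ell2 => Im (u n) - Im (y n)) @ F -->
        Im (u n) - lim ((fun y : ell2 => Im (y n)) @ F).
      by apply: cvgB; [exact: cvg_cst | exact: cIm].
    have := cvgD (cvgM hR hR) (cvgM hI hI).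
    by move=> h; exact: h.
  rewrite -(cvg_lim (@Rhausdorff R) cN); apply: (limr_le (cvgP _ cN)).
  apply: filterS Fu => y; rewrite -ball_normE /= (ell2_norm_lt _ (ltW e0)).
  by move=> /ltW; apply: le_trans; exact: (ell2_partial (u - y)).
have lim_bnd u (e : R) : 0 < e -> F (ball u e%:C%C) ->
    exists L : ell2, (L : nat -> R[i]) = l /\ `|u - L| <= e%:C%C.
  move=> e0 Fu; have b := bnd u e e0 Fu.
  have c : cvgn (series (fun n => nsq (u n - l n))).
    apply: nondecreasing_is_cvgn; first by apply: series_ge0 => n; exact: nsq_ge0.
    by exists (e ^+ 2) => _ [N _ <-]; exact: b.
  have ul : (fun n => u n - l n) \in ell2_pred by apply/asboolP.
  have lP : l \in ell2_pred.
    have := rpredB (ell2_valP u) ul.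
    by rewrite (_ : _ - _ = l)//; apply/funext => n; rewrite !fctE subKr.
  exists (Ell2 lP); split => //; rewrite (ell2_norm_le _ (ltW e0)).
  by apply: limr_le => //; near=> N; exact: b.
have [u1 Fu1] : exists u, F (ball u 1%:C%C).
  by move/cauchyP : Fc; apply; rewrite ltcR.
have [L [Ll _]] := lim_bnd u1 1 ltr01 Fu1.
apply/cvg_ex; exists L; apply/cvgrPdist_lt => -[e e'] /=.
rewrite ltcE /= => /andP[/eqP-> e0].
have e30 : 0 < e / 3 by rewrite divr_gt0.
have [u Fu] : exists u, F (ball u (e / 3)%:C%C).
  by move/cauchyP : Fc; apply; rewrite ltcR.
have [L' [L'l uL']] := lim_bnd u _ e30 Fu.
have LL' : L' = L by apply: val_inj; rewrite /= Ll.
rewrite {L' L'l}LL' in uL'.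
apply: filterS Fu => y; rewrite -ball_normE /= => uy.
rewrite -(subrKA u) (le_lt_trans (ler_normD _ _))// distrC.
rewrite (lt_trans (ler_ltD uL' uy))// -rmorphD ltcR /=; lra.
Unshelve. all: by end_near. Qed.

HB.instance Definition _ := Uniform_isComplete.Build ell2 ell2_complete.
HB.instance Definition _ := isHilbert.Build R ell2 ip_norm.

End ell2.

Section BoundedOperators.
Variables (R : realType) (H K : hilbertType R).

Definition bop_pred : {pred H -> K} := fun T =>
  `[< linear T /\ exists M : R, forall u, `|T u| <= M%:C%C * `|u| >].

Fact bop_closed : submod_closed bop_pred.
Proof.
split.
  have z u : (0 : H -> K) u = 0 by [].
  apply/asboolP; split; first by move=> a u v; rewrite !z scaler0 addr0.
  by exists 0 => u; rewrite z normr0 mul0r.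
move=> a S T /asboolP[Sl [M SM]] /asboolP[Tl [N TN]]; apply/asboolP; split.
  move=> b u v; rewrite !fctE Sl Tl !scalerDr !scalerA [a * b]mulrC.
  by rewrite !addrA; congr (_ + _); rewrite -!addrA; congr (_ + _); rewrite addrC.
exists (complex.Re `|a| * M + N) => u; rewrite !fctE.
have ra : (complex.Re `|a|)%:C%C = `|a| by rewrite normc_def.
rewrite rmorphD rmorphM /= ra mulrDl -mulrA.
rewrite (le_trans (ler_normD _ _))// normrZ lerD//.
by rewrite ler_wpM2l.
Qed.

HB.instance Definition _ :=
  GRing.isSubmodClosed.Build _ _ bop_pred bop_closed.

Record bop := Bop { bop_fun :> H -> K; bopP : bop_fun \in bop_pred }.
HB.instance Definition _ := [isSub for bop_fun].
HB.instance Definition _ := [Choice of bop by <:].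
HB.instance Definition _ := [SubChoice_isSubLmodule of bop by <:].

(* The unit ball is not empty and [T] is bounded, so that [sup] is meaningful. *)
Definition opnorm (T : bop) : R :=
  sup [set complex.Re `|T u| | u in [set u : H | `|u| <= 1]].

Definition supnorm (T : nat -> bop) : \bar R :=
  ereal_sup (range (fun n => (opnorm (T n))%:E)).

End BoundedOperators.

Section Schatten.
Variable R : realType.

Fact delta_ell2 (n : nat) : (fun k => (k == n)%:R) \in @ell2_pred R.
Proof.
apply/asboolP; apply: nondecreasing_is_cvgn.
  by apply: nondecreasing_series => k _ _; exact: nsq_ge0.
exists 1 => _ [N _ <-]; rewrite /series /=.
have [nN|Nn] := ltnP n N.
  rewrite (bigD1_seq n) ?mem_index_iota ?iota_uniq//= eqxx big1; last first.
    by move=> k /negbTE->; rewrite /nsq /= expr0n /= addr0.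
  by rewrite /nsq /= expr1n expr0n !addr0.
rewrite big_nat big1 ?ler01// => k kN.
by rewrite (_ : _ == _ = false) ?/nsq /= ?expr0n ?addr0//; apply/ltn_eqF/(leq_trans kN).
Qed.

Definition ebasis n : ell2 R := Ell2 (delta_ell2 n).

Local Notation B := (bop (ell2 R) (ell2 R)).

(* [p = (x^* x)^(1/2)]: [p] is positive (hence self-adjoint, the scalars being
   complex) and [p^2 = x^* x].  Such a [p] exists and is unique, so the default
   value of [xget] below is never used. *)
Definition is_absop (x p : B) :=
  (forall u, 0 <= innerp (p u) u) /\
  (forall u v, innerp (p (p u)) v = innerp (x u) (x v)).

Definition absop (x : B) : B := xget 0 [set p | is_absop x p].

(* tr|x|; the trace class is [trnorm x < +oo]. *)
Definition trnorm (x : B) : \bar R :=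
  (\sum_(0 <= n <oo) (complex.Re (innerp (absop x (ebasis n)) (ebasis n)))%:E)%E.

Definition hsnorm (x : B) : \bar R :=
  sqrte (\sum_(0 <= n <oo) ((complex.Re `|x (ebasis n)|) ^+ 2)%:E)%E.

End Schatten.

Section Hardy.
Variable R : realType.
Local Notation B := (bop (ell2 R) (ell2 R)).
Local Notation mu := (@lebesgue_measure R).

(* The unit circle with normalized Lebesgue measure is parametrized by
   t |-> exp(2 i pi t) on [0, 1]; functions on the circle are represented by
   functions on [R[i]] whose values off the circle are irrelevant. *)
Definition unit_itv : set R := `[0, 1].

Definition circ (t : R) : R[i] := (cos (2 * pi * t) +i* sin (2 * pi * t))%C.

Definition circle_int (F : R[i] -> R[i]) : R[i] :=
  ((\int[mu]_(t in unit_itv) complex.Re (F (circ t))) +i*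
   (\int[mu]_(t in unit_itv) complex.Im (F (circ t))))%C.

(* S_1 and S_2 are separable and their norms are suprema of countably many
   |finite linear combinations of matrix coefficients|, so (Pettis) weak and
   strong measurability agree for S_p-valued functions, and all the norm functions
   integrated below are measurable. *)
Definition weakly_measurable (f : R[i] -> B) := forall u v : ell2 R,
  measurable_fun unit_itv (fun t => complex.Re (innerp (f (circ t) u) v)) /\
  measurable_fun unit_itv (fun t => complex.Im (innerp (f (circ t) u) v)).

Definition H1norm (f : R[i] -> B) : \bar R :=
  (\int[mu]_(t in unit_itv) trnorm (f (circ t)))%E.

Definition H2norm (f : R[i] -> B) : \bar R :=
  sqrte (\int[mu]_(t in unit_itv) (hsnorm (f (circ t)) ^+ 2))%E.

Definition analytic_poly (N : B -> \bar R) (P : R[i] -> B) :=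
  exists (d : nat) (a : nat -> B),
    (forall n, (N (a n) < +oo)%E) /\
    P = (fun z => \sum_(n < d) z ^+ n *: a n).

(* The completion of the analytic polynomials, realized inside L^p(m; S_p) as the
   closure of the S_p-valued analytic polynomials.  Its elements are actual
   functions; equality almost everywhere is used where it matters
   (see [factorization]). *)
Definition hardy (N : B -> \bar R) (norm : (R[i] -> B) -> \bar R) :
    set (R[i] -> B) :=
  [set f | weakly_measurable f /\
    exists P : nat -> R[i] -> B, (forall j, analytic_poly N (P j)) /\
      norm (fun z => f z - P j z) @[j --> \oo] --> 0%E].

Definition H1S1 := hardy (@trnorm R) H1norm.
Definition H2S2 := hardy (@hsnorm R) H2norm.

(* [a n] is the n-th Fourier coefficient of [f], as a weak integral. *)
Definition has_fourier (f : R[i] -> B) (a : nat -> B) :=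
  forall n (u v : ell2 R),
    innerp (a n u) v = circle_int (fun z => (z^*) ^+ n * innerp (f z u) v).

Definition factorization (x : nat -> R[i] -> B) (g : R[i] -> B)
    (y : nat -> B) (h : R[i] -> B) := forall k,
  {ae mu, forall t, unit_itv t ->
    forall u, x k (circ t) u = g (circ t) (y k (h (circ t) u))}.

(* [c] is an admissible bound: "|||(x_k)||| < c".  The convention 0 * +oo = 0 of
   [\bar R] only matters when g or h is 0, i.e. when all the x_k vanish. *)
Definition facnorm_lt (x : nat -> R[i] -> B) (c : R) := exists g y h,
  [/\ H2S2 g, H2S2 h, factorization x g y h &
      (H2norm g * supnorm y * H2norm h < c%:E)%E].

Definition facnorm (x : nat -> R[i] -> B) : \bar R :=
  ereal_inf [set c%:E | c in facnorm_lt x].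

(* [w k] is the element of H^1(S_1) with Fourier coefficients phi(n + k) x_k^(n),
   i.e. \bar z^k M_phi(z^k x_k); it is unique up to equality a.e. *)
Definition is_mult (phi : nat -> R[i]) (x w : nat -> R[i] -> B) := forall k,
  H1S1 (w k) /\ exists2 a, has_fourier (x k) a &
    has_fourier (w k) (fun n => phi (n + k)%N *: a n).

(* +oo, as the infimum of the empty set, when there is no such [w]. *)
Definition mult_facnorm phi (x : nat -> R[i] -> B) : \bar R :=
  ereal_inf [set facnorm w | w in is_mult phi x].

Definition calM3_norm (phi : nat -> R[i]) : \bar R :=
  ereal_sup [set mult_facnorm phi x |
    x in [set x | (forall k, H1S1 (x k)) /\ facnorm_lt x 1]].

(* [R[i]] is the one-dimensional Hilbert space H_0 = H_3; a bounded operator T on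
   it is identified with the scalar [T 1]. *)
Definition M3_rep (phi : nat -> R[i]) (H1 H2 : hilbertType R)
    (xi1 : nat -> bop H1 R[i]) (xi2 : nat -> bop H2 H1)
    (xi3 : nat -> bop R[i] H2) :=
  [/\ (supnorm xi1 < +oo)%E, (supnorm xi2 < +oo)%E, (supnorm xi3 < +oo)%E &
    forall t1 t2 t3 : nat,
      phi (t1 + t2 + t3)%N = xi1 t1 (xi2 t2 (xi3 t3 1))].

Definition M3_norm (phi : nat -> R[i]) : \bar R :=
  ereal_inf [set c | exists H1 H2 xi1 xi2 xi3,
    @M3_rep phi H1 H2 xi1 xi2 xi3 /\
    c = (supnorm xi1 * supnorm xi2 * supnorm xi3)%E].

End Hardy.

(* Main.v *)
Require Import Defs.
From mathcomp Require Import all_boot all_order all_algebra.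
From mathcomp Require Import all_classical all_reals all_analysis.
From mathcomp Require Import measurable_realfun complex.
From mathcomp Require Import ring lra.

(** Both inequalities rest on a description of M_3(N) by positive kernels.  A factorization
phi(i + k + j) = xi_1(i) xi_2(k) xi_3(j) is encoded by the Gram kernel K3 of the vectors xi_3(j)1
and the Gram kernel K2 of the vectors xi_2(k) xi_3(j)1, indexed by pairs (k, j): xi_2(k) is a
contraction when the k-th diagonal block of K2 is dominated by K3, and xi_1(i) is bounded when
|sum c_kj phi(i + k + j)|^2 <= al_i K2(c, c).  Such kernels can be averaged and have limits
([kernel_rep_convex], [kernel_rep_limit]), and the Gram-Schmidt process turns them into a row A_i,
a contraction matrix B_k and a column D_j with phi(i + k + j) = A_i B_k D_j
([kernel_rep_matrix]), so that all the Hilbert spaces may be taken to be ell_2.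

The multiplier norm is at most the norm of M_3 ([multiplier_bound]).  Let x_k = g y_k h, and let
g_p, h_q be the Fourier coefficients of g and h.  The functions G and H with coefficients
A_p (x) g_p and D_q (x) h_q, and the operators Y_k = B_k (x) y_k, satisfy
G_p Y_k H_q = phi(p + k + q) g_p y_k h_q.  In the coefficient of index n of G Y_k H one has
p + q = n, so the factor phi(n + k) comes out of the sum: G Y_k H is the image of x_k,
and the norms of the factors have been multiplied by those of A, B and D.  This uses that elements of
H^2(S_2) correspond to square-summable sequences of coefficients ([H2S2_coefficients],
[operator_riesz_fischer]), and that a product of two of them belongs to H^1(S_1) and has the
convolution as coefficients ([product_H1S1], [product_fourier]).

Conversely, let the multiplier norm be less than c, and choose positive weights la_i, ga_j with sum 1
for i, j < N.  Apply the hypothesis to y_k = 1, g = sum of sqrt(la_i) z^i e_(i,0) and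
h = sum of sqrt(ga_j) z^j e_(0,j), with g divided by some rho > 1.  The multiplied functions are
w_k = G Y_k H, and phi(i + k + j) sqrt(la_i ga_j) / rho is the integral of conj(z)^(i+j) times the
entry (i, j) of w_k.  Hence the integrated Gram kernels of the vectors
conj(z)^j H e_j / sqrt(ga_j) and of their images under Y_k represent phi for i, j < N, with bounds
al, be satisfying sum la_i al_i <= rho c and sum ga_j be_j <= rho c ([kernel_of_bound]).  The set of
admissible bounds is convex and the weights are arbitrary, so a minimax argument
([minimax_convex]) gives al, be <= rho c + d at all indices, for every d > 0.  The bounds do not
depend on N, and the kernels have a limit as N grows ([M3_norm_le]). *)

Import numFieldNormedType.Exports.
Set Implicit Arguments. Unset Strict Implicit. Unset Printing Implicit Defensive.
Import Order.TTheory GRing.Theory Num.Theory.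
Local Open Scope classical_set_scope.
Local Open Scope ring_scope.

(** * Gram-Schmidt for semi-inner products *)

Section SemiInner.
Variables (C : numClosedFieldType) (V : lmodType C) (f : V -> V -> C).
Hypothesis f_lin : forall w, scalar (f ^~ w).
Hypothesis f_conj : forall u v, f u v = (f v u)^*.
Hypothesis f_ge0 : forall u, 0 <= f u u.

Lemma semiDl u v w : f (u + v) w = f u w + f v w.
Proof. by have := f_lin w 1 u v; rewrite scale1r mul1r. Qed.

Lemma semi0l w : f 0 w = 0.
Proof. by apply: (addrI (f 0 w)); rewrite -semiDl !addr0. Qed.

Lemma semiZl a u w : f (a *: u) w = a * f u w.
Proof. by have := f_lin w a u 0; rewrite !addr0 semi0l addr0. Qed.

Lemma semiBl u v w : f (u - v) w = f u w - f v w.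
Proof. by rewrite semiDl -scaleN1r semiZl mulN1r. Qed.

Lemma semi_suml (I : Type) (r : seq I) (P : pred I) (F : I -> V) w :
  f (\sum_(i <- r | P i) F i) w = \sum_(i <- r | P i) f (F i) w.
Proof.
elim/big_rec2: _ => [|i a b _ <-]; first exact: semi0l.
by rewrite semiDl.
Qed.

Lemma semi0r w : f w 0 = 0.
Proof. by rewrite f_conj semi0l rmorph0. Qed.

Lemma semiZr a u w : f u (a *: w) = a^* * f u w.
Proof. by rewrite f_conj semiZl rmorphM /= -f_conj. Qed.

Lemma semiBr u v w : f u (v - w) = f u v - f u w.
Proof. by rewrite f_conj semiBl rmorphB /= -!f_conj. Qed.

Lemma semi_sumr (I : Type) (r : seq I) (P : pred I) (F : I -> V) w :
  f w (\sum_(i <- r | P i) F i) = \sum_(i <- r | P i) f w (F i).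
Proof.
by rewrite f_conj semi_suml rmorph_sum /=; apply: eq_bigr => i _; rewrite -f_conj.
Qed.

Lemma semi_real u : (f u u)^* = f u u.
Proof. by rewrite -f_conj. Qed.

(** When [f v v = 0] the usual division is impossible; then [u - (a * f u v) *: v] with [a] large
    has negative square unless [f u v = 0]. *)
Lemma semi_CS u v : `|f u v| ^+ 2 <= f u u * f v v.
Proof.
have [v0|v0] := eqVneq (f v v) 0.
  rewrite v0 mulr0.
  have [->|n0] := eqVneq (f u v) 0; first by rewrite normr0 expr0n.
  exfalso; have nn : 0 < `|f u v| ^+ 2 by rewrite exprn_gt0 ?normr_gt0.
  pose a := (f u u + 1) / `|f u v| ^+ 2.
  have a0 : 0 < a by rewrite divr_gt0 // ltr_wpDl // f_ge0.
  have := f_ge0 (u - (a * f u v) *: v).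
  have ca : a^* = a by rewrite geC0_conj // ltW.
  rewrite semiBl !semiBr !semiZl !semiZr v0 !mulr0 subr0 (f_conj v u) rmorphM /= ca.
  have -> : f u u - a * (f u v)^* * f u v - a * f u v * (f u v)^* = f u u - 2 * (a * `|f u v| ^+ 2).
    by rewrite normCK; ring.
  rewrite /a divfK ?gt_eqF// => h.
  have : 0 <= f u u - 2 * (f u u + 1) + f u u by rewrite addr_ge0.
  have -> : f u u - 2 * (f u u + 1) + f u u = - 2 by ring.
  by rewrite oppr_ge0 lern0.
have v1 : 0 < f v v by rewrite lt_neqAle eq_sym v0 f_ge0.
have := f_ge0 (u - (f u v / f v v) *: v).
rewrite semiBl !semiBr !semiZl !semiZr (f_conj v u) rmorphM /= fmorphV /= semi_real.
have -> : f u u - (f u v)^* / f v v * f u v - (f u v / f v v * (f u v)^* - f u v / f v v * ((f u v)^* / f v v * f v v)) = f u u - `|f u v| ^+ 2 / f v v.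
  by rewrite normCK; field.
by rewrite subr_ge0 ler_pdivrMr.
Qed.

Lemma semi_null u v : f u u = 0 -> f u v = 0.
Proof.
move=> u0; have := semi_CS u v; rewrite u0 mul0r => h.
have /eqP : `|f u v| ^+ 2 = 0 by apply/eqP; rewrite eq_le h exprn_ge0.
by rewrite expf_eq0 /= normr_eq0 => /eqP.
Qed.

Lemma semi_null_lin a u v : f u u = 0 -> f v v = 0 ->
  f (a *: u + v) (a *: u + v) = 0.
Proof. by move=> u0 v0; rewrite semiDl semiZl semi_null // (semi_null _ v0) mulr0 addr0. Qed.

(** Null vectors are sent to 0, so that the Gram-Schmidt process below accepts linearly dependent
    and null vectors: such steps just produce the zero vector. *)
Definition seminormalize (r : V) : V :=
  if f r r == 0 then 0 else (sqrtC (f r r))^-1 *: r.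

Variable v : nat -> V.

Fixpoint gs_seq n : seq V :=
  if n is m.+1 then
    let s := gs_seq m in
    rcons s (seminormalize (v m - \sum_(e <- s) f (v m) e *: e))
  else [::].

Definition gs n : V := last 0 (gs_seq n.+1).

Lemma gs_seqE n : gs_seq n = [seq gs i | i <- iota 0 n].
Proof.
elim: n => // n ih; rewrite -[n.+1 in RHS]addn1 iotaD map_cat /= add0n.
by rewrite -ih /gs /= last_rcons cats1.
Qed.

Definition gs_res n := v n - \sum_(i < n) f (v n) (gs i) *: gs i.

Lemma gsE n : gs n = seminormalize (gs_res n).
Proof.
by rewrite /gs /= last_rcons gs_seqE big_map -[n in iota 0 n]subn0 big_mkord.
Qed.

Lemma seminormalize_norm r : f (seminormalize r) (seminormalize r) = (f r r != 0)%:R.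
Proof.
rewrite /seminormalize; case: eqVneq => [_|h]; first by rewrite semi0l.
rewrite semiZl semiZr fmorphV /= geC0_conj ?sqrtC_ge0 // mulrA -invfM -expr2 sqrtCK.
by rewrite mulVf.
Qed.

Lemma gs_norm n : f (gs n) (gs n) = (gs n != 0)%:R.
Proof.
rewrite {1 2}gsE seminormalize_norm gsE /seminormalize.
case: eqVneq => [_|h]; first by rewrite eqxx.
rewrite scaler_eq0 invr_eq0 sqrtC_eq0 (negbTE h) /=.
have /negbTE-> // : gs_res n != 0.
by apply: contra_neq h => ->; rewrite semi0l.
Qed.

Lemma gs_orth_lt m n : (m < n)%N -> f (gs n) (gs m) = 0.
Proof.
elim/ltn_ind: n m => n ih m mn.
have orth i j : (i < n)%N -> (j < n)%N -> i != j -> f (gs i) (gs j) = 0.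
  move=> Hi Hj; rewrite neq_ltn => /orP[ij|ji]; last exact: ih.
  by rewrite f_conj ih // rmorph0.
rewrite gsE /seminormalize; case: ifP => _; first exact: semi0l.
rewrite semiZl; set s := _^-1; rewrite semiBl semi_suml (bigD1 (Ordinal mn)) //= semiZl big1.
  rewrite addr0 gs_norm; case: eqVneq => [->|_] /=.
    by rewrite semi0r mul0r subrr mulr0.
  by rewrite mulr1 subrr mulr0.
by move=> i im; rewrite semiZl orth ?mulr0.
Qed.

Lemma gs_orth m n : m != n -> f (gs n) (gs m) = 0.
Proof.
rewrite neq_ltn => /orP[|h]; first exact: gs_orth_lt.
by rewrite f_conj gs_orth_lt // rmorph0.
Qed.

Lemma gs_comb_le n (c : nat -> C) :
  f (\sum_(i < n) c i *: gs i) (\sum_(i < n) c i *: gs i) <= \sum_(i < n) `|c i| ^+ 2.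
Proof.
set w := \sum_(i < n) _; rewrite {1}/w semi_suml; apply: ler_sum => i _.
rewrite semiZl /w semi_sumr (bigD1 i) //= big1 => [|j ji]; last first.
  by rewrite semiZr gs_orth ?mulr0 //.
rewrite semiZr addr0 mulrA -normCK -[leRHS]mulr1 ler_wpM2l ?exprn_ge0 //.
by rewrite gs_norm; case: (_ != _).
Qed.

Lemma gs_ind (P : V -> Prop) n : P 0 -> (forall a u w, P u -> P w -> P (a *: u + w)) ->
  (forall m, (m <= n)%N -> P (v m)) -> P (gs n).
Proof.
move=> P0 PD; elim/ltn_ind: n => n ih Pv; rewrite gsE /seminormalize.
case: ifP => _ //; rewrite -[_ *: _]addr0; apply: (PD) => //.
rewrite /gs_res addrC -scaleN1r; apply: (PD); last exact: Pv.
apply: big_ind => //; first by move=> x y Px Py; rewrite -[x]scale1r; apply: (PD).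
move=> i _; rewrite -[_ *: _]addr0; apply: (PD) => //; apply: ih => // m mi.
by apply: Pv; apply: leq_trans mi _; apply: ltnW.
Qed.

(** The orthogonal projection of [w], modulo null vectors, onto the span of [v 0, ..., v n.-1]. *)
Definition gs_proj n w := \sum_(i < n) f w (gs i) *: gs i.

Lemma gs_proj_dot n w m : f (gs_proj n w) (gs m) = if (m < n)%N then f w (gs m) else 0.
Proof.
rewrite semi_suml; case: ifP => [mn|/negbT mn].
  rewrite (bigD1 (Ordinal mn)) //= semiZl big1 => [|i im].
    rewrite addr0 gs_norm; case: eqVneq => [->|_]; last by rewrite mulr1.
    by rewrite semi0r mul0r.
  by rewrite semiZl gs_orth ?mulr0 // eq_sym.
apply: big1 => i _; rewrite semiZl gs_orth ?mulr0 // eq_sym.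
by apply: contraNneq mn => <-.
Qed.

Lemma gs_proj_norm n w : f (gs_proj n w) (gs_proj n w) = \sum_(i < n) `|f w (gs i)| ^+ 2.
Proof.
rewrite {2}/gs_proj semi_sumr; apply: eq_bigr => i _.
by rewrite semiZr gs_proj_dot ltn_ord mulrC normCK.
Qed.

Lemma gs_proj_norm_r n w : f w (gs_proj n w) = \sum_(i < n) `|f w (gs i)| ^+ 2.
Proof.
rewrite /gs_proj semi_sumr; apply: eq_bigr => i _.
by rewrite semiZr mulrC normCK.
Qed.

Lemma gs_bessel n w : \sum_(i < n) `|f w (gs i)| ^+ 2 <= f w w.
Proof.
have := f_ge0 (w - gs_proj n w).
have h := gs_proj_norm_r n w.
have r : (f w (gs_proj n w))^* = f w (gs_proj n w).
  by rewrite h geC0_conj // sumr_ge0 // => i _; rewrite exprn_ge0.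
rewrite semiBl !semiBr gs_proj_norm (f_conj (gs_proj n w) w) r h subrr subr0.
by rewrite subr_ge0.
Qed.

(** The residual of step [n] is a multiple of [gs n], unless it is a null vector. *)
Lemma gs_res_null n : f (v n - gs_proj n.+1 (v n)) (v n - gs_proj n.+1 (v n)) = 0.
Proof.
rewrite /gs_proj big_ord_recr /= opprD addrA -/(gs_res n).
have re : f (v n) (gs n) = f (gs_res n) (gs n).
  rewrite /gs_res semiBl semi_suml big1 ?subr0 // => i _.
  by rewrite semiZl gs_orth ?mulr0 // neq_ltn ltn_ord orbT.
rewrite re gsE /seminormalize; case: eqVneq => [h|h].
  by rewrite scaler0 subr0.
rewrite semiZr fmorphV /= geC0_conj ?sqrtC_ge0 // scalerA mulrAC -invfM -expr2 sqrtCK.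
by rewrite mulVf // scale1r subrr semi0l.
Qed.

(** Up to a null vector, [v j] is a combination of [gs 0, ..., gs j], which are orthogonal to
    [gs m]. This triangularity is what makes all sums over matrix entries below finite. *)
Lemma gs_high j m : (j < m)%N -> f (v j) (gs m) = 0.
Proof.
move=> jm; have := semi_null (gs m) (gs_res_null j).
rewrite semiBl gs_proj_dot ltnS leqNgt jm /= subr0.
exact.
Qed.

Lemma gs_projS n w : gs_proj n.+1 w = gs_proj n w + f w (gs n) *: gs n.
Proof. by rewrite /gs_proj big_ord_recr. Qed.

Lemma gs_proj_null j n : (j < n)%N -> f (v j - gs_proj n (v j)) (v j - gs_proj n (v j)) = 0.
Proof.
elim: n => // n ih; rewrite ltnS leq_eqVlt => /orP[/eqP<-|jn]; first exact: gs_res_null.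
by rewrite gs_projS gs_high // scale0r addr0 ih.
Qed.

Lemma gs_proj_lin n a u w : gs_proj n (a *: u + w) = a *: gs_proj n u + gs_proj n w.
Proof.
rewrite /gs_proj scaler_sumr -big_split /=; apply: eq_bigr => i _.
by rewrite f_lin scalerDl scalerA.
Qed.

Lemma gs_proj_null_span n (c : nat -> C) :
  let w := \sum_(j < n) c j *: v j in
  f (w - gs_proj n w) (w - gs_proj n w) = 0.
Proof.
suff H : forall m, (m <= n)%N -> let w := \sum_(j < m) c j *: v j in
  f (w - gs_proj n w) (w - gs_proj n w) = 0 by exact: H.
elim=> [_ w|m ih mn w].
  rewrite /w big_ord0 /gs_proj big1 ?subrr ?semi0l // => i _.
  by rewrite semi0l scale0r.
have -> : w - gs_proj n w = c m *: (v m - gs_proj n (v m)) +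
  ((\sum_(j < m) c j *: v j) - gs_proj n (\sum_(j < m) c j *: v j)).
  rewrite /w big_ord_recr /= [in LHS]addrC gs_proj_lin scalerBr opprD addrACA.
  by rewrite [_ - _ + _]addrA.
by apply: semi_null_lin; [exact: gs_proj_null|apply: ih; exact: ltnW].
Qed.

End SemiInner.

(** * A minimax principle *)

Section Minimax.
Variables (R : realType) (I : finType).
Implicit Types s nu : I -> R.

Lemma pos_sqr_le (x y p : R) : x <= p -> 0 <= p -> Num.max (x + y) 0 ^+ 2 <= (p + y) ^+ 2.
Proof.
move=> xp p0; case: (leP (x + y) 0) => h; first by rewrite expr0n /= sqr_ge0.
by rewrite ler_pXn2r ?nnegrE ?(ltW h) //; lra.
Qed.

Lemma sum_sqr_le (p : I -> R) : (forall i, 0 <= p i) ->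
  \sum_i p i ^+ 2 <= (\sum_i p i) ^+ 2.
Proof.
move=> p0; rewrite expr2 mulr_suml; apply: ler_sum => i _.
rewrite expr2 ler_wpM2l // (bigD1 i) //= lerDl.
by apply: sumr_ge0.
Qed.

(** Otherwise the squared excess [Phi s] of [s] above [c' = c + d / 2] is at least [(d / 2) ^+ 2]
    on [S]. At a near-minimizer [s], use as weights the gradient of [Phi], shifted by a small [h]
    to be positive: the hypothesis gives a point [s'] of [S] towards which [Phi] decreases at a
    definite rate, and a short step from [s] to [s'] leads below the infimum of [Phi]. *)
Lemma minimax_convex (S : set (I -> R)) (c : R) : 0 <= c ->
  (forall s s' t, S s -> S s' -> 0 <= t <= 1 -> S (fun i => s i + t * (s' i - s i))) ->
  (forall s i, S s -> 0 <= s i) ->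
  (forall nu, (forall i, 0 < nu i) ->
     exists2 s, S s & \sum_i nu i * s i <= c * \sum_i nu i) ->
  forall d, 0 < d -> exists2 s, S s & forall i, s i <= c + d.
Proof.
move=> c0 Sconv S0 Snu d d0; apply: contrapT => nex.
pose c' := c + d / 2.
pose p s i := Num.max (s i - c') 0.
have p0 s i : 0 <= p s i by rewrite /p le_max lexx orbT.
have ps s i : s i - c' <= p s i by rewrite /p le_max lexx.
pose Phi s := \sum_i p s i ^+ 2.
have Phie s : S s -> (d / 2) ^+ 2 <= Phi s.
  move=> Ss; rewrite leNgt; apply/negP => lt; apply: nex; exists s => // i.
  have : p s i ^+ 2 <= (d / 2) ^+ 2.
    apply: le_trans (ltW lt); rewrite /Phi (bigD1 i) //= lerDl.
    by apply: sumr_ge0 => j _; rewrite sqr_ge0.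
  rewrite ler_pXn2r ?nnegrE ?p0 ?divr_ge0 ?(ltW d0) // => h.
  have := le_trans (ps s i) h; rewrite /c' => ?; lra.
have [s0 Ss0 _] := Snu (fun=> 1) (fun=> ltr01).
pose m := inf [set Phi s | s in S].
have lbS : has_lbound [set Phi s | s in S] by exists ((d / 2) ^+ 2) => _ [s Ss <-]; exact: Phie.
have hi : has_inf [set Phi s | s in S] by split => //; exists (Phi s0), s0.
have mle s : S s -> m <= Phi s by move=> Ss; apply: ge_inf => //; exists s.
have m0 : 0 <= m by apply: lb_le_inf; [exists (Phi s0), s0|move=> _ [s Ss <-]; apply: sumr_ge0 => i _; exact: sqr_ge0].
(* [k] is the rate of decrease to be found, [M] bounds the entries of the point s' and [D] those of
   s' - s; the step [th] is so small that the quadratic term of the increment is at most [th * k]. *)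
pose n : R := #|I|%:R.
have n0 : 0 <= n by rewrite ler0n.
pose B := m + 1.
pose k := d ^+ 2 / 8.
have k0 : 0 < k by rewrite divr_gt0 ?exprn_gt0.
pose h := k / (c * n + 1).
have cn1 : 0 < c * n + 1 by rewrite ltr_wpDl ?mulr_ge0.
have h0 : 0 < h by rewrite divr_gt0.
have ch : c * n * h <= k.
  rewrite /h mulrCA ger_pMr // ler_pdivrMr // mul1r; lra.
pose M := c * (n * B + n * h) / h.
have B0 : 0 <= B by rewrite /B addr_ge0.
have M0 : 0 <= M by rewrite /M divr_ge0 ?(ltW h0)// mulr_ge0// addr_ge0// mulr_ge0// ltW.
pose D := M + c' + B.
have c'0 : 0 <= c' by rewrite /c' addr_ge0 ?divr_ge0 ?(ltW d0).
have D0 : 0 <= D by exact: addr_ge0 (addr_ge0 M0 c'0) B0.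
pose th := k / (n * D ^+ 2 + k + 1).
have nD : 0 <= n * D ^+ 2 by rewrite mulr_ge0// sqr_ge0.
have th0 : 0 < th by rewrite divr_gt0//; lra.
have th1 : th <= 1 by rewrite ler_pdivrMr; lra.
have thD : th * (n * D ^+ 2) <= k.
  rewrite /th mulrAC -mulrA ger_pMr // ler_pdivrMr; lra.
pose tau := Num.min 1 (th * k).
have tau0 : 0 < tau by rewrite lt_min ltr01 mulr_gt0.
have [_ [s Ss <-] Phis] := inf_adherent tau0 hi.
rewrite -/m in Phis.
have PB : Phi s <= B.
  apply: ltW; apply: lt_le_trans Phis _; rewrite lerD2l /tau ge_min lexx //.
have pB i : p s i <= B.
  have : p s i ^+ 2 <= B.
    apply: le_trans PB; rewrite /Phi (bigD1 i) //= lerDl.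
    by apply: sumr_ge0 => j _; rewrite sqr_ge0.
  have := sqr_ge0 (p s i - 1).
  have B1 : 1 <= B by rewrite /B lerDr.
  by rewrite sqrrB1 /B; rewrite /B in B1; lra.
have psum : d / 2 <= \sum_i p s i.
  have s0' : 0 <= \sum_i p s i by apply: sumr_ge0.
  rewrite -(@ler_pXn2r _ 2) ?nnegrE ?divr_ge0 ?(ltW d0) //.
  by apply: le_trans (Phie _ Ss) _; apply: sum_sqr_le.
have nu0 i : 0 < p s i + h by rewrite ltr_wpDl.
have [s' Ss' hs'] := Snu _ nu0.
have sumnu : \sum_i (p s i + h) = \sum_i p s i + n * h.
  by rewrite big_split /= sumr_const mulr_natl.
have s'M i : s' i <= M.
  rewrite /M ler_pdivlMr //.
  apply: (@le_trans _ _ (\sum_i (p s i + h) * s' i)).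
    rewrite (bigD1 i) //= -[leLHS]addr0 lerD //.
      by rewrite mulrC ler_wpM2r ?S0 // lerDr.
    by apply: sumr_ge0 => j _; rewrite mulr_ge0 ?S0 // ltW.
  apply: le_trans hs' _; rewrite sumnu ler_wpM2l // lerD2r /n.
  rewrite mulr_natl -sumr_const; apply: ler_sum => j _ //.
have sB i : s i <= c' + B by have := ps s i; have := pB i; lra.
have dif i : (s' i - s i) ^+ 2 <= D ^+ 2.
  have h1 := S0 _ i Ss; have h2 := S0 _ i Ss'; have h3 := s'M i; have h4 := sB i.
  by rewrite -subr_ge0 subr_sqr mulr_ge0 // /D; lra.
have der : \sum_i p s i * (s' i - s i) <= - k.
  have e1 : \sum_i p s i * s' i <= c * \sum_i p s i + k.
    apply: (@le_trans _ _ (\sum_i (p s i + h) * s' i)).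
      by apply: ler_sum => i _; rewrite ler_wpM2r ?S0 // lerDl ltW.
    apply: le_trans hs' _; rewrite sumnu mulrDr lerD2l mulrA //.
  have e2 : c' * \sum_i p s i <= \sum_i p s i * s i.
    rewrite mulr_sumr; apply: ler_sum => i _; rewrite mulrC.
    have [->|h'] : p s i = 0 \/ c' <= s i.
      by rewrite /p; case: (leP (s i - c') 0) => hh; [left|right; rewrite -subr_ge0 ltW].
      by rewrite !mul0r.
    by rewrite ler_wpM2l.
  have -> : \sum_i p s i * (s' i - s i) = \sum_i p s i * s' i - \sum_i p s i * s i.
    by rewrite -sumrB; apply: eq_bigr => i _; rewrite mulrBr.
  have e3 : d / 2 * (d / 2) <= d / 2 * \sum_i p s i by rewrite ler_wpM2l // divr_ge0 // ltW.
  have e4 : c' * \sum_i p s i = c * \sum_i p s i + d / 2 * \sum_i p s i by rewrite /c' mulrDl.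
  have e5 : d / 2 * (d / 2) = 2 * k by rewrite /k; field.
  lra.
have Sth : S (fun i => s i + th * (s' i - s i)) by apply: Sconv => //; rewrite ltW.
have := mle _ Sth.
apply/negP; rewrite -ltNge.
apply: (@le_lt_trans _ _ (Phi s + 2 * th * (\sum_i p s i * (s' i - s i)) + th * (th * (n * D ^+ 2)))).
  have -> : th * (th * (n * D ^+ 2)) = \sum_(i : I) th ^+ 2 * D ^+ 2.
    by rewrite sumr_const /n -[RHS]mulr_natl; ring.
  rewrite mulr_sumr -!big_split /=; apply: ler_sum => i _.
  have e : (s i + th * (s' i - s i)) - c' = (s i - c') + th * (s' i - s i) by ring.
  rewrite {1}/p e.
  apply: le_trans (pos_sqr_le _ (ps s i) (p0 s i)) _.
  have -> : (p s i + th * (s' i - s i)) ^+ 2 = p s i ^+ 2 + 2 * th * (p s i * (s' i - s i)) + th ^+ 2 * (s' i - s i) ^+ 2 by ring.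
  by rewrite lerD2l ler_wpM2l // sqr_ge0.
have f1 : 2 * th * (\sum_i p s i * (s' i - s i)) <= 2 * th * - k by rewrite ler_wpM2l // mulr_ge0 // ltW.
have f2 : th * (th * (n * D ^+ 2)) <= th * k by rewrite ler_wpM2l // ltW.
have f3 : tau <= th * k by rewrite /tau ge_min lexx orbT.
have f4 : 2 * th * - k = - (th * k) *+ 2 by ring.
lra.
Qed.
End Minimax.

(** * Squared moduli, and pairs of natural numbers *)

Section ComplexHelpers.
Variable R : realType.
Local Notation C := R[i].
Local Notation Re := (@complex.Re R).
Local Notation Im := (@complex.Im R).
Implicit Types z w : C.

Lemma nsqM z w : nsq (z * w) = nsq z * nsq w.
Proof. by case: z w => [p q] [r s]; rewrite /nsq /=; ring. Qed.

Lemma nsq_conj z : nsq z^* = nsq z.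
Proof. by case: z => [p q]; rewrite /nsq /= sqrrN. Qed.

Lemma nsq0 : nsq (0 : C) = 0.
Proof. by rewrite /nsq /= expr0n addr0. Qed.

Lemma nsq1 : nsq (1 : C) = 1.
Proof. by rewrite /nsq /= expr0n addr0 expr1n. Qed.

Lemma nsqN z : nsq (- z) = nsq z.
Proof. by case: z => [p q]; rewrite /nsq /= !sqrrN. Qed.

Lemma nsq_real (x : R) : nsq (x%:C%C) = x ^+ 2.
Proof. by rewrite /nsq /= expr0n addr0. Qed.

Lemma nsq_eq0 z : nsq z = 0 -> z = 0.
Proof.
move=> h; have := nsqE z; rewrite h => /esym/eqP.
by rewrite expf_eq0 /= normr_eq0 => /eqP.
Qed.

Lemma nsq_mul_conj z : z * z^* = (nsq z)%:C%C.
Proof. by rewrite nsqE normCK. Qed.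

Lemma conj_realc (x : R) : (x%:C%C : C)^* = x%:C%C.
Proof. by apply/eqP; rewrite eq_complex /= oppr0 !eqxx. Qed.

Lemma ge0_realc z : 0 <= z -> z = (Re z)%:C%C.
Proof. by move=> /ger0_Im; case: z => a b /= ->. Qed.

Lemma conj_eq_realc z : z^* = z -> z = (Re z)%:C%C.
Proof.
case: z => a b /= [] h; congr (_ +i* _)%C.
lra.
Qed.

Lemma ler_Re z w : z <= w -> Re z <= Re w.
Proof. by rewrite lecE => /andP[]. Qed.

Lemma ReM_real (x : R) z : Re (x%:C%C * z) = x * Re z.
Proof. by case: z => a b /=; rewrite mul0r subr0. Qed.

Lemma Re_normsq z : Re (`|z| ^+ 2) = nsq z.
Proof. by rewrite -nsqE. Qed.

Lemma Re_sum (I : Type) (r : seq I) (P : pred I) (F : I -> C) :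
  Re (\sum_(i <- r | P i) F i) = \sum_(i <- r | P i) Re (F i).
Proof. by rewrite raddf_sum. Qed.

Lemma Im_sum (I : Type) (r : seq I) (P : pred I) (F : I -> C) :
  Im (\sum_(i <- r | P i) F i) = \sum_(i <- r | P i) Im (F i).
Proof. by rewrite raddf_sum. Qed.

Lemma sum_realc (I : Type) (r : seq I) (P : pred I) (F : I -> R) :
  (\sum_(i <- r | P i) F i)%:C%C = \sum_(i <- r | P i) (F i)%:C%C.
Proof. by rewrite raddf_sum. Qed.

Lemma Re_sum_normsq (I : Type) (r : seq I) (P : pred I) (F : I -> C) :
  Re (\sum_(i <- r | P i) `|F i| ^+ 2) = \sum_(i <- r | P i) nsq (F i).
Proof. by rewrite Re_sum; apply: eq_bigr => i _; rewrite Re_normsq. Qed.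

Lemma nsq_CS n (a b : nat -> C) :
  nsq (\sum_(i < n) a i * b i) <= (\sum_(i < n) nsq (a i)) * (\sum_(i < n) nsq (b i)).
Proof.
pose f (u v : nat -> C) := \sum_(i < n) u i * (v i)^*.
have fl (x : nat -> C) : scalar (f ^~ x).
  move=> k u v; rewrite /f mulr_sumr -big_split /=; apply: eq_bigr => i _.
  by rewrite !fctE mulrDl /GRing.scale /= -mulrA.
have fc u v : f u v = (f v u)^*.
  rewrite /f rmorph_sum /=; apply: eq_bigr => i _.
  by rewrite rmorphM /= conjCK mulrC.
have fE u : f u u = (\sum_(i < n) nsq (u i))%:C%C.
  by rewrite sum_realc; apply: eq_bigr => i _; rewrite nsq_mul_conj.
have fp u : 0 <= f u u.
  by rewrite fE lecR; apply: sumr_ge0 => i _; exact: nsq_ge0.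
have := ler_Re (semi_CS fl fc fp a (fun i => (b i)^*)).
rewrite Re_normsq !fE -rmorphM /=.
have -> : f a (fun i => (b i)^*) = \sum_(i < n) a i * b i.
  by apply: eq_bigr => i _; rewrite conjCK.
have -> : \sum_(i < n) nsq ((b i)^*) = \sum_(i < n) nsq (b i).
  by apply: eq_bigr => i _; rewrite nsq_conj.
by [].
Qed.

End ComplexHelpers.

Section Pairing.

Lemma nat_pairing : {cu : (nat * nat -> nat) * (nat -> nat * nat) |
  cancel cu.1 cu.2 /\ cancel cu.2 cu.1}.
Proof.
apply: cid.
have := card_nat2.
move=> /card_set_bijP [f]; rewrite setTT_bijective => -[g fg gf].
by exists (f, g).
Qed.

(** Kernels on pairs of indices are written as kernels on [nat], so that the Gram-Schmidt process
    and the passage to the limit are only needed for sequences. *)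
Definition npair : nat * nat -> nat := (sval nat_pairing).1.
Definition nunpair : nat -> nat * nat := (sval nat_pairing).2.
Lemma npairK : cancel npair nunpair. Proof. exact: (svalP nat_pairing).1. Qed.
Lemma nunpairK : cancel nunpair npair. Proof. exact: (svalP nat_pairing).2. Qed.
End Pairing.

(** * Positive kernels representing a function of three indices *)

Section Kernels.
Variable R : realType.
Local Notation C := R[i].
Local Notation Re := (@complex.Re R).
Local Notation Im := (@complex.Im R).
Implicit Types (K : nat -> nat -> C) (c : nat -> C) (al be : nat -> R).
Implicit Types F : nat -> nat -> nat -> C.

Definition kform K S c : R :=
  Re (\sum_(s < S) \sum_(s' < S) c s * (c s')^* * K s s').

Definition psd_kernel K :=
  (forall s s', K s s' = (K s' s)^*) /\ (forall S c, 0 <= kform K S c).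

(** If F i k j = xi_1(i) xi_2(k) xi_3(j), take for [K3] the Gram kernel of the vectors xi_3(j)1
    and for [K2] that of the vectors xi_2(k) xi_3(j)1, indexed by the pairs (k, j). The last three
    clauses say in this order that xi_2(k) is a contraction, that xi_1(i) is a functional of
    squared norm at most [al i] on the span of these vectors, and that xi_3(j)1 has squared norm
    at most [be j]. *)
Definition kernel_pair F al be K2 K3 :=
  [/\ psd_kernel K2, psd_kernel K3,
    forall k S c, kform (fun j j' => K2 (npair (k, j)) (npair (k, j'))) S c <= kform K3 S c,
    (forall i, 0 <= al i) /\
    forall i S c, nsq (\sum_(s < S) c s * F i (nunpair s).1 (nunpair s).2) <= al i * kform K2 S c &
    forall j, Re (K3 j j) <= be j].

Definition kernel_rep F al be := exists K2 K3, kernel_pair F al be K2 K3.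

Definition kmix (t : R) K K' : nat -> nat -> C :=
  fun s s' => (1 - t)%:C%C * K s s' + t%:C%C * K' s s'.

Lemma kform_mix t K K' S c :
  kform (kmix t K K') S c = (1 - t) * kform K S c + t * kform K' S c.
Proof.
rewrite /kform -!ReM_real -raddfD /=; congr Re.
rewrite !mulr_sumr -big_split /=; apply: eq_bigr => s _.
rewrite !mulr_sumr -big_split /=; apply: eq_bigr => s' _.
by rewrite /kmix; ring.
Qed.

Lemma psd_mix t K K' : 0 <= t <= 1 -> psd_kernel K -> psd_kernel K' -> psd_kernel (kmix t K K').
Proof.
move=> /andP[t0 t1] [hK pK] [hK' pK']; split.
  move=> s s'; rewrite /kmix hK hK'; move: (1 - t) => u; rewrite rmorphD /= !rmorphM /=.
  by rewrite !conj_realc.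
by move=> S c; rewrite kform_mix addr_ge0 // mulr_ge0 // subr_ge0.
Qed.

(** The set of the [(a, q)] with [x <= a * q] is convex, because the geometric mean is concave;
    [cross] is the inequality between the two means. *)
Lemma cone_mix (x a q a' q' t : R) : 0 <= x -> 0 <= a -> 0 <= q -> 0 <= a' -> 0 <= q' ->
  0 <= t <= 1 -> x <= a * q -> x <= a' * q' ->
  x <= (a + t * (a' - a)) * ((1 - t) * q + t * q').
Proof.
move=> x0 a0 q0 a'0 q'0 /andP[t0 t1] h h'.
have cross : 2 * x <= a * q' + a' * q.
  rewrite -(@ler_pXn2r _ 2) ?nnegrE ?addr_ge0 ?mulr_ge0 //.
  apply: (@le_trans _ _ (4 * ((a * q) * (a' * q')))).
    rewrite exprMn (_ : 2 ^+ 2 = 4) ?ler_wpM2l //; last by ring.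
    by rewrite expr2; apply: ler_pM.
  rewrite -subr_ge0 (_ : _ - _ = (a * q' - a' * q) ^+ 2); first exact: sqr_ge0.
  by ring.
have -> : (a + t * (a' - a)) * ((1 - t) * q + t * q') =
  (1 - t) ^+ 2 * (a * q) + t * (1 - t) * (a * q' + a' * q) + t ^+ 2 * (a' * q') by ring.
have -> : x = (1 - t) ^+ 2 * x + t * (1 - t) * (2 * x) + t ^+ 2 * x by ring.
by rewrite !lerD // ler_wpM2l // ?sqr_ge0 // mulr_ge0 // subr_ge0.
Qed.

(** In [nsq _ <= al i * kform K2 S c] the bound and the kernel may be averaged simultaneously, by
    [cone_mix]; all the other clauses are linear. This joint convexity is the reason for using
    kernels instead of operators. *)
Lemma kernel_rep_convex F al be al' be' t : 0 <= t <= 1 ->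
  kernel_rep F al be -> kernel_rep F al' be' ->
  kernel_rep F (fun i => al i + t * (al' i - al i)) (fun j => be j + t * (be' j - be j)).
Proof.
move=> t01; have /andP[t0 t1] := t01.
move=> [K2 [K3 [p2 p3 h23 [a0 h1] h3]]] [K2' [K3' [p2' p3' h23' [a0' h1'] h3']]].
exists (kmix t K2 K2'), (kmix t K3 K3'); split; [exact: psd_mix|exact: psd_mix|..].
- move=> k S c; rewrite (_ : (fun j j' => _) = kmix t (fun j j' => K2 (npair (k, j)) (npair (k, j'))) (fun j j' => K2' (npair (k, j)) (npair (k, j')))) //.
  by rewrite !kform_mix lerD // ler_wpM2l // subr_ge0.
- split=> [i|i S c].
    rewrite (_ : _ + _ = (1 - t) * al i + t * al' i); last by ring.
    by rewrite addr_ge0 // mulr_ge0 // subr_ge0.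
  by rewrite kform_mix; apply: cone_mix => //; [exact: nsq_ge0|apply: p2.2|apply: p2'.2].
- move=> j; rewrite /kmix raddfD /= !ReM_real.
  rewrite (_ : be j + _ = (1 - t) * be j + t * be' j); last by ring.
  by rewrite lerD // ler_wpM2l // subr_ge0.
Qed.

Lemma kform_ReIm K S c : kform K S c =
  \sum_(s < S) \sum_(s' < S) (Re (c s * (c s')^*) * Re (K s s') - Im (c s * (c s')^*) * Im (K s s')).
Proof.
rewrite /kform Re_sum; apply: eq_bigr => s _; rewrite Re_sum; apply: eq_bigr => s' _.
by case: (c s * _) (K s s') => [p q] [r u].
Qed.

Lemma kform_single K j : kform K j.+1 (fun i => (i == j)%:R) = Re (K j j).
Proof.
rewrite /kform big_ord_recr /= big1 => [|s _]; last first.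
  by apply: big1 => s' _; rewrite ltn_eqF // !mul0r.
rewrite add0r big_ord_recr /= big1 => [|s _]; last by rewrite eqxx mul1r conjC_nat ltn_eqF //= mul0r.
by rewrite conjC_nat eqxx !mul1r add0r.
Qed.

(** Polynomials stand for finitely supported sequences; this is the linear map with values [g n]
    on ['X^n]. *)
Definition poly_ext (W : lmodType C) (g : nat -> W) (p : {poly C}) : W :=
  \sum_(s < size p) p`_s *: g s.

Lemma poly_ext_widen (W : lmodType C) (g : nat -> W) (p : {poly C}) N : (size p <= N)%N ->
  poly_ext g p = \sum_(s < N) p`_s *: g s.
Proof.
move=> pN; rewrite /poly_ext (big_ord_widen N (fun s => p`_s *: g s)) // big_mkcond /=.
by apply: eq_bigr => i _; case: ltnP => // h; rewrite nth_default // scale0r.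
Qed.

Lemma poly_ext_lin (W : lmodType C) (g : nat -> W) a p q :
  poly_ext g (a *: p + q) = a *: poly_ext g p + poly_ext g q.
Proof.
pose N := maxn (size p) (size q).
rewrite !(@poly_ext_widen _ _ _ N) ?leq_maxl ?leq_maxr //; last first.
  by apply: leq_trans (size_polyD _ _) _; rewrite geq_max leq_maxr andbT (leq_trans (size_scale_leq _ _)) ?leq_maxl.
rewrite scaler_sumr -big_split /=; apply: eq_bigr => i _.
by rewrite coefD coefZ scalerDl scalerA.
Qed.

Lemma poly_extX (W : lmodType C) (g : nat -> W) n : poly_ext g 'X^n = g n.
Proof.
rewrite (@poly_ext_widen _ _ _ n.+1) ?size_polyXn // big_ord_recr /= big1 => [|i _].
  by rewrite add0r coefXn eqxx scale1r.
by rewrite coefXn ltn_eqF // scale0r.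
Qed.

(** The sesquilinear form of [K], carried to polynomials in order to be a semi-inner product on a
    vector space. *)
Definition poly_form K (p q : {poly C}) : C :=
  poly_ext (fun i => (poly_ext (fun j => (K i j)^* : C^o) q)^* : C^o) p.

Lemma poly_form_lin K q : scalar (poly_form K ^~ q).
Proof. by move=> a u v; rewrite /poly_form poly_ext_lin. Qed.

Lemma poly_formE K (p q : {poly C}) N : (size p <= N)%N -> (size q <= N)%N ->
  poly_form K p q = \sum_(s < N) \sum_(s' < N) p`_s * (q`_s')^* * K s s'.
Proof.
move=> pN qN; rewrite /poly_form (poly_ext_widen _ pN); apply: eq_bigr => s _.
rewrite (poly_ext_widen _ qN) rmorph_sum /= /GRing.scale /= mulr_sumr; apply: eq_bigr => s' _.
by rewrite rmorphM /= conjCK mulrA.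
Qed.

Lemma poly_form_conj K : (forall s s', K s s' = (K s' s)^*) -> forall p q, poly_form K p q = (poly_form K q p)^*.
Proof.
move=> hK p q; pose N := maxn (size p) (size q).
rewrite !(@poly_formE _ _ _ N) ?leq_maxl ?leq_maxr // exchange_big /= rmorph_sum /=.
apply: eq_bigr => s' _; rewrite rmorph_sum /=; apply: eq_bigr => s _.
by rewrite hK !rmorphM /= conjCK [_ * (q`_s')^*]mulrC.
Qed.

Lemma poly_form_kform K (p : {poly C}) N : (size p <= N)%N -> Re (poly_form K p p) = kform K N (fun s => p`_s).
Proof. by move=> pN; rewrite (@poly_formE _ _ _ N). Qed.

Lemma poly_form_real K (p : {poly C}) : psd_kernel K -> poly_form K p p = (Re (poly_form K p p))%:C%C.
Proof. by move=> [hK _]; apply: conj_eq_realc; rewrite -poly_form_conj. Qed.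

Lemma poly_form_ge0 K : psd_kernel K -> forall p, 0 <= poly_form K p p.
Proof.
by move=> pK p; rewrite poly_form_real // lecR (@poly_form_kform _ _ (size p)) //; apply: pK.2.
Qed.

Lemma poly_formX K i j : poly_form K 'X^i 'X^j = K i j.
Proof. by rewrite /poly_form !poly_extX conjCK. Qed.

Lemma psd_bound K M : psd_kernel K -> (forall j, Re (K j j) <= M j) ->
  forall i j, nsq (K i j) <= M i * M j.
Proof.
move=> pK KM i j.
have := ler_Re (semi_CS (poly_form_lin K) (poly_form_conj pK.1) (poly_form_ge0 pK) 'X^i 'X^j).
rewrite Re_normsq (poly_form_real _ pK) (poly_form_real 'X^j pK) -rmorphM /= !poly_formX.
have d0 l : 0 <= Re (K l l) by rewrite -kform_single; apply: pK.2.
by move=> /le_trans; apply; apply: ler_pM.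
Qed.

End Kernels.

(** * Compactness of kernel representations *)

Section KernelLimit.
Variable R : realType.
Local Notation C := R[i].
Local Notation Re := (@complex.Re R).
Local Notation Im := (@complex.Im R).

(** An ultrafilter provides the limits of all kernel entries at once, without a diagonal
    extraction of subsequences. *)
Lemma ultra_limit (G : set_system nat) (u : nat -> R) (M : R) : UltraFilter G ->
  (forall n, `|u n| <= M) -> exists l : R, u @ G --> l.
Proof.
move=> UG uM; have PG : ProperFilter G by exact: ultra_proper.
have [|l [_ ul]] := @segment_compact R (- M) M (u @ G) _.
  rewrite /nbhs /=; suff : G (u @^-1` `[- M, M]) by [].
  by apply: filterE => n /=; rewrite in_itv /= -ler_norml.
exists l => V lV; have [//|GV] := in_ultra_setVsetC (u @^-1` V) UG.
have [x [nx Vx]] := ul (~` V) V GV lV.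
by [].
Qed.

Lemma kform_cvg (G : set_system nat) (Kn : nat -> nat -> nat -> C) K S c : ProperFilter G ->
  (forall s s', (fun n => Re (Kn n s s')) @ G --> Re (K s s')) ->
  (forall s s', (fun n => Im (Kn n s s')) @ G --> Im (K s s')) ->
  (fun n => kform (Kn n) S c) @ G --> kform K S c.
Proof.
move=> PG KR KI; rewrite kform_ReIm.
have -> : (fun n => kform (Kn n) S c) = (fun n => \sum_(s < S) \sum_(s' < S) (Re (c s * (c s')^*) * Re (Kn n s s') - Im (c s * (c s')^*) * Im (Kn n s s'))).
  by apply/funext => n; rewrite kform_ReIm.
apply: cvg_big => [|s _]; first exact: add_continuous.
apply: cvg_big => [|s' _]; first exact: add_continuous.
by apply: cvgB; apply: cvgMr.
Qed.

(** The diagonal of [K3] is bounded by [be], so that of [K2] is bounded too, and Cauchy-Schwarz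
    bounds all the entries uniformly in [n]. Each clause involves finitely many entries, hence it
    passes to entrywise limits along an ultrafilter containing the neighbourhoods of infinity. *)
Lemma kernel_rep_limit (Fn : nat -> nat -> nat -> nat -> C) F al be :
  (forall n, kernel_rep (Fn n) al be) ->
  (forall i k j, exists N, forall n, (N <= n)%N -> Fn n i k j = F i k j) ->
  kernel_rep F al be.
Proof.
move=> hn Flim.
have [K2n hn2] := choice hn.
have [K3n hK] := choice hn2.
have [G [UG GF]] := @ultraFilterLemma _ \oo%classic _.
have PG : ProperFilter G by exact: ultra_proper.
have near N (P : nat -> Prop) : (forall n, (N <= n)%N -> P n) -> G P.
  by move=> h; apply: GF; exists N.
have sqb (x y : R) : x ^+ 2 <= y -> `|x| <= 1 + y.
  move=> h; have := sqr_ge0 (x - 1); have := sqr_ge0 (x + 1).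
  by rewrite sqrrB1 sqrrD1 => h1 h2; rewrite ler_norml; apply/andP; split; lra.
have bnd K M : psd_kernel K -> (forall j, Re (K j j) <= M j) -> forall s s',
    `|Re (K s s')| <= 1 + M s * M s' /\ `|Im (K s s')| <= 1 + M s * M s'.
  move=> pK KM s s'; have := psd_bound pK KM s s'; rewrite /nsq => h.
  by split; apply: sqb; apply: le_trans h; rewrite ?lerDl ?lerDr sqr_ge0.
have lim K M : (forall n, psd_kernel (K n)) -> (forall n j, Re (K n j j) <= M j) ->
    exists K', (forall s s', (fun n => Re (K n s s')) @ G --> Re (K' s s')) /\
               (forall s s', (fun n => Im (K n s s')) @ G --> Im (K' s s')).
  move=> pK KM.
  have hR (p : nat * nat) : exists l : R, (fun n => Re (K n p.1 p.2)) @ G --> l.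
    by apply: ultra_limit (1 + M p.1 * M p.2) _ _ => n; exact: (bnd _ _ (pK n) (KM n) _ _).1.
  have hI (p : nat * nat) : exists l : R, (fun n => Im (K n p.1 p.2)) @ G --> l.
    by apply: ultra_limit (1 + M p.1 * M p.2) _ _ => n; exact: (bnd _ _ (pK n) (KM n) _ _).2.
  have [lR hlR] := choice hR; have [lI hlI] := choice hI.
  exists (fun s s' => (lR (s, s') +i* lI (s, s'))%C).
  by split=> s s'; [exact: (hlR (s, s'))|exact: (hlI (s, s'))].
have psd_lim K K' : (forall n, psd_kernel (K n)) ->
    (forall s s', (fun n => Re (K n s s')) @ G --> Re (K' s s')) ->
    (forall s s', (fun n => Im (K n s s')) @ G --> Im (K' s s')) -> psd_kernel K'.
  move=> pK KR KI; split.
    move=> s s'; apply/eqP; rewrite eq_complex; apply/andP; split; apply/eqP.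
      rewrite (_ : Re (_^*) = Re (K' s' s)); last by case: (K' s' s).
      have e : (fun n => Re (K n s s')) = (fun n => Re (K n s' s)).
        by apply/funext => n; rewrite (pK n).1; case: (K n s' s).
      by have := KR s s'; rewrite e => h; exact: (cvg_unique _ h (KR s' s)).
    rewrite (_ : Im (_^*) = - Im (K' s' s)); last by case: (K' s' s).
    have e : (fun n => Im (K n s s')) = (fun n => - Im (K n s' s)).
      by apply/funext => n; rewrite (pK n).1; case: (K n s' s).
    have := KI s s'; rewrite e => h.
    exact: (cvg_unique _ h (cvgN (KI s' s))).
  move=> S c; apply: (cvgr_to_ge (@kform_cvg G _ _ S c PG KR KI)).
  by apply: filterE => n; apply: (pK n).2.
have K3b n j : Re (K3n n j j) <= be j by have [_ _ _ _] := hK n; apply.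
have K2b n s : Re (K2n n s s) <= be (nunpair s).2.
  apply: le_trans (K3b n _); have [_ _ + _ _] := hK n.
  move=> /(_ (nunpair s).1 (nunpair s).2.+1 (fun i => (i == (nunpair s).2)%:R)).
  by rewrite !kform_single -surjective_pairing nunpairK.
have [K2 [K2R K2I]] := lim K2n _ (fun n => let: And5 p _ _ _ _ := hK n in p) K2b.
have [K3 [K3R K3I]] := lim K3n _ (fun n => let: And5 _ p _ _ _ := hK n in p) K3b.
exists K2, K3; split.
- by apply: psd_lim K2R K2I => n; have [] := hK n.
- by apply: psd_lim K3R K3I => n; have [] := hK n.
- move=> k S c; apply: (ler_cvg_to (@kform_cvg G _ _ S c PG _ _) (@kform_cvg G _ _ S c PG K3R K3I)).
  + by move=> s s'; apply: K2R.
  + by move=> s s'; apply: K2I.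
  + by apply: filterE => n; have [_ _ + _ _] := hK n; apply.
- split; first by have [_ _ _ [+ _] _] := hK 0.
  move=> i S c.
  have e : (fun n => al i * kform (K2n n) S c) @ G --> al i * kform K2 S c.
    by apply: cvgMr; exact: kform_cvg.
  apply: (cvgr_to_ge e).
  have : exists N, forall n, (N <= n)%N -> forall s, (s < S)%N ->
     Fn n i (nunpair s).1 (nunpair s).2 = F i (nunpair s).1 (nunpair s).2.
    elim: S {e} => [|S [N hN]]; first by exists 0.
    have [N' hN'] := Flim i (nunpair S).1 (nunpair S).2.
    exists (maxn N N') => n; rewrite geq_max => /andP[Nn N'n] s.
    by rewrite ltnS leq_eqVlt => /orP[/eqP->|sS]; [exact: hN'|exact: hN].
  move=> [N hN]; apply: (near N) => n Nn.
  have [_ _ _ [_ +] _] := hK n => /(_ i S c).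
  congr (nsq _ <= _); apply: eq_bigr => s _; rewrite hN //.
- move=> j; apply: (cvgr_to_le (K3R j j)); apply: filterE => n; exact: K3b.
Qed.
End KernelLimit.

(** * From kernels to infinite matrices *)

Section MatrixRep.
Variable R : realType.
Local Notation C := R[i].
Local Notation Re := (@complex.Re R).
Implicit Types (M : nat -> nat -> C).

Definition mbound M (c : R) := forall S N (u : nat -> C),
  \sum_(s < S) nsq (\sum_(t < N) M s t * u t) <= c * \sum_(t < N) nsq (u t).

(** The function is a product of a row [A i], a contraction matrix [B k] and a column [D j]. The
    vanishing conditions make the sums finite: column [b] of [B k] is supported below [nb k b],
    and [D j] is supported up to [j]. *)
Definition matrix_rep (F : nat -> nat -> nat -> C) (al be : nat -> R)
    (A : nat -> nat -> C) (B : nat -> nat -> nat -> C) (D : nat -> nat -> C)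
    (nb : nat -> nat -> nat) :=
  [/\ forall i n, \sum_(a < n) nsq (A i a) <= al i,
      forall k, mbound (B k) 1,
      forall j n, \sum_(b < n) nsq (D j b) <= be j,
      (forall k b a, (nb k b <= a)%N -> B k a b = 0) /\
      (forall j b, (j < b)%N -> D j b = 0) &
      forall i k j, F i k j =
        \sum_(b < j.+1) (\sum_(a < nb k b) A i a * B k a b) * D j b].

Lemma poly_sum_widen (p : {poly C}) n : (size p <= n)%N -> p = \sum_(j < n) p`_j *: 'X^j.
Proof.
move=> pn; rewrite -(@poly_ext_widen R _ (fun j => 'X^j : {poly C}) p n pn) /poly_ext.
by rewrite -{1}(coefK p) poly_def.
Qed.

(** On polynomials, [L i] is the functional with values F i k j at 'X^(k,j), and [U k] maps 'X^j
    to 'X^(k,j). [A], [B] and [D] are the matrices of [L i], of [U k] and of the vectors ['X^j] in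
    the Gram-Schmidt systems [e2] and [e3] of the two forms. The kernel inequalities say that
    [U k] is a contraction and that [L i] is bounded, so both annihilate null vectors, and the
    bounds on the matrices are Bessel inequalities. *)
Theorem kernel_rep_matrix (F : nat -> nat -> nat -> C) al be : kernel_rep F al be ->
  exists A B D nb, matrix_rep F al be A B D nb.
Proof.
move=> [K2 [K3 [p2 p3 h23 [al0 h1] h3]]].
pose f2 := poly_form K2; pose f3 := poly_form K3.
have l2 := poly_form_lin K2 : forall w, scalar (f2 ^~ w).
have l3 := poly_form_lin K3 : forall w, scalar (f3 ^~ w).
have c2 := poly_form_conj p2.1 : forall u v, f2 u v = (f2 v u)^*.
have c3 := poly_form_conj p3.1 : forall u v, f3 u v = (f3 v u)^*.
have g2 := poly_form_ge0 p2 : forall u, 0 <= f2 u u.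
have g3 := poly_form_ge0 p3 : forall u, 0 <= f3 u u.
pose X (n : nat) : {poly C} := 'X^n.
pose e2 := gs f2 X; pose e3 := gs f3 X.
pose U k : {poly C} -> {poly C} := poly_ext (fun j => 'X^(npair (k, j)) : {poly C}).
have Ul k a p q : U k (a *: p + q) = a *: U k p + U k q by apply: poly_ext_lin.
pose L i : {poly C} -> C := poly_ext (fun s => F i (nunpair s).1 (nunpair s).2 : C^o).
have Ll i a p q : L i (a *: p + q) = a * L i p + L i q by apply: poly_ext_lin.
have U2 k p : Re (f2 (U k p) (U k p)) <= Re (f3 p p).
  have -> : f2 (U k p) (U k p) = \sum_(j < size p) \sum_(j' < size p)
      p`_j * (p`_j')^* * K2 (npair (k, j : nat)) (npair (k, j' : nat)).
    rewrite {1}/U /poly_ext (semi_suml l2); apply: eq_bigr => j _.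
    rewrite (semiZl l2) /U /poly_ext (semi_sumr l2 c2) mulr_sumr; apply: eq_bigr => j' _.
    by rewrite (semiZr l2 c2) /f2 poly_formX mulrA.
  rewrite (@poly_form_kform _ _ _ (size p)) //; exact: h23.
have L2 i p : nsq (L i p) <= al i * Re (f2 p p).
  rewrite (@poly_form_kform _ _ _ (size p)) //; exact: h1.
have UN k p : f3 p p = 0 -> f2 (U k p) (U k p) = 0.
  move=> h; rewrite (ge0_realc (g2 _)); congr (_ +i* _)%C; apply/eqP; rewrite eq_le.
  have := U2 k p; rewrite h => -> /=.
  by have := g2 (U k p); rewrite lecE => /andP[].
have LN i p : f2 p p = 0 -> L i p = 0.
  move=> h; apply: nsq_eq0; apply/eqP; rewrite eq_le nsq_ge0 andbT.
  by have := L2 i p; rewrite h mulr0.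
have U0 k : U k 0 = 0 by rewrite /U /poly_ext size_poly0 big_ord0.
have L0 i : L i 0 = 0 by rewrite /L /poly_ext size_poly0 big_ord0.
have Usum k n (u : nat -> C) (w : nat -> {poly C}) :
    U k (\sum_(b < n) u b *: w b) = \sum_(b < n) u b *: U k (w b).
  elim: n => [|n ih]; first by rewrite !big_ord0.
  by rewrite !big_ord_recr /= addrC Ul ih addrC.
have Lsum i n (u : nat -> C) (w : nat -> {poly C}) :
    L i (\sum_(b < n) u b *: w b) = \sum_(b < n) u b * L i (w b).
  elim: n => [|n ih]; first by rewrite !big_ord0.
  by rewrite !big_ord_recr /= addrC Ll ih addrC.
(* [e3 b] is a polynomial of degree at most [b], so [U k (e3 b)] involves only these exponents. *)
pose nb k b := (\max_(j < b.+1) npair (k, j : nat)).+1.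
have e3s b : (size (e3 b) <= b.+1)%N.
  apply: (@gs_ind _ _ f3 X (fun p => (size p <= b.+1)%N)) => [|a u w hu hw|m mb].
  - by rewrite size_poly0.
  - rewrite (leq_trans (size_polyD _ _)) // geq_max hw andbT.
    by rewrite (leq_trans (size_scale_leq _ _)).
  - by rewrite size_polyXn ltnS.
have Ue k b : (size (U k (e3 b)) <= nb k b)%N.
  rewrite /U (poly_ext_widen _ (e3s b)).
  apply: (leq_trans (size_sum _ _ _)); apply/bigmax_leqP => j _.
  rewrite (leq_trans (size_scale_leq _ _)) // size_polyXn ltnS.
  exact: (@leq_bigmax _ (fun j : 'I_b.+1 => npair (k, j : nat)) j).
pose A i a := L i (e2 a).
pose B k a b := f2 (U k (e3 b)) (e2 a).
pose D j b := f3 (X j) (e3 b).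
exists A, B, D, nb.
have Bz k b a : (nb k b <= a)%N -> B k a b = 0.
  move=> h; rewrite /B (poly_sum_widen (Ue k b)) (semi_suml l2) big1 // => j _.
  by rewrite (semiZl l2) (gs_high l2 c2 g2 X) ?mulr0 // (leq_trans _ h).
split.
- move=> i n; set s := \sum_(a < n) _.
  have s0 : 0 <= s by apply: sumr_ge0 => a _; exact: nsq_ge0.
  (* Testing [L i] on the conjugate of its own row turns boundedness into square-summability. *)
  pose w := \sum_(a < n) (A i a)^* *: e2 a.
  have Lw : L i w = s%:C%C.
    rewrite /w (Lsum i n (fun a => (A i a)^*)) /s sum_realc; apply: eq_bigr => a _.
    by rewrite -nsq_mul_conj mulrC.
  have := L2 i w; rewrite Lw nsq_real => h.
  have h' : Re (f2 w w) <= s.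
    have -> : s = Re (\sum_(a < n) `|(A i a)^*| ^+ 2).
      by rewrite Re_sum_normsq; apply: eq_bigr => a _; rewrite nsq_conj.
    exact: ler_Re (gs_comb_le l2 c2 g2 X n (fun a => (A i a)^*)).
  have h2 : s ^+ 2 <= al i * s by apply: le_trans h _; rewrite ler_wpM2l.
  have [->|sn] := eqVneq s 0; first exact: al0.
  have sp : 0 < s by rewrite lt_neqAle eq_sym sn.
  by rewrite -(ler_pM2r sp) -expr2.
- move=> k S N u; rewrite mul1r.
  pose w := \sum_(b < N) u b *: e3 b.
  have e a : \sum_(b < N) B k a b * u b = f2 (U k w) (e2 a).
    rewrite /w Usum (semi_suml l2); apply: eq_bigr => b _.
    by rewrite (semiZl l2) mulrC.
  under eq_bigr do rewrite e.
  apply: (@le_trans _ _ (Re (f2 (U k w) (U k w)))).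
    have := ler_Re (gs_bessel l2 c2 g2 X S (U k w)).
    by rewrite Re_sum_normsq.
  apply: le_trans (U2 k w) _.
  have := ler_Re (gs_comb_le l3 c3 g3 X N u).
  by rewrite Re_sum_normsq.
- move=> j n; apply: le_trans (h3 j).
  have := ler_Re (gs_bessel l3 c3 g3 X n (X j)).
  by rewrite Re_sum_normsq /f3 poly_formX.
- split; first exact: Bz.
  by move=> j b jb; rewrite /D (gs_high l3 c3 g3 X).
- move=> i k j.
  have -> : F i k j = L i (U k (X j)) by rewrite /L /U /X !poly_extX npairK.
  have n1 := gs_proj_null l3 c3 g3 X (ltnSn j).
  have E1 : L i (U k (X j)) = L i (U k (gs_proj f3 X j.+1 (X j))).
    apply/eqP; rewrite -subr_eq0; apply/eqP.
    have := LN i _ (UN k _ n1).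
    by rewrite -[X in U k (X - _)]scale1r -scaleN1r addrC Ul addrC scale1r scaleN1r  -scaleN1r addrC Ll mulN1r addrC.
  rewrite E1 /gs_proj (Usum k j.+1 (D j)) (Lsum i j.+1 (D j) (fun b => U k (e3 b))); apply: eq_bigr => b _.
  rewrite mulrC; congr (_ * _).
  have n2 := gs_proj_null_span l2 c2 g2 X (nb k b) (fun s => (U k (e3 b))`_s).
  rewrite /= -(poly_sum_widen (Ue k b)) in n2.
  have E2 : L i (U k (e3 b)) = L i (gs_proj f2 X (nb k b) (U k (e3 b))).
    apply/eqP; rewrite -subr_eq0; apply/eqP.
    have := LN i _ n2.
    by rewrite -scaleN1r addrC Ll mulN1r addrC.
  rewrite E2 /gs_proj (Lsum i _ (B k ^~ b) e2); apply: eq_bigr => a _.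
  by rewrite mulrC.
Qed.
End MatrixRep.

(** * Norms in Hilbert spaces and of operators *)

Section HilbertBasics.
Variable R : realType.
Local Notation C := R[i].
Local Notation Re := (@complex.Re R).

Definition rnorm (H : hilbertType R) (u : H) : R := Re `|u|.

Section OneSpace.
Variable H : hilbertType R.
Implicit Types u v : H.

Lemma rnormE u : `|u| = (rnorm u)%:C%C.
Proof. exact: ge0_realc (normr_ge0 u). Qed.

Lemma rnorm_ge0 u : 0 <= rnorm u.
Proof. exact: ler_Re (normr_ge0 u). Qed.

Lemma rnormZ a u : rnorm (a *: u) ^+ 2 = nsq a * rnorm u ^+ 2.
Proof.
rewrite /rnorm normrZ (rnormE u) mulrC ReM_real /= exprMn mulrC; congr (_ * _).
have := nsqE a; rewrite {1}(ge0_realc (normr_ge0 a)) -rmorphXn => /eqP.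
by rewrite eq_complex /= => /andP[/eqP->].
Qed.

Lemma rnorm0 : rnorm (0 : H) = 0.
Proof. by rewrite /rnorm normr0. Qed.

Lemma rnorm_eq0 u : rnorm u = 0 -> u = 0.
Proof. by move=> h; apply/eqP; rewrite -normr_eq0 rnormE h. Qed.

Lemma rnorm_innerp u : (rnorm u ^+ 2)%:C%C = innerp u u.
Proof. by rewrite -normr_innerp rnormE rmorphXn. Qed.

Lemma innerp_conj u v : innerp u v = (innerp v u)^*.
Proof. by rewrite hermC /= expr0 mul1r. Qed.

Lemma innerp_lin (w : H) : scalar (fun u => innerp u w).
Proof. by move=> a u v; rewrite linearPl. Qed.

Lemma innerp_ge0 u : 0 <= innerp u u.
Proof. by rewrite -rnorm_innerp lecR sqr_ge0. Qed.

Lemma innerp_CS u v : nsq (innerp u v) <= rnorm u ^+ 2 * rnorm v ^+ 2.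
Proof.
have := dot_CauchySchwarz (@innerp R H) u v.
by rewrite -!rnorm_innerp -rmorphM /= -nsqE lecR.
Qed.

End OneSpace.

Section BopBasics.
Variables H K : hilbertType R.
Implicit Types T : bop H K.

Lemma bop_lin T a u v : T (a *: u + v) = a *: T u + T v.
Proof. by have /asboolP [l _] := bopP T; apply: l. Qed.

Lemma bop0 T : T 0 = 0.
Proof. by have := bop_lin T (-1) 0 0; rewrite scaler0 addr0 scaleN1r addNr. Qed.

Lemma bopZ T a u : T (a *: u) = a *: T u.
Proof. by rewrite -[a *: u]addr0 bop_lin bop0 addr0. Qed.

Lemma bopD T u v : T (u + v) = T u + T v.
Proof. by rewrite -{1}[u]scale1r bop_lin scale1r. Qed.

Lemma bopB T u v : T (u - v) = T u - T v.
Proof. by rewrite addrC -scaleN1r bop_lin scaleN1r addrC. Qed.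

Lemma bop_sum T (I : Type) (r : seq I) (P : pred I) (F : I -> H) :
  T (\sum_(i <- r | P i) F i) = \sum_(i <- r | P i) T (F i).
Proof.
elim/big_rec2: _ => [|i a b _ <-]; first exact: bop0.
by rewrite bopD.
Qed.

Lemma opnorm_has_sup T : has_sup [set Re `|T u| | u in [set u : H | `|u| <= 1]].
Proof.
split; first by exists (Re `|T 0|), 0 => //=; rewrite normr0.
have /asboolP [_ [M MT]] := bopP T.
exists `|M| => _ [u u1 <-].
have := ler_Re (MT u); rewrite (rnormE u) -rmorphM /= => h.
apply: le_trans h _.
have u1' : rnorm u <= 1 := ler_Re u1.
apply: (@le_trans _ _ (`|M| * rnorm u)); first by rewrite ler_wpM2r ?rnorm_ge0 ?ler_norm.
by rewrite ler_piMr.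
Qed.

Lemma opnorm_ge0 T : 0 <= opnorm T.
Proof.
have : rnorm (T 0) <= opnorm T.
  by apply: (ub_le_sup (opnorm_has_sup T).2); exists 0 => //=; rewrite normr0.
by rewrite bop0 rnorm0.
Qed.

Lemma opnorm_ub T u : rnorm (T u) <= opnorm T * rnorm u.
Proof.
have [u0|u0] := eqVneq (rnorm u) 0.
  by rewrite u0 (rnorm_eq0 u0) bop0 rnorm0 mulr0.
have up : 0 < rnorm u by rewrite lt_neqAle eq_sym u0 rnorm_ge0.
pose v := ((rnorm u)^-1)%:C%C *: u.
have v1 : rnorm v = 1.
  apply: (@pexpIrn _ 2) => //; rewrite ?nnegrE ?rnorm_ge0 ?ler01 //.
  by rewrite rnormZ nsq_real exprVn mulVf ?expr1n // expf_neq0.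
have vT : rnorm (T v) <= opnorm T.
  apply: (ub_le_sup (opnorm_has_sup T).2) => /=.
  by exists v => //=; rewrite rnormE v1.
rewrite -ler_pdivrMr //.
apply: le_trans vT; rewrite -(@ler_pXn2r _ 2) ?nnegrE ?rnorm_ge0 ?divr_ge0 ?rnorm_ge0 //.
by rewrite bopZ rnormZ nsq_real exprMn mulrC.
Qed.

Lemma opnorm_le T M : 0 <= M -> (forall u, rnorm (T u) <= M * rnorm u) -> opnorm T <= M.
Proof.
move=> M0 h; apply: ge_sup; first exact: (opnorm_has_sup T).1.
move=> _ [u u1 <-]; apply: le_trans (h u) _; rewrite -[leRHS]mulr1 ler_wpM2l //.
exact: ler_Re u1.
Qed.

End BopBasics.
End HilbertBasics.

(** * Coordinates in the space of square-summable sequences *)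

Section Ell2Basics.
Variable R : realType.
Local Notation C := R[i].
Local Notation Re := (@complex.Re R).
Local Notation Im := (@complex.Im R).
Local Notation E := (ell2 R).
Local Notation B := (bop E E).
Implicit Types (u v : E) (x y : nat -> C).

Definition ccvg x (l : C) := (Re \o x) @ \oo --> Re l /\ (Im \o x) @ \oo --> Im l.

Lemma ccvg_nsq x l : ccvg x l -> (fun n => nsq (x n)) @ \oo --> nsq l.
Proof.
move=> [hR hI]; have h := cvgD (cvgM hR hR) (cvgM hI hI).
have -> : (fun n => nsq (x n)) = (fun n => Re (x n) * Re (x n) + Im (x n) * Im (x n)).
  by apply/funext => n; rewrite /nsq !expr2.
by rewrite /nsq !expr2; exact: h.
Qed.

Lemma ccvg_of_nsq x l (b : nat -> R) : (forall n, nsq (x n - l) <= b n) -> b @ \oo --> 0 -> ccvg x l.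
Proof.
move=> h b0.
have s (y z : R) : y ^+ 2 + z ^+ 2 = nsq (y +i* z)%C by [].
have sq (f : nat -> R) (a : R) : (forall n, (f n - a) ^+ 2 <= b n) -> f @ \oo --> a.
  move=> hf; apply/cvgrPdist_lt => e e0.
  have e2 : 0 < e ^+ 2 by rewrite exprn_gt0.
  move/cvgrPdist_lt : b0 => /(_ _ e2); apply: filterS => n.
  rewrite sub0r normrN => bn.
  rewrite distrC -(@ltr_pXn2r _ 2) ?nnegrE ?(ltW e0) // real_normK ?num_real //.
  by apply: le_lt_trans (hf n) _; apply: le_lt_trans (ler_norm _) bn.
split; apply: sq => n; apply: le_trans (h n); rewrite /nsq !raddfB /=.
  by rewrite lerDl sqr_ge0.
by rewrite lerDr sqr_ge0.
Qed.

Lemma ccvg_unique x l l' : ccvg x l -> ccvg x l' -> l = l'.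
Proof.
move=> [h1 h2] [h3 h4].
have e1 := cvg_unique (@Rhausdorff R) h1 h3; have e2 := cvg_unique (@Rhausdorff R) h2 h4.
by case: l l' {h1 h2 h3 h4} e1 e2 => [a b] [c d] /= -> ->.
Qed.

Lemma ell2_valD u v n : (u + v) n = u n + v n. Proof. by []. Qed.
Lemma ell2_valZ a u n : (a *: u) n = a * u n. Proof. by []. Qed.
Lemma ell2_valB u v n : (u - v) n = u n - v n. Proof. by []. Qed.
Lemma ell2_val_sum (I : Type) (r : seq I) (P : pred I) (F : I -> E) n :
  (\sum_(i <- r | P i) F i) n = \sum_(i <- r | P i) F i n.
Proof. by elim/big_rec2: _ => [|i a b _ <-]. Qed.

Lemma ell2_eq u v : (forall n, u n = v n) -> u = v.
Proof. by move=> h; apply: val_inj; apply/funext. Qed.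

Lemma rnorm_ell2 u : rnorm u ^+ 2 = ell2_normsq u.
Proof.
have := ell2_normsqE u; rewrite (rnormE u) -rmorphXn => /eqP.
by rewrite eq_complex /= => /andP[/eqP->].
Qed.

Lemma ell2_series_cvg u : series (fun n => nsq (u n)) @ \oo --> rnorm u ^+ 2.
Proof. by rewrite rnorm_ell2; have /asboolP := ell2_valP u. Qed.

Lemma nsq_coord u n : nsq (u n) <= rnorm u ^+ 2.
Proof. by rewrite rnorm_ell2 ell2_coord. Qed.

Lemma ell2_partial_sum u n : \sum_(k < n) nsq (u k) <= rnorm u ^+ 2.
Proof. by rewrite rnorm_ell2; have := ell2_partial u n; rewrite /series /= big_mkord. Qed.

Lemma mk_ell2 x (M : R) : (forall n, \sum_(k < n) nsq (x k) <= M) ->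
  exists u : E, (forall n, u n = x n) /\ rnorm u ^+ 2 <= M.
Proof.
move=> h.
have nd : nondecreasing_seq (series (fun n => nsq (x n))).
  by apply: nondecreasing_series => n _ _; exact: nsq_ge0.
have xP : x \in @ell2_pred R.
  apply/asboolP; apply: nondecreasing_is_cvgn => //.
  by exists M => _ [n _ <-]; rewrite /series /= big_mkord.
exists (Ell2 xP); split=> //.
apply: (cvgr_to_le (@ell2_series_cvg (Ell2 xP))); apply: nearW => n /=.
by rewrite /series /= big_mkord.
Qed.

Lemma ebasisE n k : @ebasis R n k = (k == n)%:R. Proof. by []. Qed.

Definition etrunc N u : E := \sum_(n < N) u n *: ebasis R n.

Lemma etruncE N u k : etrunc N u k = if (k < N)%N then u k else 0.
Proof.
rewrite /etrunc ell2_val_sum.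
have -> : \sum_(i < N) (u i *: ebasis R i) k = \sum_(i < N) u i * (k == i)%:R by [].
case: ifP => [kN|/negbT kN].
  rewrite (bigD1 (Ordinal kN)) //= eqxx mulr1 big1 ?addr0 // => i ik.
  by rewrite eq_sym (_ : _ == _ = false) ?mulr0 //; apply/negbTE.
apply: big1 => i _; rewrite (_ : _ == _ = false) ?mulr0 //.
by apply: contraNF kN => /eqP ->.
Qed.

Lemma etrunc_res N u : rnorm (u - etrunc N u) ^+ 2 <= rnorm u ^+ 2 - \sum_(k < N) nsq (u k).
Proof.
apply: (cvgr_to_le (@ell2_series_cvg (u - etrunc N u))); apply: nearW => n /=.
rewrite /series /= lerBrDr.
apply: le_trans (ell2_partial_sum u (maxn n N)); rewrite big_mkord.
have e k : nsq ((u - etrunc N u) k) = if (k < N)%N then 0 else nsq (u k).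
  by rewrite ell2_valB etruncE; case: ltnP; rewrite ?subrr ?nsq0 ?subr0.
have -> : \sum_(k < n) nsq ((u - etrunc N u) k) = \sum_(k < n) if (k < N)%N then 0 else nsq (u k).
  by apply: eq_bigr => k _; exact: e.
rewrite (big_ord_widen (maxn n N) (fun k => if (k < N)%N then 0 else nsq (u k))) ?leq_maxl //.
rewrite (big_ord_widen (maxn n N) (fun k => nsq (u k))) ?leq_maxr //.
rewrite big_mkcond [X in _ + X]big_mkcond -big_split /=; apply: ler_sum => i _.
case: (ltnP i N) => iN; first by case: ifP => _; rewrite ?add0r ?addr0.
by case: ifP => _; rewrite ?addr0 // nsq_ge0.
Qed.

Lemma etrunc_cvg u : (fun N => rnorm u ^+ 2 - \sum_(k < N) nsq (u k)) @ \oo --> (0 : R).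
Proof.
rewrite -[X in _ --> X](subrr (rnorm u ^+ 2)).
apply: cvgB; first exact: cvg_cst.
have e : series (fun n => nsq (u n)) = (fun N => \sum_(k < N) nsq (u k)).
  by apply/funext => n; rewrite /series /= big_mkord.
have h := @ell2_series_cvg u; rewrite e in h; exact: h.
Qed.

Lemma bop_etrunc_cvg (T : B) u m : ccvg (fun N => \sum_(n < N) u n * (T (ebasis R n)) m) (T u m).
Proof.
apply: (@ccvg_of_nsq _ _ (fun N => opnorm T ^+ 2 * (rnorm u ^+ 2 - \sum_(k < N) nsq (u k)))).
  move=> N.
  have -> : \sum_(n < N) u n * T (ebasis R n) m - T u m = - (T (u - etrunc N u)) m.
    rewrite bopB ell2_valB opprB; congr (_ - _).
    by rewrite /etrunc bop_sum ell2_val_sum; apply: eq_bigr => n _; rewrite bopZ.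
  rewrite nsqN; apply: le_trans (nsq_coord _ _) _.
  apply: (@le_trans _ _ ((opnorm T * rnorm (u - etrunc N u)) ^+ 2)).
    by rewrite ler_pXn2r ?nnegrE ?mulr_ge0 ?rnorm_ge0 ?opnorm_ge0 ?opnorm_ub.
  by rewrite exprMn ler_wpM2l ?sqr_ge0 // etrunc_res.
by rewrite -[X in _ --> X](mulr0 (opnorm T ^+ 2)); apply: cvgMr; exact: etrunc_cvg.
Qed.

Lemma bop_ext (S T : B) : (forall n, S (ebasis R n) = T (ebasis R n)) -> forall u, S u = T u.
Proof.
move=> h u; apply: ell2_eq => m; apply: ccvg_unique (bop_etrunc_cvg S u m) _.
have -> : (fun N => \sum_(n < N) u n * S (ebasis R n) m) = (fun N => \sum_(n < N) u n * T (ebasis R n) m).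
  by apply/funext => N; apply: eq_bigr => n _; rewrite h.
exact: bop_etrunc_cvg.
Qed.

Lemma innerp_cvg u v : ccvg (fun N => \sum_(n < N) u n * (v n)^*) (innerp u v).
Proof.
apply: (@ccvg_of_nsq _ _ (fun N => rnorm v ^+ 2 * (rnorm u ^+ 2 - \sum_(k < N) nsq (u k)))).
  move=> N.
  have e : forall w : E, (forall k, (N <= k)%N -> w k = 0) -> innerp w v = \sum_(n < N) w n * (v n)^*.
    move=> w hw; rewrite /innerp /= /ell2_ip /csum.
    have l (f : nat -> R) : (forall k, (N <= k)%N -> f k = 0) -> limn (series f) = \sum_(k < N) f k.
      move=> f0; apply/cvg_lim => //; apply: cvg_near_cst; exists N => // n /= Nn.
      rewrite /series /= big_mkord [RHS](big_ord_widen n f Nn) [RHS]big_mkcond /=.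
      by apply: eq_bigr => i _; case: ltnP => // /f0 ->.
    rewrite !l.
    + by apply/eqP; rewrite eq_complex /= Re_sum Im_sum !eqxx.
    + by move=> k Nk; rewrite /= hw // mul0r.
    + by move=> k Nk; rewrite /= hw // mul0r.
  have -> : \sum_(n < N) u n * (v n)^* = innerp (etrunc N u) v.
    rewrite e => [|k Nk]; last by rewrite etruncE ltnNge Nk.
    by apply: eq_bigr => n _; rewrite etruncE ltn_ord.
  have -> : innerp (etrunc N u) v - innerp u v = - innerp (u - etrunc N u) v.
    by rewrite linearBl opprB.
  rewrite nsqN; apply: le_trans (innerp_CS _ _) _.
  by rewrite mulrC ler_wpM2l ?sqr_ge0 // etrunc_res.
by rewrite -[X in _ --> X](mulr0 (rnorm v ^+ 2)); apply: cvgMr; exact: etrunc_cvg.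
Qed.

Lemma innerp_ebasis u n : innerp u (ebasis R n) = u n.
Proof.
apply: ccvg_unique (innerp_cvg _ _) _.
have e N : (n < N)%N -> \sum_(k < N) u k * (ebasis R n k)^* = u n.
  move=> nN; have -> : \sum_(k < N) u k * (ebasis R n k)^* = \sum_(k < N) u k * ((k : nat) == n)%:R.
    by apply: eq_bigr => k _; rewrite ebasisE conjC_nat.
  rewrite (bigD1 (Ordinal nN)) //= eqxx mulr1 big1 ?addr0 // => i ik.
  by rewrite (_ : _ == _ = false) ?mulr0 //; apply/negbTE.
by split; apply: cvg_near_cst; exists n.+1 => // N /= nN; rewrite e.
Qed.

End Ell2Basics.

(** * Operators given by matrices *)

Section BopConstructions.
Variable R : realType.
Local Notation C := R[i].
Local Notation Re := (@complex.Re R).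
Local Notation Im := (@complex.Im R).
Local Notation E := (ell2 R).
Local Notation B := (bop E E).

Lemma mk_bop (H K : hilbertType R) (f : H -> K) (M : R) : 0 <= M -> linear f ->
  (forall u, rnorm (f u) ^+ 2 <= M ^+ 2 * rnorm u ^+ 2) ->
  exists T : bop H K, (forall u, T u = f u) /\ opnorm T <= M.
Proof.
move=> M0 fl fM.
have fM' u : rnorm (f u) <= M * rnorm u.
  by rewrite -(@ler_pXn2r _ 2) ?nnegrE ?mulr_ge0 ?rnorm_ge0 // exprMn.
have fP : f \in @bop_pred R H K.
  apply/asboolP; split => //; exists M => u.
  by rewrite (rnormE u) (rnormE (f u)) -rmorphM lecR /=.
by exists (Bop fP); split=> //; apply: opnorm_le.
Qed.

Lemma opnorm_sqr (H K : hilbertType R) (T : bop H K) u :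
  rnorm (T u) ^+ 2 <= opnorm T ^+ 2 * rnorm u ^+ 2.
Proof.
by rewrite -exprMn ler_pXn2r ?nnegrE ?mulr_ge0 ?rnorm_ge0 ?opnorm_ge0 ?opnorm_ub.
Qed.

Fact bcomp_subproof (H K L : hilbertType R) (S : bop K L) (T : bop H K) :
  (fun u => S (T u)) \in @bop_pred R H L.
Proof.
apply/asboolP; split; first by move=> a u v; rewrite bop_lin bop_lin.
exists (opnorm S * opnorm T) => u; rewrite (rnormE u) (rnormE (S _)) -rmorphM lecR /=.
apply: le_trans (opnorm_ub _ _) _; rewrite -mulrA ler_wpM2l ?opnorm_ge0 //.
exact: opnorm_ub.
Qed.
Definition bcomp (H K L : hilbertType R) (S : bop K L) (T : bop H K) : bop H L := Bop (bcomp_subproof S T).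

Lemma bopscaleE (H K : hilbertType R) a (T : bop H K) u : (a *: T) u = a *: T u.
Proof. by []. Qed.
Lemma bopsubE (H K : hilbertType R) (S T : bop H K) u : (S - T) u = S u - T u.
Proof. by []. Qed.
Lemma bopsumE (H K : hilbertType R) (I : Type) (r : seq I) (P : pred I) (F : I -> bop H K) u :
  (\sum_(i <- r | P i) F i) u = \sum_(i <- r | P i) F i u.
Proof. by elim/big_rec2: _ => [|i a b _ <-]. Qed.

Lemma ccvg_sum k (x : nat -> nat -> C) (l : nat -> C) : (forall i, (i < k)%N -> ccvg (x i) (l i)) ->
  ccvg (fun n => \sum_(i < k) x i n) (\sum_(i < k) l i).
Proof.
elim: k => [|k ih] h.
  rewrite big_ord0; split; apply: cvg_near_cst; apply: nearW => n /=; by rewrite big_ord0.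
have [h1 h2] := ih (fun i ik => h i (ltnW ik)).
have [h3 h4] := h k (ltnSn k).
rewrite big_ord_recr /=; split; rewrite raddfD /=.
  rewrite (_ : _ \o _ = (fun n => Re (\sum_(i < k) x i n) + Re (x k n))); first exact: cvgD h1 h3.
  by apply/funext => n /=; rewrite big_ord_recr /= raddfD.
rewrite (_ : _ \o _ = (fun n => Im (\sum_(i < k) x i n) + Im (x k n))); first exact: cvgD h2 h4.
by apply/funext => n /=; rewrite big_ord_recr /= raddfD.
Qed.

Lemma ccvgMr (x : nat -> C) l c : ccvg x l -> ccvg (fun n => x n * c) (l * c).
Proof.
move=> h; have := ccvg_nsq (x := fun n => x n - l) (l := 0).
have hd : ccvg (fun n => x n - l) 0.
  case: h => h1 h2; split; rewrite /comp.
    have -> : (fun n => Re (x n - l)) = (fun n => Re (x n) - Re l).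
      by apply/funext => n; rewrite raddfB.
    rewrite -[X in _ --> X](subrr (Re l)); apply: cvgB; [exact: h1|exact: cvg_cst].
  have -> : (fun n => Im (x n - l)) = (fun n => Im (x n) - Im l).
    by apply/funext => n; rewrite raddfB.
  rewrite -[X in _ --> X](subrr (Im l)); apply: cvgB; [exact: h2|exact: cvg_cst].
move=> /(_ hd); rewrite nsq0 => h0.
apply: (@ccvg_of_nsq _ _ _ (fun n => nsq c * nsq (x n - l))).
  by move=> n; rewrite -mulrBl nsqM mulrC.
by rewrite -[X in _ --> X](mulr0 (nsq c)); apply: cvgMr.
Qed.

(** A bounded functional sends the truncations of [u], which converge in norm, to a sequence
    converging to its value. *)
Lemma functional_cvg (L : E -> C) (M : R) (u : E) : 0 <= M ->
  (forall a u v, L (a *: u + v) = a * L u + L v) ->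
  (forall u, nsq (L u) <= M * rnorm u ^+ 2) ->
  ccvg (fun N => \sum_(n < N) u n * L (ebasis R n)) (L u).
Proof.
move=> M0 Ll LM.
apply: (@ccvg_of_nsq _ _ _ (fun N => M * (rnorm u ^+ 2 - \sum_(k < N) nsq (u k)))).
  move=> N.
  have L0 : L 0 = 0.
    by have := Ll (-1) 0 0; rewrite scaler0 addr0 mulN1r addNr.
  have Ls (w : nat -> C) k : L (\sum_(n < k) w n *: ebasis R n) = \sum_(n < k) w n * L (ebasis R n).
    elim: k => [|k ih]; first by rewrite !big_ord0.
    by rewrite !big_ord_recr /= addrC Ll ih addrC.
  have -> : \sum_(n < N) u n * L (ebasis R n) - L u = - L (u - etrunc N u).
    have e : u - etrunc N u = (-1) *: etrunc N u + u by rewrite scaleN1r addrC.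
    by rewrite e Ll mulN1r opprD opprK /etrunc Ls.
  rewrite nsqN; apply: le_trans (LM _) _.
  by rewrite ler_wpM2l // etrunc_res.
by rewrite -[X in _ --> X](mulr0 M); apply: cvgMr; exact: etrunc_cvg.
Qed.

(** The rows are square-summable, so the coordinates of the image of [u] are inner products; the
    bound on finite sections passes to the limit. *)
Lemma mx_bop (M : nat -> nat -> C) (c : R) : 0 <= c -> mbound M (c ^+ 2) ->
  exists T : B, (forall s t, T (ebasis R t) s = M s t) /\ opnorm T <= c.
Proof.
move=> c0 Mc.
have rowb s n : \sum_(t < n) nsq ((M s t)^*) <= c ^+ 2.
  set S := \sum_(t < n) _.
  have S0 : 0 <= S by apply: sumr_ge0 => t _; exact: nsq_ge0.
  have := Mc s.+1 n (fun t => (M s t)^*).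
  rewrite big_ord_recr /=.
  have -> : \sum_(t < n) M s t * (M s t)^* = S%:C%C.
    rewrite /S sum_realc; apply: eq_bigr => t _.
    by rewrite nsq_mul_conj nsq_conj.
  rewrite nsq_real -/S => h.
  have h2 : S ^+ 2 <= c ^+ 2 * S.
    by apply: le_trans h; rewrite lerDr; apply: sumr_ge0 => t _; exact: nsq_ge0.
  have [->|Sn] := eqVneq S 0; first exact: sqr_ge0.
  have Sp : 0 < S by rewrite lt_neqAle eq_sym Sn.
  by rewrite -(ler_pM2r Sp) -expr2.
have [r hr] := choice (fun s => mk_ell2 (x := fun t => (M s t)^*) (rowb s)).
pose x (u : E) s := innerp u (r s).
have xs (u : E) s : ccvg (fun N => \sum_(t < N) M s t * u t) (x u s).
  have := innerp_cvg u (r s).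
  suff -> : (fun N => \sum_(n < N) u n * (r s n)^*) = (fun N => \sum_(t < N) M s t * u t) by [].
  by apply/funext => N; apply: eq_bigr => t _; rewrite (hr s).1 conjCK mulrC.
have xb (u : E) S : \sum_(s < S) nsq (x u s) <= c ^+ 2 * rnorm u ^+ 2.
  have e : (fun N => \sum_(s < S) nsq (\sum_(t < N) M s t * u t)) @ \oo --> \sum_(s < S) nsq (x u s).
    apply: cvg_big => [|s _]; first exact: add_continuous.
    exact: ccvg_nsq.
  apply: (cvgr_to_le e); apply: nearW => N; apply: le_trans (Mc _ _ _) _.
  by rewrite ler_wpM2l ?sqr_ge0 // ell2_partial_sum.
have [f hf] := choice (fun u => mk_ell2 (x := x u) (xb u)).
have fl : linear f.
  move=> a u v; apply: ell2_eq => n; rewrite ell2_valD ell2_valZ !(hf _).1 /x.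
  by rewrite linearPl.
have [T [hT Tc]] := mk_bop c0 fl (fun u => (hf u).2).
exists T; split=> // s t; rewrite hT (hf _).1 /x innerp_conj innerp_ebasis (hr s).1.
by rewrite conjCK.
Qed.

Lemma bop_mbound (T : B) : mbound (fun s t => T (ebasis R t) s) (opnorm T ^+ 2).
Proof.
move=> S N u.
have [w [hw wN]] : exists w : E, (forall t, w t = if (t < N)%N then u t else 0) /\
    rnorm w ^+ 2 <= \sum_(t < N) nsq (u t).
  have : forall n, \sum_(k < n) nsq (if (k < N)%N then u k else 0) <= \sum_(t < N) nsq (u t).
    move=> n; rewrite (big_ord_widen (maxn n N) (fun k => nsq (if (k < N)%N then u k else 0))) ?leq_maxl //.
    rewrite (big_ord_widen (maxn n N) (fun k => nsq (u k))) ?leq_maxr //.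
    rewrite big_mkcond [leRHS]big_mkcond; apply: ler_sum => i _.
    by case: (ltnP i N) => _; case: ifP => _; rewrite ?nsq0 ?nsq_ge0.
  exact: (mk_ell2 (x := fun t => if (t < N)%N then u t else 0)).
have wE : T w = \sum_(t < N) u t *: T (ebasis R t).
  have -> : w = \sum_(t < N) u t *: ebasis R t.
    apply: ell2_eq => n; have <- : etrunc N w n = (\sum_(t < N) u t *: ebasis R t) n.
      by rewrite /etrunc !ell2_val_sum; apply: eq_bigr => t _; rewrite !ell2_valZ hw ltn_ord.
    by rewrite etruncE hw; case: ifP.
  by rewrite bop_sum; apply: eq_bigr => t _; rewrite bopZ.
have e s : \sum_(t < N) T (ebasis R t) s * u t = T w s.
  by rewrite wE ell2_val_sum; apply: eq_bigr => t _; rewrite ell2_valZ mulrC.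
have -> : \sum_(s < S) nsq (\sum_(t < N) T (ebasis R t) s * u t) = \sum_(s < S) nsq (T w s).
  by apply: eq_bigr => s _; rewrite e.
apply: le_trans (ell2_partial_sum _ _) _.
by apply: le_trans (opnorm_sqr _ _) _; rewrite ler_wpM2l ?sqr_ge0.
Qed.

End BopConstructions.

(** * Hilbert-Schmidt and trace norms *)

Section SchattenBounds.
Variable R : realType.
Local Notation C := R[i].
Local Notation Re := (@complex.Re R).
Local Notation Im := (@complex.Im R).
Local Notation E := (ell2 R).
Local Notation B := (bop E E).
Local Notation e_ := (ebasis R).

(** The square of [hsnorm], a countable sum that can be integrated termwise. *)
Definition hs2 (T : B) : \bar R := (\sum_(0 <= n <oo) (rnorm (T (e_ n)) ^+ 2)%:E)%E.

Lemma hs2_ge0 T : (0 <= hs2 T)%E.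
Proof. by apply: nneseries_ge0 => n _ _; rewrite lee_fin sqr_ge0. Qed.

Lemma hsnorm_sqr T : (hsnorm T ^+ 2 = hs2 T)%E.
Proof. by rewrite /hsnorm sqr_sqrte //; exact: hs2_ge0. Qed.

Lemma nneseries_le (f : nat -> \bar R) (M : \bar R) : (forall n, (0 <= f n)%E) ->
  (forall N, (\sum_(n < N) f n <= M)%E) -> (\sum_(0 <= n <oo) f n <= M)%E.
Proof.
move=> f0 h; apply: lime_le; first by apply: is_cvg_nneseries => n _ _.
by apply: nearW => n; rewrite big_mkord.
Qed.

Lemma nneseries_partial (f : nat -> \bar R) N : (forall n, (0 <= f n)%E) ->
  (\sum_(n < N) f n <= \sum_(0 <= n <oo) f n)%E.
Proof.
by move=> f0; have := nneseries_lim_ge N (fun n (_ : (0 <= n)%N) (_ : true) => f0 n); rewrite big_mkord.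
Qed.

Lemma ell2_esum (u : E) : (\sum_(0 <= m <oo) (nsq (u m))%:E = (rnorm u ^+ 2)%:E)%E.
Proof.
apply/cvg_lim => //; have h := @ell2_series_cvg R u.
have -> : (fun n => \sum_(0 <= i < n) (nsq (u i))%:E)%E = EFin \o series (fun n => nsq (u n)).
  by apply/funext => n; rewrite /series /= sumEFin.
by apply: cvg_EFin => //; apply: nearW.
Qed.

Lemma hs2_partial (T : B) (h : R) N : (hs2 T <= h%:E)%E ->
  \sum_(n < N) rnorm (T (e_ n)) ^+ 2 <= h.
Proof.
move=> Th; rewrite -lee_fin -sumEFin; apply: le_trans Th.
by apply: nneseries_partial => n; rewrite lee_fin sqr_ge0.
Qed.

Lemma hs2_bound (T : B) (h : R) u : (hs2 T <= h%:E)%E -> rnorm (T u) ^+ 2 <= h * rnorm u ^+ 2.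
Proof.
move=> Th.
have h0 : 0 <= h by rewrite -lee_fin; apply: le_trans Th; exact: hs2_ge0.
apply: (cvgr_to_le (@ell2_series_cvg R (T u))); apply: nearW => N; rewrite /series /= big_mkord.
have c : (fun K => \sum_(m < N) nsq (\sum_(n < K) u n * T (e_ n) m)) @ \oo --> \sum_(m < N) nsq (T u m).
  apply: cvg_big => [|m _]; first exact: add_continuous.
  by apply: ccvg_nsq; exact: bop_etrunc_cvg.
apply: (cvgr_to_le c); apply: nearW => K.
apply: (@le_trans _ _ (\sum_(m < N) (\sum_(n < K) nsq (u n)) * (\sum_(n < K) nsq (T (e_ n) m)))).
  by apply: ler_sum => m _; apply: (@nsq_CS R K u (fun n => T (e_ n) m)).
rewrite -mulr_sumr mulrC; apply: ler_pM.
- by apply: sumr_ge0 => i _; apply: sumr_ge0 => j _; exact: nsq_ge0.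
- by apply: sumr_ge0 => j _; exact: nsq_ge0.
- rewrite exchange_big /=; apply: le_trans (hs2_partial K Th); apply: ler_sum => n _.
  exact: ell2_partial_sum.
- exact: ell2_partial_sum.
Qed.

(** The hypothesis says that the map with values [h b] on the unit vectors is a contraction, and
    the conclusion says it of its adjoint. *)
Lemma bessel_semi (H : hilbertType R) (K : nat) (h : nat -> H) (y : H) :
  (forall c : nat -> C, rnorm (\sum_(b < K) c b *: h b) ^+ 2 <= \sum_(b < K) nsq (c b)) ->
  \sum_(b < K) nsq (innerp y (h b)) <= rnorm y ^+ 2.
Proof.
move=> hc; pose c b := innerp y (h b); set S := \sum_(b < K) _.
have S0 : 0 <= S by apply: sumr_ge0 => b _; exact: nsq_ge0.
pose z := \sum_(b < K) c b *: h b.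
have yz : innerp y z = S%:C%C.
  rewrite innerp_conj /z (semi_suml (@innerp_lin R H)) rmorph_sum /= /S sum_realc; apply: eq_bigr => b _.
  by rewrite linearZl_LR /= rmorphM /= -innerp_conj mulrC nsq_mul_conj.
have := innerp_CS y z; rewrite yz nsq_real => h1.
have h2 : S ^+ 2 <= rnorm y ^+ 2 * S by apply: le_trans h1 _; rewrite ler_wpM2l ?sqr_ge0 // hc.
have [->|Sn] := eqVneq S 0; first exact: sqr_ge0.
have Sp : 0 < S by rewrite lt_neqAle eq_sym Sn.
by rewrite -(ler_pM2r Sp) -expr2.
Qed.

(** Polarization: the form is real at [u + v] and at [u + 'i *: v]. *)
Lemma positive_hermitian (p : B) : (forall u, 0 <= innerp (p u) u) ->
  forall u v, innerp (p u) v = innerp u (p v).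
Proof.
move=> p0.
pose q u v := innerp (p u) v.
have ql u w v : q (u + w) v = q u v + q w v by rewrite /q bopD linearDl.
have qr u w v : q v (u + w) = q v u + q v w by rewrite /q linearD.
have qZl a u v : q (a *: u) v = a * q u v by rewrite /q bopZ linearZl_LR.
have qZr a u v : q u (a *: v) = a^* * q u v by rewrite /q linearZr_LR.
have im0 u : Im (q u u) = 0 by apply: ger0_Im; exact: p0.
have H u v : q u v = (q v u)^*.
  have i2 : ('i%C : C)^* = - 'i%C by apply/eqP; rewrite eq_complex /= oppr0 !eqxx.
  have h1 := im0 (u + v); rewrite ql !qr in h1.
  have h2 := im0 (u + 'i%C *: v); rewrite ql !qr !qZl !qZr i2 in h2.
  move: h1 h2 (im0 u) (im0 v).
  case: (q u u) (q u v) (q v u) (q v v) => [a0 b0] [a1 b1] [a2 b2] [a3 b3] /= h1 h2 h3 h4.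
  by apply/eqP; rewrite eq_complex /=; apply/andP; split; apply/eqP; lra.
move=> u v; rewrite -[LHS]/(q u v) H /q innerp_conj conjCK.
by [].
Qed.

Lemma Re_mul_le (w : R) (be ga : C) : 0 < w -> Re (be * ga) <= w * nsq ga + w^-1 * nsq be.
Proof.
move=> w0; have wV : w * w^-1 = 1 by rewrite divff // gt_eqF.
have w1 : 0 < w^-1 by rewrite invr_gt0.
case: be ga => [p q] [r s]; rewrite /nsq /=.
have e1 : 0 <= w^-1 * (p - w * r) ^+ 2 by rewrite mulr_ge0 ?sqr_ge0 // ltW.
have e2 : 0 <= w^-1 * (q + w * s) ^+ 2 by rewrite mulr_ge0 ?sqr_ge0 // ltW.
have e3 : w^-1 * (p - w * r) ^+ 2 = w^-1 * p ^+ 2 - 2 * (p * r) * (w * w^-1) + w * r ^+ 2 * (w * w^-1) by ring.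
have e4 : w^-1 * (q + w * s) ^+ 2 = w^-1 * q ^+ 2 + 2 * (q * s) * (w * w^-1) + w * s ^+ 2 * (w * w^-1) by ring.
rewrite e3 wV in e1; rewrite e4 wV in e2.
have e5 : 0 <= w * (r ^+ 2 + s ^+ 2) by rewrite mulr_ge0 ?(ltW w0) // addr_ge0 ?sqr_ge0.
have e6 : 0 <= w^-1 * (p ^+ 2 + q ^+ 2) by rewrite mulr_ge0 ?(ltW w1) // addr_ge0 ?sqr_ge0.
lra.
Qed.

Section PolarPairing.
Variables (x p : B) (xp : is_absop x p) (N : nat).

Let F (u v : E) : C := innerp (p u) (p v).

Let FE u v : F u v = innerp (x u) (x v).
Proof. by rewrite /F -(positive_hermitian xp.1) xp.2. Qed.

Let Fl w : scalar (F ^~ w).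
Proof. by move=> a u v; rewrite /F bop_lin innerp_lin. Qed.

Let Fc u v : F u v = (F v u)^*.
Proof. exact: innerp_conj. Qed.

Let Fp u : 0 <= F u u.
Proof. exact: innerp_ge0. Qed.

Let s_ := gs F e_.

Let comb_le (T : B) (c : nat -> C) : (forall u v, innerp (T u) (T v) = F u v) ->
  rnorm (\sum_(b < N) c b *: T (s_ b)) ^+ 2 <= \sum_(b < N) nsq (c b).
Proof.
move=> TF.
have -> : \sum_(b < N) c b *: T (s_ b) = T (\sum_(b < N) c b *: s_ b).
  by rewrite bop_sum; apply: eq_bigr => b _; rewrite bopZ.
have := ler_Re (gs_comb_le Fl Fc Fp e_ N c).
by rewrite Re_sum_normsq -TF -rnorm_innerp.
Qed.

(** In place of the polar decomposition x = U p: the inner products of p u, p v and of x u, x v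
    coincide, so U maps the [p (s_ b)] to the [x (s_ b)], both orthonormal up to zero vectors,
    when [s_] is obtained by Gram-Schmidt from the basis. The vector [z n] is U applied to the
    projection of [e_ n] on this finite-dimensional range. *)
Lemma polar_vectors : exists z : nat -> E,
  (forall n, (n < N)%N -> innerp (p (e_ n)) (e_ n) = innerp (x (e_ n)) (z n)) /\
  (forall y, \sum_(n < N) nsq (innerp y (z n)) <= rnorm y ^+ 2).
Proof.
pose h b := x (s_ b); pose f b := p (s_ b).
exists (fun n => \sum_(b < N) (f b n)^* *: h b).
have zE y n : innerp y (\sum_(b < N) (f b n)^* *: h b) = (\sum_(b < N) innerp y (h b) *: f b) n.
  rewrite (semi_sumr (@innerp_lin R E) (@innerp_conj R E)) ell2_val_sum; apply: eq_bigr => b _.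
  by rewrite (semiZr (@innerp_lin R E) (@innerp_conj R E)) conjCK mulrC ell2_valZ.
split.
  move=> n nN; rewrite zE innerp_ebasis; congr (ell2_val _ n).
  have n0 := gs_proj_null Fl Fc Fp e_ nN.
  have d0 : p (e_ n - gs_proj F e_ N (e_ n)) = 0.
    apply: rnorm_eq0; have := rnorm_innerp (p (e_ n - gs_proj F e_ N (e_ n))).
    by rewrite [RHS]n0 => -[] /eqP; rewrite sqrf_eq0 => /eqP.
  move/eqP : d0; rewrite bopB subr_eq0 => /eqP ->.
  by rewrite bop_sum; apply: eq_bigr => b _; rewrite bopZ FE.
move=> y.
have -> : \sum_(n < N) nsq (innerp y (\sum_(b < N) (f b n)^* *: h b)) =
    \sum_(n < N) nsq ((\sum_(b < N) innerp y (h b) *: f b) n).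
  by apply: eq_bigr => n _; rewrite zE.
apply: le_trans (ell2_partial_sum _ _) _.
apply: le_trans (comb_le (T := p) (fun b => innerp y (h b)) _) _ => //.
apply: bessel_semi => c; apply: (comb_le (T := x)) => u v; exact/esym/FE.
Qed.
End PolarPairing.

(** By [polar_vectors], tr|x| is a sum of inner products of x e_n and z_n. Each a_i b_i
    contributes the inner product of b_i e_n and a_i^* z_n, which is split by the inequality
    between the means; the z_n form a contraction, so the squares of the a_i^* z_n add up to at
    most [hs2 (a i)]. The weights [w] allow a small factor to compensate for a large one. *)
Lemma trnorm_sum_le (k : nat) (a b : nat -> B) (w : nat -> R) (x : B) :
  (forall i, 0 < w i) ->
  (forall u, x u = \sum_(i < k) a i (b i u)) ->
  (trnorm x <= \sum_(i < k) ((w i)%:E * hs2 (a i) + ((w i)^-1)%:E * hs2 (b i)))%E.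
Proof.
move=> w0 xE; set rhs := (\sum_(i < k) _)%E.
have wV i : 0 < (w i)^-1 by rewrite invr_gt0.
have rhs0 : (0 <= rhs)%E.
  by apply: sume_ge0 => i _; rewrite adde_ge0 // mule_ge0 ?hs2_ge0 // lee_fin ltW.
have [xp|x0] : is_absop x (absop x) \/ absop x = 0.
  by rewrite /absop; case: xgetP => [y _ h|h]; [left|right].
  apply: nneseries_le => [n|N]; first by rewrite lee_fin; apply: (ler_Re (xp.1 _)).
  have [z [zp zb]] := polar_vectors xp N.
  rewrite sumEFin.
  case: (rhs =P +oo%E) => [->|/eqP rhsy]; first exact: leey.
  have rf : rhs \is a fin_num by rewrite ge0_fin_numE // ltey.
  rewrite -(fineK rf) lee_fin.
  pose q M := \sum_(i < k) \sum_(n < N) \sum_(m < M) b i (e_ n) m * innerp (a i (e_ m)) (z n).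
  have qc : ccvg q (\sum_(i < k) \sum_(n < N) innerp (a i (b i (e_ n))) (z n)).
    apply: (ccvg_sum (x := fun i M => \sum_(n < N) \sum_(m < M) b i (e_ n) m * innerp (a i (e_ m)) (z n))
      (l := fun i => \sum_(n < N) innerp (a i (b i (e_ n))) (z n))) => i _.
    apply: (ccvg_sum (x := fun n M => \sum_(m < M) b i (e_ n) m * innerp (a i (e_ m)) (z n))
      (l := fun n => innerp (a i (b i (e_ n))) (z n))) => n _.
    apply: (@functional_cvg R (fun u => innerp (a i u) (z n)) (opnorm (a i) ^+ 2 * rnorm (z n) ^+ 2)).
    - by rewrite mulr_ge0 ?sqr_ge0.
    - by move=> c u v; rewrite bop_lin innerp_lin.
    - move=> u; apply: le_trans (innerp_CS _ _) _; rewrite [leRHS]mulrAC ler_wpM2r ?sqr_ge0 //.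
      exact: opnorm_sqr.
  have -> : \sum_(n < N) Re (innerp (absop x (e_ n)) (e_ n)) =
      Re (\sum_(i < k) \sum_(n < N) innerp (a i (b i (e_ n))) (z n)).
    rewrite exchange_big Re_sum; apply: eq_bigr => n _; rewrite (zp _ (ltn_ord n)) xE; congr Re.
    by rewrite (semi_suml (@innerp_lin R E)).
  apply: (cvgr_to_le qc.1); apply: nearW => M.
  rewrite -lee_fin fineK // /comp /q Re_sum -sumEFin; apply: lee_sum => i _.
  apply: (@le_trans _ _ ((w i)%:E * (\sum_(m < M) rnorm (a i (e_ m)) ^+ 2)%:E +
      ((w i)^-1)%:E * (\sum_(n < N) rnorm (b i (e_ n)) ^+ 2)%:E)%E); last first.
    rewrite -!sumEFin; apply: leeD; apply: lee_wpmul2l; rewrite ?lee_fin ?(ltW (w0 i)) ?(ltW (wV i)) //;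
      by apply: nneseries_partial => n; rewrite lee_fin sqr_ge0.
  rewrite -!EFinM -EFinD lee_fin.
  apply: (@le_trans _ _ (\sum_(n < N) \sum_(m < M) (w i * nsq (innerp (a i (e_ m)) (z n)) + (w i)^-1 * nsq (b i (e_ n) m)))).
    rewrite Re_sum; apply: ler_sum => n _; rewrite Re_sum; apply: ler_sum => m _.
    exact: Re_mul_le.
  have -> : \sum_(n < N) \sum_(m < M) (w i * nsq (innerp (a i (e_ m)) (z n)) + (w i)^-1 * nsq (b i (e_ n) m)) =
     w i * (\sum_(m < M) \sum_(n < N) nsq (innerp (a i (e_ m)) (z n))) +
     (w i)^-1 * \sum_(n < N) \sum_(m < M) nsq (b i (e_ n) m).
    transitivity (\sum_(n < N) \sum_(m < M) w i * nsq (innerp (a i (e_ m)) (z n)) +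
        \sum_(n < N) \sum_(m < M) (w i)^-1 * nsq (b i (e_ n) m)).
      by rewrite -big_split; apply: eq_bigr => n _; rewrite big_split.
    congr (_ + _); last by rewrite mulr_sumr; apply: eq_bigr => n _; rewrite mulr_sumr.
    by rewrite exchange_big mulr_sumr; apply: eq_bigr => m _; rewrite mulr_sumr.
  apply: lerD; rewrite ler_pM2l //; apply: ler_sum => m _; first exact: zb.
  exact: ell2_partial_sum.
rewrite /trnorm x0 eseries0 // => n _ _.
by rewrite (_ : (0 : B) (e_ n) = 0) // (semi0l (@innerp_lin R E)).
Qed.
End SchattenBounds.

(** * The norm of M_3 in terms of kernels and matrices *)

Section M3Kernel.
Variable R : realType.
Local Notation C := R[i].
Local Notation Re := (@complex.Re R).
Local Notation E := (ell2 R).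
Local Notation e_ := (ebasis R).

Definition gram (H : hilbertType R) (u : nat -> H) (s s' : nat) : C := innerp (u s) (u s').

Lemma kform_gram (H : hilbertType R) (u : nat -> H) S c :
  kform (gram u) S c = rnorm (\sum_(s < S) c s *: u s) ^+ 2.
Proof.
have : (rnorm (\sum_(s < S) c s *: u s) ^+ 2)%:C%C = (kform (gram u) S c)%:C%C; last by case.
rewrite rnorm_innerp [LHS](ge0_realc (innerp_ge0 _)); congr (_ %:C)%C; rewrite /kform; congr Re.
rewrite (semi_suml (@innerp_lin R H)); apply: eq_bigr => s _.
rewrite (semiZl (@innerp_lin R H)) (semi_sumr (@innerp_lin R H) (@innerp_conj R H)) mulr_sumr.
apply: eq_bigr => s' _.
by rewrite (semiZr (@innerp_lin R H) (@innerp_conj R H)) mulrA.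
Qed.

Lemma psd_gram (H : hilbertType R) (u : nat -> H) : psd_kernel (gram u).
Proof.
split; first by move=> s s'; exact: innerp_conj.
by move=> S c; rewrite kform_gram sqr_ge0.
Qed.

Lemma kform_scale (r : R) K S c : kform (fun s s' => r%:C%C * K s s') S c = r * kform K S c.
Proof.
rewrite /kform -ReM_real; congr Re; rewrite mulr_sumr; apply: eq_bigr => s _.
by rewrite mulr_sumr; apply: eq_bigr => s' _; rewrite mulrCA.
Qed.

Lemma psd_scale (r : R) K : 0 <= r -> psd_kernel K -> psd_kernel (fun s s' => r%:C%C * K s s').
Proof.
move=> r0 [hK pK]; split=> [s s'|S c]; last by rewrite kform_scale mulr_ge0.
by rewrite hK rmorphM /= conj_realc.
Qed.

Lemma rnorm_sqr_C (z : C) : rnorm z ^+ 2 = nsq z.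
Proof.
by rewrite -Re_normsq (ge0_realc (normr_ge0 z)) -rmorphXn.
Qed.

(** The kernel [K3] is multiplied by the square of the bound [n2] of xi_2, which makes xi_2(k) a
    contraction for the two kernels. *)
Lemma M3_rep_kernel phi (H1 H2 : hilbertType R) (xi1 : nat -> bop H1 C)
    (xi2 : nat -> bop H2 H1) (xi3 : nat -> bop C H2) (n1 n2 n3 : R) :
  (forall t, opnorm (xi1 t) <= n1) -> (forall t, opnorm (xi2 t) <= n2) ->
  (forall t, opnorm (xi3 t) <= n3) ->
  (forall t1 t2 t3 : nat, phi (t1 + t2 + t3)%N = xi1 t1 (xi2 t2 (xi3 t3 1))) ->
  kernel_rep (fun i k j => phi (i + k + j)%N) (fun=> n1 ^+ 2) (fun=> (n2 * n3) ^+ 2).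
Proof.
move=> h1 h2 h3 hphi.
have p1 : 0 <= n1 by apply: le_trans (h1 0); exact: opnorm_ge0.
have p2 : 0 <= n2 by apply: le_trans (h2 0); exact: opnorm_ge0.
have p3 : 0 <= n3 by apply: le_trans (h3 0); exact: opnorm_ge0.
have ob (H K : hilbertType R) (T : bop H K) n u : opnorm T <= n -> rnorm (T u) ^+ 2 <= n ^+ 2 * rnorm u ^+ 2.
  move=> Tn; apply: le_trans (opnorm_sqr _ _) _; rewrite ler_wpM2r ?sqr_ge0 //.
  by rewrite ler_pXn2r ?nnegrE ?opnorm_ge0 //; apply: le_trans Tn; exact: opnorm_ge0.
pose v j := xi3 j 1.
pose u s := xi2 (nunpair s).1 (v (nunpair s).2).
exists (gram u), (fun j j' => (n2 ^+ 2)%:C%C * gram v j j'); split.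
- exact: psd_gram.
- by apply: psd_scale; [exact: sqr_ge0|exact: psd_gram].
- move=> k S c; rewrite kform_scale kform_gram.
  rewrite -[leLHS]/(kform (gram (fun j => u (npair (k, j)))) S c) kform_gram.
  have -> : \sum_(s < S) c s *: u (npair (k, s : nat)) = xi2 k (\sum_(s < S) c s *: v s).
    by rewrite bop_sum; apply: eq_bigr => s _; rewrite bopZ /u npairK.
  exact: ob.
- split=> [i|i S c]; first exact: sqr_ge0.
  rewrite kform_gram.
  have -> : \sum_(s < S) c s * phi (i + (nunpair s).1 + (nunpair s).2)%N = xi1 i (\sum_(s < S) c s *: u s).
    by rewrite bop_sum; apply: eq_bigr => s _; rewrite hphi bopZ.
  by rewrite -rnorm_sqr_C; exact: ob.
- move=> j; rewrite ReM_real exprMn ler_wpM2l ?sqr_ge0 // /gram -rnorm_innerp /=.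
  apply: le_trans (ob _ _ _ _ _ (h3 j)) _.
  by rewrite rnorm_sqr_C nsq1 mulr1.
Qed.

Lemma supnorm_ub (H K : hilbertType R) (T : nat -> bop H K) n : ((opnorm (T n))%:E <= supnorm T)%E.
Proof. by apply: ereal_sup_ubound; exists n. Qed.

Lemma supnorm_le (H K : hilbertType R) (T : nat -> bop H K) M : (forall n, opnorm (T n) <= M) -> (supnorm T <= M%:E)%E.
Proof. by move=> h; apply: ge_ereal_sup => _ [n _ <-]; rewrite lee_fin. Qed.

Lemma supnorm_ge0 (H K : hilbertType R) (T : nat -> bop H K) : (0 <= supnorm T)%E.
Proof. by apply: le_trans (supnorm_ub T 0); rewrite lee_fin opnorm_ge0. Qed.

(** The rows and columns define operators between [C] and [ell2]; by the support conditions the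
    finite sums are the matrix products. *)
Lemma matrix_rep_M3 phi (a b : R) A B D nb : 0 <= a -> 0 <= b ->
  matrix_rep (fun i k j => phi (i + k + j)%N) (fun=> a ^+ 2) (fun=> b ^+ 2) A B D nb ->
  (M3_norm phi <= (a * b)%:E)%E.
Proof.
move=> a0 b0 [hA hB hD [Bz Dz] hphi].
have hA' i n : \sum_(k < n) nsq ((A i k)^*) <= a ^+ 2.
  by apply: le_trans (hA i n); apply: ler_sum => k _; rewrite nsq_conj.
have [va hva] := choice (fun i => mk_ell2 (x := fun k => (A i k)^*) (hA' i)).
have [vd hvd] := choice (fun j => mk_ell2 (x := D j) (hD j)).
have [xi2 hxi2] := choice (fun k => mx_bop (c := 1) ler01 (M := B k)
  (eq_ind_r (mbound (B k)) (hB k) (expr1n R 2))).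
have f1 i : exists T : bop E C, (forall u, T u = innerp u (va i)) /\ opnorm T <= a.
  apply: mk_bop => //; first by move=> c u v; rewrite innerp_lin.
  move=> u; rewrite rnorm_sqr_C; apply: le_trans (innerp_CS _ _) _.
  by rewrite mulrC ler_wpM2r ?sqr_ge0 // (hva i).2.
have f3 j : exists T : bop C E, (forall z, T z = z *: vd j) /\ opnorm T <= b.
  apply: mk_bop => //; first by move=> c u v; rewrite scalerDl scalerA.
  move=> u; rewrite rnormZ rnorm_sqr_C mulrC ler_wpM2r ?nsq_ge0 //.
  exact: (hvd j).2.
have [xi1 hxi1] := choice f1; have [xi3 hxi3] := choice f3.
have s1 := supnorm_le (fun n => (hxi1 n).2).
have s2 := supnorm_le (fun n => (hxi2 n).2).
have s3 := supnorm_le (fun n => (hxi3 n).2).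
have rep : M3_rep phi xi1 xi2 xi3.
  split; [exact: le_lt_trans s1 (ltry _)|exact: le_lt_trans s2 (ltry _)|exact: le_lt_trans s3 (ltry _)|].
  move=> i k j; rewrite hphi (hxi3 j).1 scale1r.
  have -> : vd j = \sum_(b < j.+1) D j b *: e_ b.
    apply: ell2_eq => n; rewrite (hvd j).1.
    have -> : (\sum_(b < j.+1) D j b *: e_ b) n = etrunc j.+1 (vd j) n.
      by rewrite /etrunc !ell2_val_sum; apply: eq_bigr => l _; rewrite !ell2_valZ (hvd j).1.
    by rewrite etruncE (hvd j).1; case: ltnP => // h; rewrite Dz.
  rewrite bop_sum (hxi1 i).1 (semi_suml (@innerp_lin R E)); apply: eq_bigr => l _.
  rewrite bopZ (semiZl (@innerp_lin R E)) mulrC; congr (_ * _).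
  have -> : xi2 k (e_ l) = \sum_(s < nb k l) B k s l *: e_ s.
    apply: ell2_eq => n; rewrite (hxi2 k).1.
    have -> : (\sum_(s < nb k l) B k s l *: e_ s) n = etrunc (nb k l) (xi2 k (e_ l)) n.
      by rewrite /etrunc !ell2_val_sum; apply: eq_bigr => s _; rewrite !ell2_valZ (hxi2 k).1.
    by rewrite etruncE (hxi2 k).1; case: ltnP => // h; rewrite Bz.
  rewrite (semi_suml (@innerp_lin R E)); apply: eq_bigr => s _.
  by rewrite (semiZl (@innerp_lin R E)) innerp_conj innerp_ebasis (hva i).1 conjCK mulrC.
apply: (@le_trans _ _ (supnorm xi1 * supnorm xi2 * supnorm xi3)%E).
  by apply: ereal_inf_lbound; exists E, E, xi1, xi2, xi3.
rewrite -[(a * b)%:E](_ : (a%:E * 1%:E * b%:E)%E = _); last by rewrite mule1.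
by apply: lee_pmul => //; rewrite ?mule_ge0 ?supnorm_ge0 //; apply: lee_pmul => //; rewrite ?supnorm_ge0.
Qed.

Lemma M3_norm_lt_kernel phi (c : R) : (M3_norm phi < c%:E)%E ->
  exists a b : R, [/\ 0 <= a, 0 <= b, a * b < c &
    kernel_rep (fun i k j => phi (i + k + j)%N) (fun=> a ^+ 2) (fun=> b ^+ 2)].
Proof.
move=> /ereal_inf_lt [_ [H1 [H2 [xi1 [xi2 [xi3 [[f1 f2 f3 hphi] ->]]]]]]] lt.
have fn (H K : hilbertType R) (T : nat -> bop H K) : (supnorm T < +oo)%E ->
    supnorm T = (fine (supnorm T))%:E /\ (forall t, opnorm (T t) <= fine (supnorm T)) /\ 0 <= fine (supnorm T).
  move=> Tf; have fT : supnorm T \is a fin_num by rewrite ge0_fin_numE ?supnorm_ge0.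
  split; first by rewrite fineK.
  split; last by apply: fine_ge0; exact: supnorm_ge0.
  by move=> t; rewrite -lee_fin fineK //; exact: supnorm_ub.
have [e1 [ob1 p1]] := fn _ _ _ f1; have [e2 [ob2 p2]] := fn _ _ _ f2; have [e3 [ob3 p3]] := fn _ _ _ f3.
exists (fine (supnorm xi1)), (fine (supnorm xi2) * fine (supnorm xi3)); split => //.
- exact: mulr_ge0.
- by move: lt; rewrite e1 e2 e3 -!EFinM lte_fin !mulrA.
- exact: (M3_rep_kernel ob1 ob2 ob3 hphi).
Qed.

End M3Kernel.

(** * Integration of complex functions on the circle *)

Section CircleIntegrals.
Variable R : realType.
Local Notation C := R[i].
Local Notation Re := (@complex.Re R).
Local Notation Im := (@complex.Im R).
Local Notation mu := (@lebesgue_measure R).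
Local Notation D := (@unit_itv R).
Implicit Types P Q : R -> C.

Lemma measurable_unit_itv : measurable (D : set (measurableTypeR R)).
Proof. exact: measurable_itv. Qed.
Hint Resolve measurable_unit_itv : core.

Lemma mu_unit_itv : mu D = 1%E.
Proof. by rewrite /unit_itv lebesgue_measure_itv /= lte_fin ltr01 oppr0 adde0. Qed.

Definition cmeas P := measurable_fun D (Re \o P) /\ measurable_fun D (Im \o P).
Definition cintg P := mu.-integrable D (EFin \o (Re \o P)) /\ mu.-integrable D (EFin \o (Im \o P)).
Definition cint P : C := ((\int[mu]_(t in D) Re (P t)) +i* (\int[mu]_(t in D) Im (P t)))%C.

Lemma circle_intE (F : C -> C) : circle_int F = cint (fun t => F (circ t)).
Proof. by []. Qed.

Lemma cmeas_cst c : cmeas (fun=> c).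
Proof. by split; apply: measurable_cst. Qed.

Lemma cmeasD P Q : cmeas P -> cmeas Q -> cmeas (fun t => P t + Q t).
Proof.
move=> [h1 h2] [h3 h4]; split.
  rewrite (_ : _ \o _ = (Re \o P) \+ (Re \o Q)); first exact: measurable_funD.
  by apply/funext => t /=; rewrite raddfD.
rewrite (_ : _ \o _ = (Im \o P) \+ (Im \o Q)); first exact: measurable_funD.
by apply/funext => t /=; rewrite raddfD.
Qed.

Lemma cmeasM P Q : cmeas P -> cmeas Q -> cmeas (fun t => P t * Q t).
Proof.
move=> [h1 h2] [h3 h4]; split.
  rewrite (_ : _ \o _ = ((Re \o P) \* (Re \o Q)) \- ((Im \o P) \* (Im \o Q))).
    by apply: measurable_funB; apply: measurable_funM.
  by apply/funext => t /=; case: (P t) (Q t) => [a b] [c d].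
rewrite (_ : _ \o _ = ((Re \o P) \* (Im \o Q)) \+ ((Im \o P) \* (Re \o Q))).
  by apply: measurable_funD; apply: measurable_funM.
by apply/funext => t /=; case: (P t) (Q t) => [a b] [c d].
Qed.

Lemma cmeasZ c P : cmeas P -> cmeas (fun t => c * P t).
Proof. by apply: cmeasM; exact: cmeas_cst. Qed.

Lemma cmeas_conj P : cmeas P -> cmeas (fun t => (P t)^*).
Proof.
move=> [h1 h2]; split.
  by rewrite (_ : _ \o _ = Re \o P) //; apply/funext => t /=; case: (P t).
rewrite (_ : _ \o _ = \- (Im \o P)); first exact: measurable_funN.
by apply/funext => t /=; case: (P t).
Qed.

Lemma cmeas_sum n (F : nat -> R -> C) : (forall i, cmeas (F i)) -> cmeas (fun t => \sum_(i < n) F i t).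
Proof.
move=> h; elim: n => [|n ih].
  by rewrite (_ : (fun t => _) = fun=> 0); [exact: cmeas_cst|apply/funext => t; rewrite big_ord0].
rewrite (_ : (fun t => _) = fun t => \sum_(i < n) F i t + F n t); first exact: cmeasD.
by apply/funext => t; rewrite big_ord_recr.
Qed.

Lemma cmeas_cvg (F : nat -> R -> C) P : (forall i, cmeas (F i)) ->
  (forall t, D t -> ccvg (fun n => F n t) (P t)) -> cmeas P.
Proof.
move=> mF c; split.
  by apply: (measurable_fun_cvg (h := fun n => Re \o F n)) => [n|t Dt]; [exact: (mF n).1|exact: (c t Dt).1].
by apply: (measurable_fun_cvg (h := fun n => Im \o F n)) => [n|t Dt]; [exact: (mF n).2|exact: (c t Dt).2].
Qed.

Lemma cmeas_nsq P : cmeas P -> measurable_fun D (fun t => nsq (P t)).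
Proof.
move=> [h1 h2]; rewrite /nsq; apply: measurable_funD.
  by apply: (measurable_funX 2 h1).
by apply: (measurable_funX 2 h2).
Qed.

Lemma cmeas_ext P Q : (forall t, D t -> P t = Q t) -> cmeas P -> cmeas Q.
Proof.
move=> e [h1 h2]; split.
  by apply: (eq_measurable_fun (Re \o P)) => // t /[!inE] Dt /=; rewrite e.
by apply: (eq_measurable_fun (Im \o P)) => // t /[!inE] Dt /=; rewrite e.
Qed.

Lemma circ_nsq (t : R) : nsq (circ t) = 1.
Proof. by rewrite /nsq /circ /= cos2Dsin2. Qed.

Lemma nsqX (z : C) n : nsq (z ^+ n) = nsq z ^+ n.
Proof. by elim: n => [|n ih]; rewrite ?expr0 ?nsq1 // !exprS nsqM ih. Qed.

Lemma circX_nsq (t : R) n : nsq (circ t ^+ n) = 1.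
Proof. by rewrite nsqX circ_nsq expr1n. Qed.

Lemma circ_conj (t : R) n : circ t ^+ n * (circ t)^* ^+ n = 1.
Proof. by rewrite -rmorphXn /= nsq_mul_conj circX_nsq. Qed.

Lemma cmeas_circ : cmeas (@circ R).
Proof.
have c : continuous (fun t : R => 2 * pi * t).
  by move=> t; apply: cvgMr; exact: cvg_id.
split; apply: measurable_funTS; apply: continuous_measurable_fun.
  have cc : continuous (cos \o (fun t : R => 2 * pi * t)).
    by move=> t; apply: continuous_comp; [exact: c|exact: continuous_cos].
  exact: cc.
have cs : continuous (sin \o (fun t : R => 2 * pi * t)).
  by move=> t; apply: continuous_comp; [exact: c|exact: continuous_sin].
exact: cs.
Qed.

Lemma cmeasX P n : cmeas P -> cmeas (fun t => P t ^+ n).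
Proof.
move=> h; elim: n => [|n ih]; first exact: cmeas_cst.
rewrite (_ : (fun t => _) = fun t => P t * P t ^+ n); first exact: cmeasM.
by apply/funext => t; rewrite exprS.
Qed.

Lemma cmeas_circX n : cmeas (fun t => circ t ^+ n).
Proof. exact: cmeasX cmeas_circ. Qed.

Lemma cmeas_cconjX n : cmeas (fun t => (circ t)^* ^+ n).
Proof. exact: cmeasX (cmeas_conj cmeas_circ). Qed.

Lemma cintg_dom P (g : R -> \bar R) : cmeas P -> measurable_fun D g ->
  (forall t, D t -> (`|Re (P t)|%:E <= g t)%E) -> (forall t, D t -> (`|Im (P t)|%:E <= g t)%E) ->
  (\int[mu]_(t in D) g t < +oo)%E -> cintg P.
Proof.
move=> [h1 h2] mg gR gI gf.
have g0 t : D t -> (0 <= g t)%E by move=> Dt; apply: le_trans (gR _ Dt); rewrite lee_fin.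
have ig : mu.-integrable D g.
  apply/integrableP; split => //.
  by under eq_integral => t /[!inE] Dt do rewrite gee0_abs ?g0 //.
have mR : measurable_fun D (EFin \o (Re \o P)) by exact/measurable_EFinP.
have mI : measurable_fun D (EFin \o (Im \o P)) by exact/measurable_EFinP.
split.
  have k := fun h => le_integrable measurable_unit_itv mR h ig.
  apply: k => t Dt.
  by rewrite (gee0_abs (g0 t Dt)); exact: gR.
have k := fun h => le_integrable measurable_unit_itv mI h ig.
apply: k => t Dt.
by rewrite (gee0_abs (g0 t Dt)); exact: gI.
Qed.

Lemma Rintegral_dom (f : R -> R) (g : R -> \bar R) (G : R) : measurable_fun D f -> measurable_fun D g ->
  (forall t, D t -> (`|f t|%:E <= g t)%E) -> (\int[mu]_(t in D) g t <= G%:E)%E ->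
  `|\int[mu]_(t in D) f t| <= G.
Proof.
move=> mf mg fg gG.
have g0 t : D t -> (0 <= g t)%E by move=> Dt; apply: le_trans (fg _ Dt); rewrite lee_fin.
have mf' : measurable_fun D (EFin \o f) by exact/measurable_EFinP.
have le : (\int[mu]_(t in D) `|(f t)%:E| <= G%:E)%E.
  apply: le_trans gG; apply: ge0_le_integral => //.
  by apply: measurableT_comp => //.
have fi : mu.-integrable D (EFin \o f).
  by apply/integrableP; split => //; apply: le_lt_trans le _; exact: ltry.
rewrite -lee_fin EFin_normr_Rintegral //.
by apply: le_trans le; exact: le_abse_integral.
Qed.

Lemma cintgD P Q : cintg P -> cintg Q -> cintg (fun t => P t + Q t).
Proof.
move=> [h1 h2] [h3 h4]; split.
  rewrite (_ : _ \o _ = (EFin \o (Re \o P)) \+ (EFin \o (Re \o Q)))%E; first exact: integrableD.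
  by apply/funext => t /=; rewrite raddfD EFinD.
rewrite (_ : _ \o _ = (EFin \o (Im \o P)) \+ (EFin \o (Im \o Q)))%E; first exact: integrableD.
by apply/funext => t /=; rewrite raddfD EFinD.
Qed.

Lemma cintD P Q : cintg P -> cintg Q -> cint (fun t => P t + Q t) = cint P + cint Q.
Proof.
move=> [h1 h2] [h3 h4]; rewrite /cint.
have -> : \int[mu]_(t in D) Re (P t + Q t) = \int[mu]_(t in D) (Re (P t) + Re (Q t)).
  by apply: eq_Rintegral => t _; rewrite raddfD.
have -> : \int[mu]_(t in D) Im (P t + Q t) = \int[mu]_(t in D) (Im (P t) + Im (Q t)).
  by apply: eq_Rintegral => t _; rewrite raddfD.
by rewrite !RintegralD.
Qed.

Lemma cintgZ c P : cintg P -> cintg (fun t => c * P t).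
Proof.
case: c => a b [h1 h2].
have iz (r : R) (f : R -> R) : mu.-integrable D (EFin \o f) -> mu.-integrable D (fun t => (r * f t)%:E).
  by move=> h; under eq_fun do rewrite EFinM; exact: integrableZl.
split.
  rewrite (_ : _ \o _ = (fun t => (a * Re (P t))%:E) \+ (fun t => (- b * Im (P t))%:E))%E.
    by apply: integrableD => //; apply: iz.
  by apply/funext => t /=; case: (P t) => [c d] /=; rewrite EFinD mulNr.
rewrite (_ : _ \o _ = (fun t => (a * Im (P t))%:E) \+ (fun t => (b * Re (P t))%:E))%E.
  by apply: integrableD => //; apply: iz.
by apply/funext => t /=; case: (P t) => [c d] /=; rewrite EFinD.
Qed.

Lemma cintZ c P : cintg P -> cint (fun t => c * P t) = c * cint P.
Proof.
case: c => a b [h1 h2]; rewrite /cint.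
have iz (r : R) (f : R -> R) : mu.-integrable D (EFin \o f) -> mu.-integrable D (EFin \o (fun t => r * f t)).
  by move=> h; rewrite (_ : _ \o _ = fun t => (r%:E * (f t)%:E)%E) //; exact: integrableZl.
have -> : \int[mu]_(t in D) Re ((a +i* b)%C * P t) = \int[mu]_(t in D) (a * Re (P t) + - b * Im (P t)).
  by apply: eq_Rintegral => t _; case: (P t) => [c d] /=; rewrite mulNr.
have -> : \int[mu]_(t in D) Im ((a +i* b)%C * P t) = \int[mu]_(t in D) (a * Im (P t) + b * Re (P t)).
  by apply: eq_Rintegral => t _; case: (P t) => [c d] /=.
rewrite !RintegralD //; [|exact: iz|exact: iz|exact: iz|exact: iz].
by rewrite !RintegralZl //= mulNr.
Qed.

Lemma cintg0 : cintg (fun=> 0).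
Proof. by split; exact: integrable0. Qed.

Lemma cint0 : cint (fun=> 0) = 0.
Proof. by rewrite /cint /= /Rintegral integral0. Qed.

Lemma cintg_sum n (F : nat -> R -> C) : (forall i, (i < n)%N -> cintg (F i)) ->
  cintg (fun t => \sum_(i < n) F i t) /\ cint (fun t => \sum_(i < n) F i t) = \sum_(i < n) cint (F i).
Proof.
elim: n => [|n ih] h.
  rewrite big_ord0 (_ : (fun t => _) = fun=> 0); first by split; [exact: cintg0|exact: cint0].
  by apply/funext => t; rewrite big_ord0.
have [i1 i2] := ih (fun i ni => h i (ltnW ni)).
rewrite (_ : (fun t => _) = fun t => \sum_(i < n) F i t + F n t); last first.
  by apply/funext => t; rewrite big_ord_recr.
by rewrite big_ord_recr /= cintD ?i2; [split => //; apply: cintgD|..]; try exact: h.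
Qed.

Lemma cint_ext P Q : (forall t, D t -> P t = Q t) -> cint P = cint Q.
Proof. by move=> e; rewrite /cint; congr (_ +i* _)%C; apply: eq_Rintegral => t /[!inE] Dt; rewrite e. Qed.

Lemma Re_cint_le P (g : R -> \bar R) (G : R) : cintg P -> measurable_fun D g ->
  (forall t, D t -> (0 <= g t)%E) ->
  (forall t, D t -> ((Re (P t))%:E <= g t)%E) -> (\int[mu]_(t in D) g t <= G%:E)%E ->
  Re (cint P) <= G.
Proof.
move=> [h1 h2] mg g0 Pg gG /=.
have ig : mu.-integrable D g.
  apply/integrableP; split => //.
  under eq_integral => t /[!inE] Dt do rewrite gee0_abs ?g0 //.
  exact: le_lt_trans gG (ltry _).
rewrite -lee_fin /Rintegral fineK; last exact: integrable_fin_num.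
by apply: le_trans gG; apply: le_integral => // t /[!inE] Dt; exact: Pg.
Qed.

(** Cauchy-Schwarz for |P|^2 <= p q. The hypothesis is this inequality polarized with a free
    constant, a form which still makes sense when [p] is infinite; integrating it and optimizing
    the constant afterwards gives the conclusion. *)
Lemma cint_CS P (p q : R -> \bar R) (a b : R) : cmeas P ->
  measurable_fun D p -> measurable_fun D q ->
  (forall t, D t -> (0 <= p t)%E) -> (forall t, D t -> (0 <= q t)%E) ->
  (forall t c, D t -> ((2 * Re (c * P t))%:E <= (nsq c)%:E * p t + q t)%E) ->
  (\int[mu]_(t in D) p t <= a%:E)%E -> (\int[mu]_(t in D) q t <= b%:E)%E ->
  cintg P /\ nsq (cint P) <= a * b.
Proof.
move=> mP mp mq p0 q0 hP pa qb.
have a0 : 0 <= a by rewrite -lee_fin; apply: le_trans pa; apply: integral_ge0.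
have b0 : 0 <= b by rewrite -lee_fin; apply: le_trans qb; apply: integral_ge0.
have mpq : measurable_fun D (fun t => p t + q t)%E by apply: emeasurable_funD.
have ipq (c : R) : 0 <= c -> (\int[mu]_(t in D) (c%:E * p t + q t) <= (c * a + b)%:E)%E.
  move=> c0; rewrite ge0_integralD //; first last.
  - exact: measurable_funeM.
  - by move=> t Dt; rewrite mule_ge0 ?p0.
  rewrite ge0_integralZl_EFin // EFinD EFinM; apply: leeD => //.
  by apply: lee_wpmul2l.
have iP : cintg P.
  apply: (cintg_dom mP mpq) => [t Dt|t Dt|].
  - have := hP t 1 Dt; have := hP t (-1) Dt.
    rewrite mulN1r mul1r nsqN nsq1 mul1e raddfN /= => h1 h2.
    have : ((2 * `|Re (P t)|)%:E <= p t + q t)%E.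
      by case: (ger0P (Re (P t))) => _ //; rewrite -mulrN in h1.
    apply: le_trans; rewrite lee_fin; have := normr_ge0 (Re (P t)); lra.
  - have := hP t 'i%C Dt; have := hP t (- 'i%C) Dt.
    rewrite nsqN (_ : nsq 'i%C = 1) ?mul1e; last by rewrite /nsq /= expr0n expr1n add0r.
    have -> : Re (- 'i%C * P t) = Im (P t) by case: (P t) => [x y] /=; ring.
    have -> : Re ('i%C * P t) = - Im (P t) by case: (P t) => [x y] /=; ring.
    move=> h1 h2.
    have : ((2 * `|Im (P t)|)%:E <= p t + q t)%E.
      by case: (ger0P (Im (P t))) => _ //; rewrite -mulrN in h2.
    apply: le_trans; rewrite lee_fin; have := normr_ge0 (Im (P t)); lra.
  - have := ipq 1 ler01; under eq_integral do rewrite mul1e.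
    by move=> /le_lt_trans; apply; exact: ltry.
split => //.
have key (c : C) : 2 * Re (c * cint P) <= nsq c * a + b.
  have -> : 2 * Re (c * cint P) = Re (cint (fun t => (2%:C%C * c) * P t)).
    by rewrite cintZ // -mulrA ReM_real.
  apply: (@Re_cint_le _ (fun t => (nsq c)%:E * p t + q t)%E).
  - exact: cintgZ.
  - by apply: emeasurable_funD => //; exact: measurable_funeM.
  - by move=> t Dt; rewrite adde_ge0 ?q0 // mule_ge0 ?p0 // lee_fin nsq_ge0.
  - by move=> t Dt; rewrite -mulrA ReM_real; exact: hP.
  - by apply: ipq; exact: nsq_ge0.
set J := cint P in key *.
have keyr (s : R) : 2 * s * nsq J <= s ^+ 2 * nsq J * a + b.
  have := key (s%:C%C * J^*).
  by rewrite -mulrA ReM_real nsqM nsq_real nsq_conj [J^* * J]mulrC nsq_mul_conj mulrA.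
have J0 := nsq_ge0 J.
have [a00|an0] := eqVneq a 0.
  rewrite a00 mul0r.
  have [//|Jp] := lerP (nsq J) 0.
  have := keyr ((b + 1) / nsq J); rewrite a00 mulr0 add0r.
  by rewrite -mulrA divfK ?gt_eqF //; lra.
have ap : 0 < a by rewrite lt_neqAle eq_sym an0.
have := keyr (a^-1).
rewrite expr2 -!mulrA [nsq J * a]mulrC (mulrA a^-1 a) mulVf // mul1r => h.
have : a^-1 * nsq J <= b by lra.
by rewrite mulrC ler_pdivrMr // mulrC.
Qed.

End CircleIntegrals.

(** * Orthogonality of the powers of z *)

Section CircleOrthogonality.
Variable R : realType.
Local Notation C := R[i].
Local Notation mu := (@lebesgue_measure R).
Local Notation D := (@unit_itv R).

Lemma circ_exp (t : R) n : circ t ^+ n = (cos (2 * pi * n%:R * t) +i* sin (2 * pi * n%:R * t))%C.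
Proof.
elim: n => [|n ih]; first by rewrite expr0 mulr0 mul0r cos0 sin0.
rewrite exprS ih /circ.
have -> : 2 * pi * n.+1%:R * t = 2 * pi * t + 2 * pi * n%:R * t by rewrite -natr1; ring.
by rewrite cosD sinD; congr (_ +i* _)%C; rewrite addrC.
Qed.

Lemma sin2pin n : sin (2 * pi * n%:R : R) = 0.
Proof.
have -> : 2 * pi * n%:R = 0 + (pi *+ 2) *+ n :> R by rewrite add0r -[RHS]mulr_natr -[pi *+ 2]mulr_natl.
by rewrite (periodicn (@sinD2pi R)) sin0.
Qed.

Lemma cos2pin n : cos (2 * pi * n%:R : R) = 1.
Proof.
have -> : 2 * pi * n%:R = 0 + (pi *+ 2) *+ n :> R by rewrite add0r -[RHS]mulr_natr -[pi *+ 2]mulr_natl.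
by rewrite (periodicn (@cosD2pi R)) cos0.
Qed.

Lemma FTC_unit (F f : R -> R) : (forall t : R, is_derive t (1 : R) F (f t)) -> continuous f ->
  \int[mu]_(t in D) f t = F 1 - F 0.
Proof.
move=> dF cf.
have cF : continuous F.
  by move=> t; apply: differentiable_continuous; apply/derivable1_diffP; have [] := dF t.
rewrite /Rintegral /unit_itv (@continuous_FTC2 R f F 0 1) //.
- by apply: continuous_subspaceT.
- split.
  + by move=> t _; have [] := dF t.
  + by apply: cvg_at_right_filter; exact: cF.
  + by apply: cvg_at_left_filter; exact: cF.
- by move=> t _; rewrite derive1E; have [_ ->] := dF t.
Qed.

Lemma is_derive_linear (a t : R) : is_derive t (1 : R) (fun t : R => a * t) a.
Proof. by apply: is_derive_eq; rewrite /GRing.scale /= mulr1. Qed.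

Lemma int_cos (a : R) : a != 0 -> \int[mu]_(t in D) cos (a * t) = a^-1 * sin a.
Proof.
move=> a0.
have dF (t : R) : is_derive t (1 : R) (fun t => a^-1 * sin (a * t)) (cos (a * t)).
  have h := is_derive_linear a t.
  have h2 := is_derive1_comp (is_derive_sin (a * t)) h.
  by apply: is_derive_eq; rewrite /GRing.scale /= mulrCA mulVf // mulr1.
rewrite (FTC_unit dF); first by rewrite mulr1 mulr0 sin0 mulr0 subr0.
move=> t; apply: (@continuous_comp _ _ _ (fun t : R => a * t) cos); last exact: continuous_cos.
by apply: cvgMr; exact: cvg_id.
Qed.

Lemma int_sin (a : R) : a != 0 -> \int[mu]_(t in D) sin (a * t) = a^-1 * (1 - cos a).
Proof.
move=> a0.
have dF (t : R) : is_derive t (1 : R) (fun t => (- a^-1) * cos (a * t)) (sin (a * t)).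
  have h := is_derive_linear a t.
  have h2 := is_derive1_comp (is_derive_cos (a * t)) h.
  by apply: is_derive_eq; rewrite /GRing.scale /=; field.
rewrite (FTC_unit dF); first by rewrite mulr1 mulr0 cos0 mulr1 mulNr mulrBr mulr1 opprK addrC.
move=> t; apply: (@continuous_comp _ _ _ (fun t : R => a * t) sin); last exact: continuous_sin.
by apply: cvgMr; exact: cvg_id.
Qed.

Lemma cint_circX n : (0 < n)%N -> cint (fun t : R => circ t ^+ n) = 0.
Proof.
move=> n0; have a0 : 2 * pi * n%:R != 0 :> R by rewrite !mulf_neq0 // ?pnatr_eq0 -?lt0n // gt_eqF // pi_gt0.
rewrite /cint; apply/eqP; rewrite eq_complex; apply/andP; split; apply/eqP => /=.
  under eq_Rintegral do rewrite circ_exp /=.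
  by rewrite int_cos // sin2pin mulr0.
under eq_Rintegral do rewrite circ_exp /=.
by rewrite int_sin // cos2pin subrr mulr0.
Qed.

Lemma int_unit_cst (c : R) : (\int[mu]_(t in D) (cst c%:E) t = c%:E)%E.
Proof. by rewrite (integral_cst mu (@measurable_unit_itv R)) -[RHS]mule1 -mu_unit_itv. Qed.

Lemma cint_cst (c : C) : cint (fun=> c) = c.
Proof.
rewrite /cint /Rintegral; have e (r : R) := int_unit_cst r.
by rewrite !e; case: c.
Qed.

Lemma cintg_bounded (P : R -> C) (M : R) : cmeas P -> (forall t, D t -> nsq (P t) <= M) -> cintg P.
Proof.
move=> mP PM.
have sqb (x y : R) : x ^+ 2 <= y -> `|x| <= 1 + y.
  move=> h; have := sqr_ge0 (x - 1); have := sqr_ge0 (x + 1).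
  by rewrite sqrrB1 sqrrD1 => h1 h2; rewrite ler_norml; apply/andP; split; lra.
have mg := @measurable_cst _ _ (measurableTypeR R) _ D (1 + M)%:E.
apply: (cintg_dom mP mg).
- move=> t Dt; rewrite lee_fin; apply: sqb; apply: (le_trans _ (PM t Dt)).
  by rewrite /nsq lerDl sqr_ge0.
- move=> t Dt; rewrite lee_fin; apply: sqb; apply: (le_trans _ (PM t Dt)).
  by rewrite /nsq lerDr sqr_ge0.
- by rewrite int_unit_cst ltry.
Qed.

Lemma cint_conj (P : R -> C) : cintg P -> cint (fun t => (P t)^*) = (cint P)^*.
Proof.
move=> [h1 h2]; apply/eqP; rewrite eq_complex; apply/andP; split; apply/eqP => /=.
  by apply: eq_Rintegral => t _; case: (P t).
rewrite -mulN1r -RintegralZl //; last exact: measurable_unit_itv.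
by apply: eq_Rintegral => t _; rewrite mulN1r; case: (P t).
Qed.

Lemma cintg_circX n : cintg (fun t : R => circ t ^+ n).
Proof. by apply: (@cintg_bounded _ 1) => [|t _]; [exact: cmeas_circX|rewrite circX_nsq]. Qed.

Lemma cint_circ_orth m n : cint (fun t : R => (circ t)^* ^+ n * circ t ^+ m) = (m == n)%:R.
Proof.
case: (ltngtP m n) => [mn|nm|->].
- have -> : cint (fun t : R => (circ t)^* ^+ n * circ t ^+ m) = (cint (fun t => circ t ^+ (n - m)))^*.
    rewrite -cint_conj; last exact: cintg_circX.
    apply: cint_ext => t _; rewrite -{1}(subnK (ltnW mn)) exprD -mulrA.
    by rewrite [_ * circ t ^+ m]mulrC circ_conj mulr1 rmorphXn.
  by rewrite cint_circX ?subn_gt0 // conjC0.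
- transitivity (cint (fun t : R => circ t ^+ (m - n))); last by rewrite cint_circX ?subn_gt0.
  apply: cint_ext => t _.
  by rewrite -{1}(subnK (ltnW nm)) exprD mulrCA [(circ t)^* ^+ n * _]mulrC circ_conj mulr1.
- rewrite -[RHS](cint_cst 1); apply: cint_ext => t _.
  by rewrite mulrC circ_conj.
Qed.

End CircleOrthogonality.

(** * Fourier coefficients of square-integrable functions *)

Section ScalarFourier.
Variable R : realType.
Local Notation C := R[i].
Local Notation Re := (@complex.Re R).
Local Notation mu := (@lebesgue_measure R).
Local Notation D := (@unit_itv R).
Implicit Types (f g : R -> C) (c : nat -> C).

Definition L2sq f : \bar R := (\int[mu]_(t in D) (nsq (f t))%:E)%E.
Definition fourier_coef f (p : nat) : C := cint (fun t => (circ t)^* ^+ p * f t).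
Definition trig_poly d c (t : R) : C := \sum_(p < d) c p * circ t ^+ p.

Lemma L2sq_ge0 f : (0 <= L2sq f)%E.
Proof. by apply: integral_ge0 => t _; rewrite lee_fin nsq_ge0. Qed.

Lemma measurable_nsqE f : cmeas f -> measurable_fun D (fun t => (nsq (f t))%:E).
Proof. by move=> mf; apply/measurable_EFinP; exact: cmeas_nsq. Qed.

Lemma cintg_L2 f : cmeas f -> (L2sq f < +oo)%E -> cintg f.
Proof.
move=> mf ff.
have sqb (x y : R) : x ^+ 2 <= y -> `|x| <= 1 + y.
  move=> h; have := sqr_ge0 (x - 1); have := sqr_ge0 (x + 1).
  by rewrite sqrrB1 sqrrD1 => h1 h2; rewrite ler_norml; apply/andP; split; lra.
have mg := @measurable_cst _ _ (measurableTypeR R) _ D (1%:E : \bar R).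
have mn := measurable_nsqE mf.
apply: (cintg_dom mf (emeasurable_funD mg mn)).
- by move=> t _; rewrite lee_fin; apply: sqb; rewrite /nsq lerDl sqr_ge0.
- by move=> t _; rewrite lee_fin; apply: sqb; rewrite /nsq lerDr sqr_ge0.
- rewrite (ge0_integralD mu (@measurable_unit_itv R)) //; last by move=> t _; rewrite lee_fin nsq_ge0.
  by apply: lte_add_pinfty => //; rewrite int_unit_cst ltry.
Qed.

Lemma L2sq_unimod f (w : R -> C) : (forall t, nsq (w t) = 1) -> L2sq (fun t => w t * f t) = L2sq f.
Proof. by move=> w1; apply: eq_integral => t _; rewrite nsqM w1 mul1r. Qed.

Lemma cmeas_trig_poly d c : cmeas (trig_poly d c).
Proof.
apply: (@cmeas_sum R d (fun p t => c p * circ t ^+ p)) => p.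
by apply: cmeasZ; exact: cmeas_circX.
Qed.

Lemma cmeasB f g : cmeas f -> cmeas g -> cmeas (fun t => f t - g t).
Proof.
move=> mf mg; apply: (cmeas_ext (P := fun t => f t + (-1) * g t)) => [t _|].
  by rewrite mulN1r.
by apply: cmeasD => //; exact: cmeasZ.
Qed.

Lemma fourier_coef_cintg f p : cmeas f -> (L2sq f < +oo)%E -> cintg (fun t => (circ t)^* ^+ p * f t).
Proof.
move=> mf ff; apply: cintg_L2; first by apply: cmeasM => //; exact: cmeas_cconjX.
by rewrite L2sq_unimod // => t; rewrite -rmorphXn /= nsq_conj circX_nsq.
Qed.

Lemma nsqB_expand (z w : C) : nsq (z - w) = nsq z - 2 * Re (w^* * z) + nsq w.
Proof. by case: z w => [a b] [p q]; rewrite /nsq /=; ring. Qed.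

(** Completing the square: [circ t ^+ p] has modulus 1. *)
Lemma L2sq_step f (I : R) (c : C) p : cmeas f -> L2sq f = I%:E ->
  L2sq (fun t => f t - c * circ t ^+ p) = (I + (nsq (fourier_coef f p - c) - nsq (fourier_coef f p)))%:E.
Proof.
move=> mf fI.
have ff : (L2sq f < +oo)%E by rewrite fI ltry.
have h := fourier_coef_cintg p mf ff.
have Re2 (x y : C) : Re (- 2%:C%C * x * y) = - (2 * Re (x * y)).
  by rewrite -mulrA; case: (x * y) => a b /=; ring.
have conjM t : (c * circ t ^+ p)^* * f t = c^* * ((circ t)^* ^+ p * f t).
  by rewrite rmorphM rmorphXn mulrA.
have e t : (nsq (f t - c * circ t ^+ p))%:E = ((nsq (f t))%:E + ((nsq c)%:E + (Re ((- 2%:C%C * c^*) * ((circ t)^* ^+ p * f t)))%:E))%E.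
  rewrite nsqB_expand nsqM circX_nsq mulr1 -!EFinD; congr EFin.
  by rewrite Re2 conjM; ring.
rewrite /L2sq; under eq_integral do rewrite e.
have [iR _] := cintgZ (- 2%:C%C * c^*) h.
have i1 : mu.-integrable D (fun t => (nsq (f t))%:E).
  apply/integrableP; split; first exact: measurable_nsqE.
  by under eq_integral do rewrite gee0_abs ?lee_fin ?nsq_ge0 //.
have i2 : mu.-integrable D (cst (nsq c)%:E).
  apply/integrableP; split; first exact: measurable_cst.
  by under eq_integral do rewrite gee0_abs ?lee_fin ?nsq_ge0 //; rewrite int_unit_cst ltry.
rewrite (integralD (@measurable_unit_itv R) i1 (integrableD (@measurable_unit_itv R) i2 iR)).
rewrite (integralD (@measurable_unit_itv R) i2 iR) int_unit_cst -/(L2sq f) fI.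
have -> : (\int[mu]_(t in D) (EFin \o (Re \o (fun t => (- 2%:C%C * c^* * ((circ t)^* ^+ p * f t))%R))) t = (Re (- 2%:C%C * c^* * fourier_coef f p)%R)%:E)%E.
  by rewrite /fourier_coef -cintZ //= /Rintegral fineK //; apply: integrable_fin_num => //; exact: measurable_unit_itv.
rewrite -!EFinD nsqB_expand; congr EFin; congr (_ + _).
by rewrite Re2; ring.
Qed.

(** The monomials are subtracted one at a time; by orthogonality this does not alter the later
    Fourier coefficients. *)
Lemma L2sq_trig_poly f (I : R) c d : cmeas f -> L2sq f = I%:E ->
  L2sq (fun t => f t - trig_poly d c t) =
  (I + \sum_(p < d) (nsq (fourier_coef f p - c p) - nsq (fourier_coef f p)))%:E.
Proof.
move=> mf fI; elim: d => [|d ih].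
  rewrite big_ord0 addr0 -fI; apply: eq_integral => t _.
  by rewrite /trig_poly big_ord0 subr0.
have mg : cmeas (fun t => f t - trig_poly d c t) by apply: cmeasB => //; exact: cmeas_trig_poly.
have gc : fourier_coef (fun t => f t - trig_poly d c t) d = fourier_coef f d.
  rewrite /fourier_coef.
  have ff : (L2sq f < +oo)%E by rewrite fI ltry.
  have ip p : cintg (fun t => c p * ((circ t)^* ^+ d * circ t ^+ p)).
    apply: cintgZ; apply: (@cintg_bounded _ _ 1) => [|t _].
      by apply: cmeasM; [exact: cmeas_cconjX|exact: cmeas_circX].
    by rewrite nsqM circX_nsq -rmorphXn /= nsq_conj circX_nsq mulr1.
  have [s1 s2] := cintg_sum (n := d) (F := fun p t => c p * ((circ t)^* ^+ d * circ t ^+ p)) (fun i _ => ip i).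
  transitivity (cint (fun t => (circ t)^* ^+ d * f t + (-1) * \sum_(p < d) c p * ((circ t)^* ^+ d * circ t ^+ p))).
    apply: cint_ext => t _; rewrite mulrBr mulN1r /trig_poly mulr_sumr; congr (_ - _).
    by apply: eq_bigr => p _; rewrite mulrCA.
  rewrite cintD; [|exact: fourier_coef_cintg|exact: cintgZ].
  rewrite cintZ // s2 big1 ?mulr0 ?addr0 // => p _.
  rewrite cintZ; last first.
    apply: (@cintg_bounded _ _ 1) => [|t _].
      by apply: cmeasM; [exact: cmeas_cconjX|exact: cmeas_circX].
    by rewrite nsqM circX_nsq -rmorphXn /= nsq_conj circX_nsq mulr1.
  by rewrite cint_circ_orth ltn_eqF ?mulr0 // ltn_ord.
have h := L2sq_step (c d) d mg ih; rewrite gc in h.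
rewrite big_ord_recr /= addrA -h.
by apply: eq_integral => t _; rewrite /trig_poly big_ord_recr /= opprD addrA.
Qed.

Lemma bessel_circle f (I : R) d : cmeas f -> L2sq f = I%:E -> \sum_(p < d) nsq (fourier_coef f p) <= I.
Proof.
move=> mf fI; have := L2sq_ge0 (fun t => f t - trig_poly d (fourier_coef f) t).
rewrite (L2sq_trig_poly (fourier_coef f) d mf fI) lee_fin.
under eq_bigr do rewrite subrr nsq0 sub0r.
by rewrite sumrN subr_ge0.
Qed.

(** By [L2sq_trig_poly] each coefficient contributes separately, and none contributes less than the
    Fourier coefficient. *)
Lemma best_approx f (I : R) c d n : cmeas f -> L2sq f = I%:E -> (d <= n)%N ->
  (L2sq (fun t => f t - trig_poly n (fourier_coef f) t)%R <= L2sq (fun t => f t - trig_poly d c t)%R)%E.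
Proof.
move=> mf fI dn; rewrite !(L2sq_trig_poly _ _ mf fI) lee_fin lerD2l.
under eq_bigr do rewrite subrr nsq0 sub0r.
apply: (@le_trans _ _ (\sum_(p < d) (- nsq (fourier_coef f p)))).
  rewrite [leRHS](big_ord_widen n (fun p => - nsq (fourier_coef f p)) dn) [leRHS]big_mkcond /=.
  by apply: ler_sum => p _; case: ifP => // _; rewrite oppr_le0 nsq_ge0.
by apply: ler_sum => p _; rewrite lerDr nsq_ge0.
Qed.

Lemma L2sq_trig_poly0 c d : L2sq (trig_poly d c) = (\sum_(p < d) nsq (c p))%:E.
Proof.
have m0 : cmeas (fun=> 0 : C) by exact: cmeas_cst.
have i0 : L2sq (fun=> 0) = (0 : R)%:E.
  by rewrite /L2sq; under eq_integral do rewrite nsq0; rewrite integral0.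
have := L2sq_trig_poly c d m0 i0; rewrite add0r.
have -> : L2sq (fun t => 0 - trig_poly d c t) = L2sq (trig_poly d c).
  by apply: eq_integral => t _; rewrite sub0r nsqN.
move=> ->; congr EFin; apply: eq_bigr => p _.
have -> : fourier_coef (fun=> 0) p = 0.
  by rewrite /fourier_coef -[RHS](@cint0 R); apply: cint_ext => t _; rewrite mulr0.
by rewrite sub0r nsqN nsq0 subr0.
Qed.

End ScalarFourier.

(** * The Riesz-Fischer theorem *)

Section RieszFischer.
Variable R : realType.
Local Notation C := R[i].
Local Notation Re := (@complex.Re R).
Local Notation Im := (@complex.Im R).
Local Notation mu := (@lebesgue_measure R).
Local Notation D := (@unit_itv R).
Variable c : nat -> C.
Hypothesis c_fin : (\sum_(0 <= p <oo) (nsq (c p))%:E < +oo)%E.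

Let tl d : \bar R := (\sum_(d <= p <oo) (nsq (c p))%:E)%E.

Let tl_cvg : tl @ \oo --> 0%E.
Proof. by apply: (nneseries_tail_cvg c_fin) => p _; rewrite lee_fin nsq_ge0. Qed.

Let tl_small (e : R) : 0 < e -> exists d, (tl d <= e%:E)%E.
Proof.
move=> e0; have /fine_cvgP [h1 h2] := tl_cvg.
move/cvgrPdist_lt : h2 => /(_ e e0) h2.
have [d [h3 h4]] : exists d, tl d \is a fin_num /\ `|0 - fine (tl d)| < e.
  have [n1 _ g1] := h1; have [n2 _ g2] := h2.
  by exists (maxn n1 n2); split; [apply: g1|apply: g2]; rewrite /= ?leq_maxl ?leq_maxr.
exists d; rewrite -(fineK h3) lee_fin; apply: ltW; apply: le_lt_trans h4.
by rewrite sub0r normrN ler_norm.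
Qed.

Let diff_le d e : (d <= e)%N -> (L2sq (fun t => trig_poly e c t - trig_poly d c t)%R <= tl d)%E.
Proof.
move=> de; pose c' p := if (d <= p)%N then c p else 0.
have -> : L2sq (fun t => trig_poly e c t - trig_poly d c t) = L2sq (trig_poly e c').
  apply: eq_integral => t _; congr (nsq _)%:E; rewrite /trig_poly.
  rewrite (big_ord_widen e (fun p => c p * circ t ^+ p) de) [X in _ - X]big_mkcond /= -sumrB.
  apply: eq_bigr => p _; rewrite /c'; case: ltnP => pd; first by rewrite subrr mul0r.
  by rewrite subr0.
rewrite L2sq_trig_poly0 -sumEFin.
have -> : (\sum_(p < e) (nsq (c' p))%:E = \sum_(d <= p < e) (nsq (c p))%:E)%E.
  rewrite -(big_mkord xpredT (fun p => (nsq (c' p))%:E)) (big_cat_nat (leq0n d) de) /=.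
  rewrite big_nat big1 ?add0e => [|p /andP[_ pd]]; last by rewrite /c' leqNgt pd /= nsq0.
  by rewrite !big_nat; apply: eq_bigr => p /andP[dp _]; rewrite /c' dp.
by apply: nneseries_lim_ge => p _ _; rewrite lee_fin nsq_ge0.
Qed.

Let tl_ge0 d : (0 <= tl d)%E.
Proof. by apply: nneseries_ge0 => p _ _; rewrite lee_fin nsq_ge0. Qed.

Let diff2_le d e : (L2sq (fun t => trig_poly e c t - trig_poly d c t)%R <= tl d + tl e)%E.
Proof.
have [de|/ltnW ed] := leqP d e.
  by apply: le_trans (diff_le de) _; rewrite leeDl.
apply: (@le_trans _ _ (tl e)); last by rewrite leeDr.
apply: le_trans (diff_le ed).
by rewrite /L2sq; under eq_integral do rewrite -nsqN opprB.
Qed.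

Let q (j : nat) : R := (2^-1) ^+ j.
Let q0 j : 0 < q j. Proof. by rewrite exprn_gt0. Qed.

Let dex j : exists d, (tl d <= (q j ^+ 2)%:E)%E.
Proof. by apply: tl_small; rewrite exprn_gt0. Qed.

Let d_ j := sval (cid (dex j)).
Let d_P j : (tl (d_ j) <= (q j ^+ 2)%:E)%E := svalP (cid (dex j)).

Let pz d (z : C) : C := \sum_(p < d) c p * z ^+ p.
Let De j (z : C) : C := pz (d_ j.+1) z - pz (d_ j) z.
Let Hz (z : C) : \bar R := (\sum_(0 <= j <oo) ((q j)^-1 * nsq (De j z))%:E)%E.
Let term0 j z : (0 <= ((q j)^-1 * nsq (De j z))%:E)%E.
Proof. by rewrite lee_fin mulr_ge0 ?nsq_ge0 // invr_ge0 ltW. Qed.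

Let mDe j : cmeas (fun t => De j (circ t)).
Proof. by apply: cmeasB; exact: cmeas_trig_poly. Qed.

Let mterm j : measurable_fun D (fun t => ((q j)^-1 * nsq (De j (circ t)))%:E).
Proof.
apply/measurable_EFinP; apply: measurable_funM; first exact: measurable_cst.
exact: cmeas_nsq.
Qed.

Let mH : measurable_fun D (fun t => Hz (circ t)).
Proof.
by apply: (ge0_emeasurable_sum (h := fun j t => ((q j)^-1 * nsq (De j (circ t)))%:E)).
Qed.

Let qS j : q j.+1 = q j / 2.
Proof. by rewrite /q exprSr. Qed.

Let intH : (\int[mu]_(t in D) Hz (circ t) < +oo)%E.
Proof.
rewrite (integral_nneseries mu (@measurable_unit_itv R) mterm) //.
apply: (@le_lt_trans _ _ 4%:E); last exact: ltry.
apply: nneseries_le => [j|N]; first exact: integral_ge0.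
apply: (@le_trans _ _ (\sum_(j < N) (2 * q j)%:E)%E); last first.
  rewrite sumEFin lee_fin.
  suff : \sum_(j < N) 2 * q j <= 4 - 4 * q N by have := q0 N; lra.
  elim: N => [|N ih]; first by rewrite big_ord0 /q expr0 mulr1 subrr.
  by rewrite big_ord_recr /= qS; lra.
apply: lee_sum => j _; under eq_integral do rewrite EFinM.
have qi : 0 <= (q j)^-1 by rewrite invr_ge0 ltW.
rewrite (ge0_integralZl_EFin mu (@measurable_unit_itv R)) //; last first.
- exact: measurable_nsqE.
- by move=> t _; rewrite lee_fin nsq_ge0.
apply: (@le_trans _ _ ((q j)^-1%:E * (2 * q j ^+ 2)%:E)%E).
  apply: lee_wpmul2l; first by rewrite lee_fin.
  apply: le_trans (diff2_le _ _) _.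
  apply: le_trans (leeD (d_P j) (d_P j.+1)) _.
  rewrite -EFinD lee_fin qS; have := sqr_ge0 (q j).
  have -> : (q j / 2) ^+ 2 = q j ^+ 2 / 4 by field.
  by move=> ?; lra.
rewrite -EFinM lee_fin; have qn : q j != 0 by rewrite gt_eqF.
by have -> : (q j)^-1 * (2 * q j ^+ 2) = 2 * q j by field.
Qed.

Let real_cvg (u : nat -> R) (H : R) :
  (forall N, \sum_(j < N) (q j)^-1 * (u j.+1 - u j) ^+ 2 <= H) -> cvgn u.
Proof.
move=> h.
pose v j := (q j)^-1 * (u j.+1 - u j) ^+ 2.
have v0 j : 0 <= v j by rewrite mulr_ge0 ?sqr_ge0 // invr_ge0 ltW.
have cv : cvgn (series v).
  apply: nondecreasing_is_cvgn; first by apply: nondecreasing_series.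
  by exists H => _ [N _ <-]; rewrite /series /= big_mkord.
have cq : cvgn (series q).
  have := @is_cvg_geometric_series R 1 (2^-1).
  rewrite (_ : geometric 1 2^-1 = q); last by apply/funext => j /=; rewrite mul1r.
  by apply; rewrite ger0_norm // invf_lt1 // ltr1n.
have cqv : cvgn (series (q + v)) by rewrite seriesD; apply: is_cvgD.
have ca : cvgn (series (fun j => u j.+1 - u j)).
  apply: normed_cvg; apply: (series_le_cvg _ _ _ cqv) => j //=.
    by rewrite addr_ge0 ?v0 ?(ltW (q0 j)).
  rewrite fctE /v; have [le|/ltW gt] := lerP `|u j.+1 - u j| (q j).
    by apply: le_trans le _; rewrite lerDl; exact: v0.
  apply: (@le_trans _ _ ((q j)^-1 * (u j.+1 - u j) ^+ 2)); last by rewrite lerDr (ltW (q0 j)).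
  rewrite mulrC ler_pdivlMr // -[leRHS]real_normK ?num_real // expr2.
  by rewrite ler_wpM2l.
have -> : u = (fun n => u 0%N + series (fun j => u j.+1 - u j) n).
  apply/funext => n; rewrite /series /= telescope_sumr // addrC subrK //.
by apply: is_cvgD => //; exact: is_cvg_cst.
Qed.

Let F (z : C) : C := if Hz z \is a fin_num then
  (limn (fun j => Re (pz (d_ j) z)) +i* limn (fun j => Im (pz (d_ j) z)))%C else 0.

Let F_cvg z : Hz z \is a fin_num -> ccvg (fun j => pz (d_ j) z) (F z).
Proof.
move=> hz.
have b N : \sum_(j < N) (q j)^-1 * nsq (De j z) <= fine (Hz z).
  by rewrite -lee_fin fineK // -sumEFin; apply: nneseries_partial.
rewrite /F hz; split => /=.
  apply: (@real_cvg _ (fine (Hz z))) => N; apply: le_trans (b N).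
  apply: ler_sum => j _; rewrite ler_wpM2l ?invr_ge0 ?(ltW (q0 _)) //.
  by rewrite /De /nsq raddfB /= lerDl sqr_ge0.
apply: (@real_cvg _ (fine (Hz z))) => N; apply: le_trans (b N).
apply: ler_sum => j _; rewrite ler_wpM2l ?invr_ge0 ?(ltW (q0 _)) //.
by rewrite /De /nsq !raddfB /= lerDr sqr_ge0.
Qed.

Let F_meas : cmeas (fun t => F (circ t)).
Proof.
pose A := D `&` [set t | Hz (circ t) \is a fin_num].
have mA : measurable (A : set (measurableTypeR R)).
  by apply: emeasurable_fin_num => //; exact: measurable_unit_itv.
have mI : cmeas (fun t : R => (\1_A t)%:C%C : C).
  by split; [exact: measurable_indic|exact: measurable_cst].
apply: (@cmeas_cvg _ (fun j t => (\1_A t)%:C%C * pz (d_ j) (circ t))) => [j|t Dt].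
  by apply: cmeasM => //; exact: cmeas_trig_poly.
have [hz|nz] := boolP (Hz (circ t) \is a fin_num).
  rewrite indicE mem_set //.
  have -> : (fun n => (1%:R)%:C%C * pz (d_ n) (circ t)) = (fun n => pz (d_ n) (circ t)).
    by apply/funext => n; rewrite mul1r.
  exact: F_cvg.
rewrite indicE memNset; last by move=> [_ /=]; exact/negP.
rewrite /F (negbTE nz).
by split; apply: cvg_near_cst; apply: nearW => n /=; rewrite mul0r.
Qed.

(** Partial sums along indices [d_ j] with tails at most 4^-j converge almost everywhere, because
    the sum [Hz] of the weighted squared differences is integrable; [F] is their limit, and
    Fatou's lemma gives the estimate. [F] is a function of [z] and not of [t], as required of the
    functions on the circle. *)
Lemma riesz_fischer : exists F : C -> C, cmeas (fun t => F (circ t)) /\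
  forall d, (L2sq (fun t => F (circ t) - trig_poly d c t)%R <= \sum_(d <= p <oo) (nsq (c p))%:E)%E.
Proof.
exists F; split=> [|d]; first exact: F_meas.
pose G j t := (nsq (trig_poly (d_ j) c t - trig_poly d c t))%:E.
have mG j : measurable_fun D (G j).
  by apply: measurable_nsqE; apply: cmeasB; exact: cmeas_trig_poly.
have G0 j t : D t -> (0 <= G j t)%E by rewrite lee_fin nsq_ge0.
have iH : mu.-integrable D (fun t => Hz (circ t)).
  apply/integrableP; split; first exact: mH.
  by under eq_integral do rewrite gee0_abs ?nneseries_ge0 //; exact: intH.
have ae := integrable_ae (@measurable_unit_itv R) iH.
have mE : measurable_fun D (fun t => limn_einf (G ^~ t)).
  have -> : (fun t => limn_einf (G ^~ t)) = (fun t => - limn_esup (fun j => - G j t))%E.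
    apply/funext => t; rewrite -limn_einfN; congr limn_einf.
    by apply/funext => j; rewrite /comp oppeK.
  apply: measurableT_comp => //; apply: measurable_fun_limn_esup => j.
  by apply: measurableT_comp.
have E0 t : D t -> (0 <= limn_einf (G ^~ t))%E.
  move=> Dt; rewrite limn_einf_lim; apply: lime_ge; first exact: is_cvg_einfs.
  by apply: nearW => n; apply: le_ereal_inf_tmp => _ [j _ <-]; exact: G0.
have mF : measurable_fun D (fun t => (nsq (F (circ t) - trig_poly d c t))%:E).
  by apply: measurable_nsqE; apply: cmeasB => //; exact: cmeas_trig_poly.
apply: (@le_trans _ _ (\int[mu]_(t in D) limn_einf (G ^~ t))%E).
  apply: (ae_ge0_le_integral (mu := mu) (@measurable_unit_itv R)) => //.
    by move=> t _; rewrite lee_fin nsq_ge0.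
  apply: filterS ae => t hz Dt.
  have cc : ccvg (fun j => trig_poly (d_ j) c t - trig_poly d c t) (F (circ t) - trig_poly d c t).
    have [c1 c2] := F_cvg (hz Dt); split; rewrite raddfB /=.
      rewrite (_ : _ \o _ = fun n => Re (pz (d_ n) (circ t)) - Re (trig_poly d c t)).
        by apply: cvgB; [exact: c1|exact: cvg_cst].
      by apply/funext => n /=; rewrite raddfB.
    rewrite (_ : _ \o _ = fun n => Im (pz (d_ n) (circ t)) - Im (trig_poly d c t)).
      by apply: cvgB; [exact: c2|exact: cvg_cst].
    by apply/funext => n /=; rewrite raddfB.
  have ce : (G ^~ t) @ \oo --> (nsq (F (circ t) - trig_poly d c t))%:E.
    by apply: cvg_EFin; [exact: nearW|exact: ccvg_nsq].
  by rewrite is_cvg_limn_einfE; [rewrite (cvg_lim _ ce)|apply/cvg_ex; eexists; exact: ce].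
apply: le_trans (fatou mu (@measurable_unit_itv R) mG G0) _.
rewrite limn_einf_lim.
have ct : (fun j => tl d + (q j ^+ 2)%:E)%E @ \oo --> (tl d + 0)%E.
  apply: cvgeD; [by rewrite fin_num_adde_defl|exact: cvg_cst|].
  have : (fun j => q j * q j) @ \oo --> (0 * 0 : R).
    have h : q @ \oo --> (0 : R) by apply: cvg_expr; rewrite ger0_norm // invf_lt1 // ltr1n.
    exact: (cvgM h h).
  rewrite mulr0 => h; apply: cvg_EFin; first exact: nearW.
  by rewrite (_ : _ \o _ = (fun j => q j * q j)).
rewrite -[leRHS]adde0 -(cvg_lim _ ct) //.
apply: lee_lim; [exact: is_cvg_einfs|by apply/cvg_ex; eexists; exact: ct|].
apply: nearW => j; apply: (@le_trans _ _ (L2sq (fun t => trig_poly (d_ j) c t - trig_poly d c t)%R)).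
  by apply: ereal_inf_lbound; exists j => //=.
by apply: le_trans (diff2_le d (d_ j)) _; apply: leeD.
Qed.

End RieszFischer.

(** * Square-integrable operator-valued functions *)

Section OperatorFunctions.
Variable R : realType.
Local Notation C := R[i].
Local Notation mu := (@lebesgue_measure R).
Local Notation D := (@unit_itv R).
Local Notation E := (ell2 R).
Local Notation B := (bop E E).
Local Notation e_ := (ebasis R).
Implicit Types (f g : C -> B).

Lemma wm_inner f u v : weakly_measurable f -> cmeas (fun t => innerp (f (circ t) u) v).
Proof. by move=> h; have [] := h u v. Qed.

Lemma wm_coord f u m : weakly_measurable f -> cmeas (fun t => f (circ t) u m).
Proof.
move=> /(wm_inner u (e_ m)); apply: cmeas_ext => t _; exact: innerp_ebasis.
Qed.

Lemma entry_wm f : (forall n m, cmeas (fun t => f (circ t) (e_ n) m)) -> weakly_measurable f.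
Proof.
move=> h u v.
have hu m : cmeas (fun t => f (circ t) u m).
  apply: (@cmeas_cvg _ (fun N t => \sum_(n < N) u n * f (circ t) (e_ n) m)) => [N|t _]; last exact: bop_etrunc_cvg.
  by apply: (@cmeas_sum R N (fun n t => u n * f (circ t) (e_ n) m)) => n; exact: cmeasZ.
suff [] : cmeas (fun t => innerp (f (circ t) u) v) by [].
apply: (@cmeas_cvg _ (fun N t => \sum_(m < N) f (circ t) u m * (v m)^*)) => [N|t _]; last exact: innerp_cvg.
apply: (@cmeas_sum R N (fun m t => f (circ t) u m * (v m)^*)) => m.
by apply: cmeasM => //; exact: cmeas_cst.
Qed.

Lemma wm_comp f g : weakly_measurable f -> weakly_measurable g ->
  weakly_measurable (fun z => bcomp (f z) (g z)).
Proof.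
move=> hf hg; apply: entry_wm => n m.
apply: (@cmeas_cvg _ (fun N t => \sum_(k < N) g (circ t) (e_ n) k * f (circ t) (e_ k) m)) => [N|t _].
  apply: (@cmeas_sum R N (fun k t => g (circ t) (e_ n) k * f (circ t) (e_ k) m)) => k.
  by apply: cmeasM; exact: wm_coord.
exact: bop_etrunc_cvg.
Qed.

Lemma wm_cst (T : B) : weakly_measurable (fun=> T).
Proof. by apply: entry_wm => n m; exact: cmeas_cst. Qed.

Lemma wmB f g : weakly_measurable f -> weakly_measurable g -> weakly_measurable (fun z => f z - g z).
Proof.
move=> hf hg; apply: entry_wm => n m.
apply: (cmeas_ext (P := fun t => f (circ t) (e_ n) m - g (circ t) (e_ n) m)) => [t _|].
  by rewrite bopsubE ell2_valB.
by apply: cmeasB; exact: wm_coord.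
Qed.

Definition op_poly (d : nat) (a : nat -> B) (z : C) : B := \sum_(p < d) z ^+ p *: a p.

Lemma op_poly_entry d a (t : R) u m : op_poly d a (circ t) u m = trig_poly d (fun p => a p u m) t.
Proof.
by rewrite /op_poly bopsumE ell2_val_sum; apply: eq_bigr => p _; rewrite bopscaleE ell2_valZ mulrC.
Qed.

Lemma wm_op_poly d a : weakly_measurable (op_poly d a).
Proof.
apply: entry_wm => n m; apply: (cmeas_ext _ (cmeas_trig_poly d (fun p => a p (e_ n) m))) => t _.
by rewrite op_poly_entry.
Qed.

Definition double_esum (a : nat -> nat -> \bar R) : \bar R := (\sum_(0 <= n <oo) \sum_(0 <= m <oo) a n m)%E.

Lemma double_esum_ge0 a : (forall n m, (0 <= a n m)%E) -> (0 <= double_esum a)%E.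
Proof. by move=> a0; apply: nneseries_ge0 => n _ _; apply: nneseries_ge0. Qed.

Lemma le_double_esum a b : (forall n m, (0 <= a n m)%E) -> (forall n m, (a n m <= b n m)%E) -> (double_esum a <= double_esum b)%E.
Proof.
move=> a0 ab; apply: lee_nneseries => [n _ _|n _]; first exact: nneseries_ge0.
by apply: lee_nneseries => m _.
Qed.

Lemma double_esum_series (a : nat -> nat -> nat -> \bar R) (P : pred nat) : (forall p n m, (0 <= a p n m)%E) ->
  double_esum (fun n m => \sum_(p <oo | P p) a p n m)%E = (\sum_(p <oo | P p) double_esum (a p))%E.
Proof.
move=> a0; rewrite /double_esum.
transitivity (\sum_(0 <= n <oo) \sum_(p <oo | P p) \sum_(0 <= m <oo) a p n m)%E.
  by apply: eq_eseriesr => n _; exact: (@nneseries_interchange R (fun m p => a p n m) xpredT P).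
apply: (@nneseries_interchange R (fun n p => \sum_(0 <= m <oo) a p n m)%E xpredT P) => n p.
exact: nneseries_ge0.
Qed.

Lemma hs2_double_esum (T : B) : hs2 T = double_esum (fun n m => (nsq (T (e_ n) m))%:E).
Proof. by apply: eq_eseriesr => n _; rewrite -ell2_esum. Qed.

Lemma measurable_hs2 f : weakly_measurable f -> measurable_fun D (fun t => hs2 (f (circ t))).
Proof.
move=> hf; have m1 n : measurable_fun D (fun t => (rnorm (f (circ t) (e_ n)) ^+ 2)%:E).
  apply: (eq_measurable_fun (fun t => \sum_(0 <= m <oo) (nsq (f (circ t) (e_ n) m))%:E)%E).
    by move=> t _; rewrite ell2_esum.
  apply: (ge0_emeasurable_sum (h := fun m t => (nsq (f (circ t) (e_ n) m))%:E)) => [m t Dt _|m _].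
    by rewrite lee_fin nsq_ge0.
  by apply: measurable_nsqE; exact: wm_coord.
apply: (ge0_emeasurable_sum (h := fun n t => (rnorm (f (circ t) (e_ n)) ^+ 2)%:E)) => [n t Dt _|n _].
  by rewrite lee_fin sqr_ge0.
exact: m1.
Qed.

Definition H2sq f : \bar R := (\int[mu]_(t in D) hs2 (f (circ t)))%E.

Lemma H2sq_ge0 f : (0 <= H2sq f)%E.
Proof. by apply: integral_ge0 => t _; exact: hs2_ge0. Qed.

Lemma H2normE f : H2norm f = sqrte (H2sq f).
Proof. by rewrite /H2norm; congr sqrte; apply: eq_integral => t _; exact: hsnorm_sqr. Qed.

Lemma H2norm_sqr f : (H2norm f ^+ 2 = H2sq f)%E.
Proof. by rewrite H2normE sqr_sqrte // H2sq_ge0. Qed.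

Lemma H2sq_double_esum f : weakly_measurable f ->
  H2sq f = double_esum (fun n m => L2sq (fun t => f (circ t) (e_ n) m)).
Proof.
move=> hf; rewrite /H2sq; under eq_integral do rewrite hs2_double_esum.
have mm n m : measurable_fun D (fun t => (nsq (f (circ t) (e_ n) m))%:E).
  by apply: measurable_nsqE; exact: wm_coord.
have p0 n m t : D t -> (0 <= (nsq (f (circ t) (e_ n) m))%:E)%E by move=> _; rewrite lee_fin nsq_ge0.
have ms n : measurable_fun D (fun t => \sum_(0 <= m <oo) (nsq (f (circ t) (e_ n) m))%:E)%E.
  by apply: (ge0_emeasurable_sum (h := fun m t => (nsq (f (circ t) (e_ n) m))%:E)) => [m t Dt _|m _]; [exact: p0|exact: mm].
have ps n t : D t -> (0 <= \sum_(0 <= m <oo) (nsq (f (circ t) (e_ n) m))%:E)%E.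
  by move=> Dt; apply: nneseries_ge0 => m _ _; exact: p0.
rewrite (integral_nneseries mu (@measurable_unit_itv R) ms ps).
by apply: eq_eseriesr => n _; rewrite (integral_nneseries mu (@measurable_unit_itv R) (mm n) (p0 n)).
Qed.

(** A matrix with square-summable entries is bounded, by Cauchy-Schwarz in each row. *)
Lemma mk_hs (M : nat -> nat -> C) : (double_esum (fun n m => (nsq (M m n))%:E) < +oo)%E ->
  exists T : B, forall n m, T (e_ n) m = M m n.
Proof.
move=> Mf.
have t0 n m : (0 <= (nsq (M m n))%:E)%E by rewrite lee_fin nsq_ge0.
have f0 := double_esum_ge0 t0.
pose h := fine (double_esum (fun n m => (nsq (M m n))%:E)).
have hE : double_esum (fun n m => (nsq (M m n))%:E) = h%:E by rewrite fineK // ge0_fin_numE.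
have h0 : 0 <= h by apply: fine_ge0.
have b : mbound M (Num.sqrt h ^+ 2).
  move=> S N u; rewrite sqr_sqrtr //.
  apply: (@le_trans _ _ (\sum_(s < S) (\sum_(t < N) nsq (M s t)) * (\sum_(t < N) nsq (u t)))).
    by apply: ler_sum => s _; exact: (@nsq_CS R N (M s) u).
  rewrite -mulr_suml ler_wpM2r //; first by apply: sumr_ge0 => t _; exact: nsq_ge0.
  rewrite -lee_fin -hE exchange_big -sumEFin.
  apply: (@le_trans _ _ (\sum_(n < N) \sum_(0 <= m <oo) (nsq (M m n))%:E)%E).
    by apply: lee_sum => n _; rewrite -sumEFin; exact: (nneseries_partial S (t0 n)).
  by apply: nneseries_partial => n; apply: nneseries_ge0.
have [T [hT _]] := mx_bop (sqrtr_ge0 h) b.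
by exists T => n m; rewrite hT.
Qed.

(** An element of H^2(S_2) together with its Fourier coefficients, as the sum in L^2 of its power
    series. *)
Definition L2conv f (a : nat -> B) :=
  [/\ weakly_measurable f, (H2sq f < +oo)%E, forall p, (hs2 (a p) < +oo)%E &
   forall e : R, 0 < e -> exists N, forall d, (N <= d)%N -> (H2sq (fun z => f z - op_poly d a z)%R <= e%:E)%E].

Lemma sub_entry f g t n m : (f (circ t) - g (circ t) : B) (e_ n) m = f (circ t) (e_ n) m - g (circ t) (e_ n) m.
Proof. by []. Qed.

Lemma H2sq_sub_op_poly f d a : weakly_measurable f -> H2sq (fun z => f z - op_poly d a z) =
  double_esum (fun n m => L2sq (fun t => f (circ t) (e_ n) m - trig_poly d (fun p => a p (e_ n) m) t)).
Proof.
move=> hf; rewrite H2sq_double_esum; last by apply: wmB => //; exact: wm_op_poly.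
apply: eq_eseriesr => n _; apply: eq_eseriesr => m _; apply: eq_integral => t _.
by rewrite sub_entry op_poly_entry.
Qed.

Lemma L2conv_H2S2 f a : L2conv f a -> H2S2 f.
Proof.
move=> [hf _ ha hc]; split => //; exists (fun d => op_poly d a); split.
  move=> d; exists d, a; split => // n.
  by rewrite /hsnorm; have := ha n; rewrite /hs2; case: (\sum_(0 <= _ <oo) _)%E => [r| |] //= _; rewrite ltry.
have s0 (d : nat) : (0 <= H2norm (fun z => f z - op_poly d a z)%R)%E by rewrite H2normE sqrte_ge0.
apply/fine_cvgP; split.
  have [N hN] := hc 1 ltr01; exists N => // d Nd /=.
  have := hN d Nd; have := s0 d; rewrite H2normE.
  by case: (H2sq _) => [r| |].
apply/cvgrPdist_le => e e0.
have [N hN] := hc (e ^+ 2) (exprn_gt0 _ e0); exists N => // d Nd /=.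
have := hN d Nd; rewrite sub0r normrN H2normE; have := H2sq_ge0 (fun z => f z - op_poly d a z).
case: (H2sq _) => [r| |] //=.
rewrite !lee_fin => r0 re; rewrite ger0_norm ?sqrtr_ge0 //.
by rewrite -(@ler_pXn2r _ 2) ?nnegrE ?sqrtr_ge0 ?(ltW e0) // sqr_sqrtr.
Qed.

End OperatorFunctions.

(** * Fourier coefficients in H^2(S_2) *)

Section HardyCoefficients.
Variable R : realType.
Local Notation C := R[i].
Local Notation mu := (@lebesgue_measure R).
Local Notation D := (@unit_itv R).
Local Notation E := (ell2 R).
Local Notation B := (bop E E).
Local Notation e_ := (ebasis R).
Implicit Types (f g : C -> B).

Lemma nneseries_term (a : nat -> \bar R) n : (forall n, (0 <= a n)%E) -> (a n <= \sum_(0 <= i <oo) a i)%E.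
Proof.
move=> a0; apply: (le_trans _ (nneseries_partial n.+1 a0)).
by rewrite big_ord_recr /= leeDr // sume_ge0.
Qed.

Lemma double_esum_term (a : nat -> nat -> \bar R) n m : (forall n m, (0 <= a n m)%E) -> (a n m <= double_esum a)%E.
Proof.
move=> a0; apply: le_trans (nneseries_term m (a0 n)) _.
by apply: (nneseries_term (a := fun n => (\sum_(0 <= m <oo) a n m)%E)) => k; exact: nneseries_ge0.
Qed.

(** The entries of [f] are scalar functions. Bessel's inequality for each of them gives the
    square-summability, and since Fourier sums are best approximations, they converge at least as
    fast as the polynomials provided by the definition of H^2(S_2). *)
Lemma H2S2_coefficients f : H2S2 f -> (H2sq f < +oo)%E ->
  exists a, L2conv f a /\ (\sum_(0 <= p <oo) hs2 (a p) <= H2sq f)%E.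
Proof.
move=> [hf [P [polyP limP]]] ff.
pose en n m t := f (circ t) (e_ n) m.
have me n m : cmeas (en n m) by exact: wm_coord.
have s0 n m : (0 <= L2sq (en n m))%E by exact: L2sq_ge0.
have fe : H2sq f = double_esum (fun n m => L2sq (en n m)) by exact: H2sq_double_esum.
have fin n m : L2sq (en n m) = (fine (L2sq (en n m)))%:E.
  rewrite fineK // ge0_fin_numE //; apply: le_lt_trans ff; rewrite fe.
  exact: (double_esum_term n m s0).
pose ga p n m := fourier_coef (en n m) p.
have g0 p n m : (0 <= (nsq (ga p n m))%:E)%E by rewrite lee_fin nsq_ge0.
have bes : (\sum_(0 <= p <oo) double_esum (fun n m => (nsq (ga p n m))%:E) <= H2sq f)%E.
  rewrite -(@double_esum_series R (fun p n m => (nsq (ga p n m))%:E) xpredT) // fe.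
  apply: le_double_esum => n m; first exact: nneseries_ge0.
  rewrite fin; apply: nneseries_le => [p|d]; first exact: g0.
  by rewrite sumEFin lee_fin; apply: bessel_circle.
have dfin p : (double_esum (fun n m => (nsq (ga p n m))%:E) < +oo)%E.
  apply: le_lt_trans ff; apply: le_trans bes.
  by apply: (nneseries_term (a := fun p => double_esum (fun n m => (nsq (ga p n m))%:E))) => k; exact: double_esum_ge0.
have [a ha] := choice (fun p => mk_hs (M := fun m n => ga p n m) (dfin p)).
have hsa p : hs2 (a p) = double_esum (fun n m => (nsq (ga p n m))%:E).
  rewrite hs2_double_esum; apply: eq_eseriesr => n _; apply: eq_eseriesr => m _.
  by rewrite ha.
exists a; split; last first.
  by under eq_eseriesr do rewrite hsa.
split => // [p|e e0]; first by rewrite hsa.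
have /fine_cvgP [n1 n2] := limP.
have se0 : 0 < Num.sqrt e by rewrite sqrtr_gt0.
move/cvgrPdist_lt : n2 => /(_ _ se0) n2.
have [j [j1 j2]] : exists j, H2norm (fun z => f z - P j z) \is a fin_num /\
    `|0 - fine (H2norm (fun z => f z - P j z))| < Num.sqrt e.
  have [k1 _ g1] := n1; have [k2 _ g2] := n2.
  by exists (maxn k1 k2); split; [apply: g1|apply: g2]; rewrite /= ?leq_maxl ?leq_maxr.
have small : (H2sq (fun z => f z - P j z)%R <= e%:E)%E.
  rewrite -H2norm_sqr -(fineK j1) -EFin_expe lee_fin.
  rewrite sub0r normrN in j2.
  rewrite -(sqr_sqrtr (ltW e0)) ler_pXn2r ?nnegrE ?sqrtr_ge0 //.
    by apply: ltW; apply: le_lt_trans j2; exact: ler_norm.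
  by rewrite fine_ge0 // H2normE sqrte_ge0.
have [d [b [_ Pj]]] := polyP j.
exists d => d' dd'.
apply: le_trans small.
have -> : (fun z => f z - P j z) = (fun z => f z - op_poly d b z) by rewrite Pj.
rewrite (H2sq_sub_op_poly d' a hf) (H2sq_sub_op_poly d b hf); apply: le_double_esum => n m; first exact: L2sq_ge0.
have -> : L2sq (fun t => f (circ t) (e_ n) m - trig_poly d' (fun p => a p (e_ n) m) t) =
  L2sq (fun t => en n m t - trig_poly d' (fourier_coef (en n m)) t).
  apply: eq_integral => t _; congr (nsq (_ - _))%:E.
  by apply: eq_bigr => p _; rewrite ha.
exact: (best_approx _ (me n m) (fin n m) dd').
Qed.

(** The entries are constructed one by one. The sum [h] of their squared moduli is integrable,
    hence finite almost everywhere, and where it is finite the entries are those of an operator;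
    the function is set to 0 elsewhere. *)
Lemma operator_riesz_fischer (G : nat -> nat -> nat -> C) (M : \bar R) : (M < +oo)%E ->
  (\sum_(0 <= p <oo) double_esum (fun n m => (nsq (G p m n))%:E) <= M)%E ->
  exists f a, [/\ L2conv f a, forall p n m, a p (e_ n) m = G p m n & (H2sq f <= M)%E].
Proof.
move=> My GM.
have g0 p n m : (0 <= (nsq (G p m n))%:E)%E by rewrite lee_fin nsq_ge0.
pose c n m p := G p m n.
have S0 p : (0 <= double_esum (fun n m => (nsq (G p m n))%:E))%E by exact: double_esum_ge0.
have tailE d : (\sum_(d <= p <oo) double_esum (fun n m => (nsq (G p m n))%:E) =
    double_esum (fun n m => \sum_(d <= p <oo) (nsq (c n m p))%:E))%E.
  have e (u : nat -> \bar R) : (\sum_(d <= p <oo) u p = \sum_(p <oo | (d <= p)%N) u p)%E.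
    by rewrite eseries_cond.
  rewrite e -(@double_esum_series R (fun p n m => (nsq (G p m n))%:E) (fun p => (d <= p)%N)) //.
  by apply: eq_eseriesr => n _; apply: eq_eseriesr => m _; rewrite e.
have Sfin : (\sum_(0 <= p <oo) double_esum (fun n m => (nsq (G p m n))%:E) < +oo)%E by apply: le_lt_trans GM My.
have cfin n m : (\sum_(0 <= p <oo) (nsq (c n m p))%:E < +oo)%E.
  apply: le_lt_trans Sfin; rewrite tailE.
  by apply: (double_esum_term (a := fun n m => (\sum_(0 <= p <oo) (nsq (c n m p))%:E)%E)) => i j; apply: nneseries_ge0 => p _ _; rewrite lee_fin nsq_ge0.
have [F hF] := choice (fun k : nat * nat => riesz_fischer (cfin k.1 k.2)).
have mF n m : cmeas (fun t => F (n, m) (circ t)) := (hF (n, m)).1.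
have bF n m d : (L2sq (fun t => F (n, m) (circ t) - trig_poly d (c n m) t)%R <= \sum_(d <= p <oo) (nsq (c n m p))%:E)%E := (hF (n, m)).2 d.
pose h z : \bar R := double_esum (fun n m => (nsq (F (n, m) z))%:E).
have h0 z : (0 <= h z)%E by apply: double_esum_ge0 => n m; rewrite lee_fin nsq_ge0.
have exT z : exists T : B, if h z \is a fin_num then forall n m, T (e_ n) m = F (n, m) z else T = 0.
  have [hz|_] := boolP (h z \is a fin_num); last by exists 0.
  have hz' : (h z < +oo)%E by move: hz; rewrite ge0_fin_numE.
  by have [T hT] := mk_hs (M := fun m n => F (n, m) z) hz'; exists T.
have [f hf] := choice exT.
have fF z n m : h z \is a fin_num -> f z (e_ n) m = F (n, m) z.
  by move=> hz; have := hf z; rewrite hz.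
have f0 z : ~~ (h z \is a fin_num) -> f z = 0.
  by move=> /negbTE hz; have := hf z; rewrite hz.
have mh : measurable_fun D (fun t => h (circ t)).
  apply: (ge0_emeasurable_sum (h := fun n t => (\sum_(0 <= m <oo) (nsq (F (n, m) (circ t)))%:E)%E)) => [n t Dt _|n _].
    by apply: nneseries_ge0 => m _ _; rewrite lee_fin nsq_ge0.
  apply: (ge0_emeasurable_sum (h := fun m t => (nsq (F (n, m) (circ t)))%:E)) => [m t Dt _|m _].
    by rewrite lee_fin nsq_ge0.
  exact: measurable_nsqE.
have ih : (\int[mu]_(t in D) h (circ t) < +oo)%E.
  apply: le_lt_trans Sfin; rewrite tailE.
  have p0 n m t : D t -> (0 <= (nsq (F (n, m) (circ t)))%:E)%E by move=> _; rewrite lee_fin nsq_ge0.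
  have mm n m : measurable_fun D (fun t => (nsq (F (n, m) (circ t)))%:E) by exact: measurable_nsqE.
  have ms n : measurable_fun D (fun t => \sum_(0 <= m <oo) (nsq (F (n, m) (circ t)))%:E)%E.
    by apply: (ge0_emeasurable_sum (h := fun m t => (nsq (F (n, m) (circ t)))%:E)) => [m t Dt _|m _]; [exact: p0|exact: mm].
  have ps n t : D t -> (0 <= \sum_(0 <= m <oo) (nsq (F (n, m) (circ t)))%:E)%E.
    by move=> Dt; apply: nneseries_ge0 => m _ _; exact: p0.
  rewrite /h /double_esum (integral_nneseries mu (@measurable_unit_itv R) ms ps).
  apply: lee_nneseries => [n _ _|n _]; first by apply: integral_ge0 => t; exact: ps.
  rewrite (integral_nneseries mu (@measurable_unit_itv R) (mm n) (p0 n)).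
  apply: lee_nneseries => [m _ _|m _]; first by apply: integral_ge0 => t; exact: p0.
  apply: le_trans (bF n m 0%N).
  rewrite /L2sq le_eqVlt; apply/orP; left; apply/eqP; apply: eq_integral => t _.
  by rewrite /trig_poly big_ord0 subr0.
have iH : mu.-integrable D (fun t => h (circ t)).
  apply/integrableP; split; first exact: mh.
  by under eq_integral do rewrite gee0_abs ?h0 //.
have ae := integrable_ae (@measurable_unit_itv R) iH.
have wf : weakly_measurable f.
  apply: entry_wm => n m.
  pose A := D `&` [set t | h (circ t) \is a fin_num].
  have mA : measurable (A : set (measurableTypeR R)).
    by apply: emeasurable_fin_num => //; exact: measurable_unit_itv.
  have mI : cmeas (fun t : R => (\1_A t)%:C%C : C).
    by split; [exact: measurable_indic|exact: measurable_cst].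
  apply: (cmeas_ext _ (cmeasM mI (mF n m))) => t Dt.
  have [hz|nz] := boolP (h (circ t) \is a fin_num).
    by rewrite fF // indicE mem_set // mul1r.
  rewrite f0 // indicE memNset ?mul0r //.
  by move=> [_ /=]; exact/negP.
have [a ha] := choice (fun p => mk_hs (M := fun m n => G p m n) (le_lt_trans (nneseries_term p S0) Sfin)).
have ha' p n m : a p (e_ n) m = G p m n by rewrite ha.
have key d : (H2sq (fun z => f z - op_poly d a z)%R <= \sum_(d <= p <oo) double_esum (fun n m => (nsq (G p m n))%:E))%E.
  rewrite H2sq_sub_op_poly // tailE; apply: le_double_esum => n m; first exact: L2sq_ge0.
  apply: le_trans (bF n m d).
  have e : L2sq (fun t => f (circ t) (e_ n) m - trig_poly d (fun p => a p (e_ n) m) t) =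
           L2sq (fun t => f (circ t) (e_ n) m - trig_poly d (c n m) t).
    apply: eq_integral => t _; congr (nsq (_ - _))%:E.
    by apply: eq_bigr => p _; rewrite ha'.
  rewrite e; apply: (ae_ge0_le_integral (mu := mu) (@measurable_unit_itv R)).
  - by move=> t _; rewrite lee_fin nsq_ge0.
  - apply: measurable_nsqE; apply: cmeasB; [exact: wm_coord|exact: cmeas_trig_poly].
  - by move=> t _; rewrite lee_fin nsq_ge0.
  - by apply: measurable_nsqE; apply: cmeasB; [exact: mF|exact: cmeas_trig_poly].
  - by apply: filterS ae => t hz Dt; rewrite fF // hz.
have fM : (H2sq f <= M)%E.
  apply: le_trans GM; apply: le_trans (key 0%N).
  rewrite /H2sq le_eqVlt; apply/orP; left; apply/eqP; apply: eq_integral => t _.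
  by rewrite /op_poly big_ord0 subr0.
exists f, a; split => //; split => //; first exact: le_lt_trans fM My.
  move=> p; rewrite hs2_double_esum; apply: le_lt_trans Sfin; apply: le_trans (nneseries_term p S0).
  by apply: le_double_esum => n m; rewrite ha'.
move=> e e0.
have tl := nneseries_tail_cvg Sfin (fun p _ => S0 p).
have /fine_cvgP [n1 n2] := tl.
move/cvgrPdist_lt : n2 => /(_ _ e0) n2.
have [k1 _ g1] := n1; have [k2 _ g2] := n2.
exists (maxn k1 k2) => d; rewrite geq_max => /andP[d1 d2].
apply: le_trans (key d) _; rewrite -(fineK (g1 d d1)) lee_fin.
have := g2 d d2; rewrite /= sub0r normrN => /ltW; apply: le_trans.
exact: ler_norm.
Qed.

End HardyCoefficients.

(** * Approximation of products by polynomials *)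

Section HardyProducts.
Variable R : realType.
Local Notation C := R[i].
Local Notation Re := (@complex.Re R).
Local Notation Im := (@complex.Im R).
Local Notation mu := (@lebesgue_measure R).
Local Notation D := (@unit_itv R).
Local Notation E := (ell2 R).
Local Notation B := (bop E E).
Local Notation e_ := (ebasis R).

(** Both integrals are suprema over the nonnegative simple functions below the integrand. *)
Lemma le_integral_nonneg (F G : R -> \bar R) : (forall t, D t -> (0 <= F t)%E) ->
  (forall t, D t -> (F t <= G t)%E) ->
  (\int[mu]_(t in D) F t <= \int[mu]_(t in D) G t)%E.
Proof.
move=> F0 FG; have G0 t : D t -> (0 <= G t)%E by move=> Dt; apply: le_trans (FG _ Dt); exact: F0.
rewrite !ge0_integralE //; apply: ge_ereal_sup => _ [h hF <-]; apply: ereal_sup_ubound.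
exists h => // t; apply: le_trans (hF t) _.
by apply: lee_restrict.
Qed.

Lemma trnorm_ge0 (x : B) : (0 <= trnorm x)%E.
Proof.
have [xp|x0] : is_absop x (absop x) \/ absop x = 0.
  by rewrite /absop; case: xgetP => [y _ h|h]; [left|right].
  by apply: nneseries_ge0 => n _ _; rewrite lee_fin; apply: (ler_Re (xp.1 _)).
rewrite /trnorm x0 eseries0 // => n _ _.
by rewrite (_ : (0 : B) (e_ n) = 0) // (semi0l (@innerp_lin R E)).
Qed.

Lemma hs2_comp_le (y T : B) : (hs2 (bcomp y T) <= (opnorm y ^+ 2)%:E * hs2 T)%E.
Proof.
rewrite /hs2 -nneseriesZl; last by move=> n _; rewrite lee_fin sqr_ge0.
apply: lee_nneseries => [n _ _|n _]; first by rewrite lee_fin sqr_ge0.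
have h := opnorm_sqr y (T (e_ n)).
by rewrite -EFinM lee_fin; exact: h.
Qed.

Lemma hs2N (T : B) : hs2 (- T) = hs2 T.
Proof.
apply: eq_eseriesr => n _; have -> : (- T : B) (e_ n) = (-1) *: T (e_ n) by rewrite scaleN1r.
by rewrite rnormZ nsqN nsq1 mul1r.
Qed.

Lemma hs2_0 : hs2 (0 : B) = 0%E.
Proof. by rewrite /hs2 eseries0 // => n _ _; rewrite (_ : (0 : B) (e_ n) = 0) // rnorm0 expr0n. Qed.

Lemma fin_ereal (x : \bar R) : (0 <= x)%E -> (x < +oo)%E -> exists2 r : R, 0 <= r & x = r%:E.
Proof. by case: x => [r| |] //= r0 _; exists r. Qed.

(** Infinite Hilbert-Schmidt norms are included, since the weights are positive. *)
Lemma pairing_bound1 (a b : B) (w : R) u v : 0 < w ->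
  ((`|Re (innerp (a (b u)) v)| + `|Im (innerp (a (b u)) v)|)%:E <=
   (2 * (rnorm u * rnorm v) + 1)%:E * (w%:E * hs2 a + (w^-1)%:E * hs2 b))%E.
Proof.
move=> w0; have wV : 0 < w^-1 by rewrite invr_gt0.
set K := rnorm u * rnorm v; have K0 : 0 <= K by rewrite mulr_ge0 ?rnorm_ge0.
have K1 : 0 < 2 * K + 1 by rewrite ltr_wpDl // mulr_ge0.
have [ay|ay] := eqVneq (hs2 a) +oo%E.
  rewrite ay gt0_muley ?lte_fin // addye ?gt0_muley ?lte_fin ?leey //.
  by rewrite gt_eqF // (lt_le_trans ltNy0) // mule_ge0 ?hs2_ge0 // lee_fin ltW.
have [bY|bY] := eqVneq (hs2 b) +oo%E.
  rewrite bY (gt0_muley (_ : 0 < w^-1%:E)%E) ?lte_fin // addey ?gt0_muley ?lte_fin ?leey //.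
  by rewrite gt_eqF // (lt_le_trans ltNy0) // mule_ge0 ?hs2_ge0 // lee_fin ltW.
have af : (hs2 a < +oo)%E by rewrite ltey.
have bf : (hs2 b < +oo)%E by rewrite ltey.
have [r r0 rE] := fin_ereal (hs2_ge0 a) af.
have [s s0 sE] := fin_ereal (hs2_ge0 b) bf.
rewrite rE sE -!EFinM lee_fin.
set z := innerp _ _; set T := w * r + w^-1 * s.
have T0 : 0 <= T by rewrite addr_ge0 // mulr_ge0 // ltW.
have rs : r * s <= T ^+ 2.
  have -> : T ^+ 2 = (w * r - w^-1 * s) ^+ 2 + 4 * (w * w^-1) * (r * s) by rewrite /T; ring.
  rewrite divff ?gt_eqF // mulr1; have := sqr_ge0 (w * r - w^-1 * s).
  have := mulr_ge0 r0 s0; lra.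
have nz : nsq z <= (K * T) ^+ 2.
  apply: le_trans (innerp_CS _ _) _.
  have h1 : rnorm (a (b u)) ^+ 2 <= r * rnorm (b u) ^+ 2 by apply: hs2_bound; rewrite rE.
  have h2 : rnorm (b u) ^+ 2 <= s * rnorm u ^+ 2 by apply: hs2_bound; rewrite sE.
  apply: (@le_trans _ _ ((r * (s * rnorm u ^+ 2)) * rnorm v ^+ 2)).
    rewrite ler_wpM2r ?sqr_ge0 //; apply: le_trans h1 _.
    by rewrite ler_wpM2l.
  have -> : r * (s * rnorm u ^+ 2) * rnorm v ^+ 2 = K ^+ 2 * (r * s) by rewrite /K; ring.
  by rewrite [(K * T) ^+ 2]exprMn ler_wpM2l ?sqr_ge0.
have KT0 : 0 <= K * T by rewrite mulr_ge0.
have c1 : `|Re z| <= K * T.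
  rewrite -(@ler_pXn2r _ 2) ?nnegrE // real_normK ?num_real //.
  by apply: le_trans nz; rewrite /nsq lerDl sqr_ge0.
have c2 : `|Im z| <= K * T.
  rewrite -(@ler_pXn2r _ 2) ?nnegrE // real_normK ?num_real //.
  by apply: le_trans nz; rewrite /nsq lerDr sqr_ge0.
by rewrite mulrDl mul1r -mulrA; lra.
Qed.

(** The same control as in [trnorm_sum_le] for the weak matrix coefficients, which are needed for
    Fourier coefficients. *)
Lemma pairing_bound (k : nat) (a b : nat -> B) (w : nat -> R) (x : B) u v :
  (forall i, 0 < w i) ->
  (forall u, x u = \sum_(i < k) a i (b i u)) ->
  ((`|Re (innerp (x u) v)| + `|Im (innerp (x u) v)|)%:E <=
   (2 * (rnorm u * rnorm v) + 1)%:E * \sum_(i < k) ((w i)%:E * hs2 (a i) + ((w i)^-1)%:E * hs2 (b i)))%E.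
Proof.
move=> w0 xE.
have t0 i : (0 <= (w i)%:E * hs2 (a i) + ((w i)^-1)%:E * hs2 (b i))%E.
  by rewrite adde_ge0 // mule_ge0 ?hs2_ge0 // lee_fin ?invr_ge0 ltW.
rewrite ge0_sume_distrr //.
apply: (@le_trans _ _ (\sum_(i < k) (`|Re (innerp (a i (b i u)) v)| + `|Im (innerp (a i (b i u)) v)|)%:E)%E); last first.
  by apply: lee_sum => i _; exact: pairing_bound1.
rewrite sumEFin lee_fin xE (semi_suml (@innerp_lin R E)) Re_sum Im_sum big_split /=.
by apply: lerD; exact: ler_norm_sum.
Qed.

Lemma big_ord3 (V : zmodType) (h : nat -> V) : \sum_(i < 3) h i = h 0%N + h 1%N + h 2.
Proof. by rewrite !big_ord_recr big_ord0 /= add0r. Qed.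

Section Product.
Variables (f g : C -> B) (a b : nat -> B) (y : B).
Hypotheses (fa : L2conv f a) (gb : L2conv g b).

(** The coefficients of the product of the partial sums of degree less than [d]. *)
Definition truncated_conv d m : B :=
  \sum_(p < d) bcomp (a p) (if (p <= m)%N && (m - p < d)%N then bcomp y (b (m - p)%N) else 0).

Lemma sum_shift (V : zmodType) (h : nat -> V) p d N : (p + d <= N)%N ->
  \sum_(q < d) h q = \sum_(m < N) if (p <= m)%N && (m - p < d)%N then h (m - p)%N else 0.
Proof.
move=> pN; rewrite -(big_mkord xpredT (fun m => if (p <= m)%N && (m - p < d)%N then h (m - p)%N else 0)).
rewrite (big_cat_nat (leq0n p) (leq_trans (leq_addr d p) pN)) /= (big_cat_nat (leq_addr d p) pN) /=.
rewrite [X in _ = X + _]big_nat [X in _ = X + _]big1 ?add0r => [|m /andP[_ mp]]; last by rewrite leqNgt mp.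
rewrite [X in _ = _ + X]big_nat [X in _ = _ + X]big1 ?addr0 => [|m /andP[mp _]]; last first.
  by rewrite ltnNge leq_subRL ?mp ?andbF // (leq_trans (leq_addr d p)).
have := @big_addn V 0 +%R 0%N (p + d)%N p xpredT (fun m => if (p <= m)%N && (m - p < d)%N then h (m - p)%N else 0).
rewrite add0n addKn => ->; rewrite big_mkord; apply: eq_bigr => q _.
by rewrite leq_addl addnK ltn_ord.
Qed.

Lemma product_poly d z u : bcomp (op_poly d a z) (bcomp y (op_poly d b z)) u = op_poly (d + d) (truncated_conv d) z u.
Proof.
have ap (c : nat -> B) v : op_poly d c z v = \sum_(p < d) z ^+ p *: c p v by rewrite /op_poly bopsumE.
rewrite -[LHS]/(op_poly d a z (y (op_poly d b z u))) !ap /op_poly.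
have -> : (\sum_(p < d + d) (z ^+ p *: truncated_conv d p : B)) u = \sum_(p < d + d) z ^+ p *: \sum_(i < d)
   (if (i <= p)%N && (p - i < d)%N then a i (y (b (p - i)%N u)) else 0).
  rewrite bopsumE; apply: eq_bigr => p _; rewrite bopscaleE /truncated_conv bopsumE; congr (_ *: _).
  by apply: eq_bigr => i _; case: ifP => _ //; exact: (bop0 (a i)).
under [RHS]eq_bigr do rewrite scaler_sumr.
rewrite exchange_big /=; apply: eq_bigr => i _.
have id : (i + d <= d + d)%N by rewrite leq_add2r ltnW.
transitivity (\sum_(q < d) z ^+ (i + q) *: a i (y (b q u))).
  by rewrite !bop_sum scaler_sumr; apply: eq_bigr => q _; rewrite !bopZ scalerA exprD.
rewrite (sum_shift (fun q => z ^+ (i + q) *: a i (y (b q u))) id); apply: eq_bigr => m _.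
by case: ifP => [/andP[im _]|_]; rewrite ?subnKC ?scaler0.
Qed.

Let w z := bcomp (f z) (bcomp y (g z)).

Let fwm : weakly_measurable f. Proof. by case: fa. Qed.
Let gwm : weakly_measurable g. Proof. by case: gb. Qed.

Let Af d z (i : nat) : B := if i == 1%N then f z else f z - op_poly d a z.
Let Bf d z (i : nat) : B := if i == 0%N then bcomp y (g z) else
  if i == 1%N then bcomp y (g z - op_poly d b z) else - bcomp y (g z - op_poly d b z).

Let error_sum d z u : (w z - op_poly (d + d) (truncated_conv d) z : B) u = \sum_(i < 3) Af d z i (Bf d z i u).
Proof.
rewrite bopsubE -product_poly (big_ord3 (fun i => Af d z i (Bf d z i u))).
have N (T : B) v : T (- v) = - T v by rewrite -scaleN1r bopZ scaleN1r.
pose h := g z u - op_poly d b z u.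
have -> : Af d z 0 (Bf d z 0 u) = f z (y (g z u)) - op_poly d a z (y (g z u)) by [].
have -> : Af d z 1 (Bf d z 1 u) = f z (y h) by [].
have -> : Af d z 2 (Bf d z 2 u) = - f z (y h) + op_poly d a z (y h).
  rewrite -[LHS]/(f z (- y h) - op_poly d a z (- y h)).
  by rewrite !N opprK.
have -> : w z u = f z (y (g z u)) by [].
have -> : bcomp (op_poly d a z) (bcomp y (op_poly d b z)) u = op_poly d a z (y (op_poly d b z u)) by [].
rewrite [X in _ = _ + X]addrC -[RHS]addrA [_ + (_ - _)]addrC subrK /h !bopB.
by rewrite addrA subrK.
Qed.

Let wm_Bf i d : weakly_measurable (fun z => Bf d z i).
Proof.
have h1 : weakly_measurable (fun z => bcomp y (g z)).
  by apply: wm_comp => //; exact: wm_cst.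
have h2 : weakly_measurable (fun z => bcomp y (g z - op_poly d b z)).
  by apply: (wm_comp (f := fun=> y)); [exact: wm_cst|apply: wmB => //; exact: wm_op_poly].
rewrite /Bf; case: (i == 0)%N => //; case: (i == 1)%N => //.
apply: entry_wm => n m.
by apply: (cmeas_ext _ (cmeasZ (-1) (wm_coord (e_ n) m h2))) => t _; rewrite mulN1r.
Qed.

Let wm_Af i d : weakly_measurable (fun z => Af d z i).
Proof. by rewrite /Af; case: (i == 1)%N => //; apply: wmB; [|exact: wm_op_poly]. Qed.

Lemma H2sq_comp_le (T : C -> B) (r : R) : weakly_measurable T -> (H2sq T <= r%:E)%E ->
  (H2sq (fun z => bcomp y (T z)) <= (opnorm y ^+ 2 * r)%:E)%E.
Proof.
move=> hT Tr; apply: (@le_trans _ _ (\int[mu]_(t in D) ((opnorm y ^+ 2)%:E * hs2 (T (circ t))))%E).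
  apply: le_integral_nonneg => t _; [exact: hs2_ge0|exact: hs2_comp_le].
rewrite (ge0_integralZl_EFin mu (@measurable_unit_itv R)) ?sqr_ge0 //; last 2 first.
- by move=> t _; exact: hs2_ge0.
- exact: measurable_hs2.
by rewrite [leRHS]EFinM; apply: lee_wpmul2l => //; rewrite lee_fin sqr_ge0.
Qed.

Let wt (dl : R) (i : nat) : R := if i == 0%N then dl^-1 else if i == 1%N then dl else 1.

Let rho (dl : R) d t : \bar R := (\sum_(i < 3)
  ((wt dl i)%:E * hs2 (Af d (circ t) i) + ((wt dl i)^-1)%:E * hs2 (Bf d (circ t) i)))%E.

Let int_term (T S : C -> B) (v r s : R) : 0 < v -> weakly_measurable T -> weakly_measurable S ->
  (H2sq T <= r%:E)%E -> (H2sq S <= s%:E)%E ->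
  (\int[mu]_(t in D) (v%:E * hs2 (T (circ t)) + (v^-1)%:E * hs2 (S (circ t))) <= (v * r + v^-1 * s)%:E)%E.
Proof.
move=> v0 hT hS Tr Ss.
have vi : 0 <= v^-1 by rewrite invr_ge0 ltW.
have mT := measurable_hs2 hT; have mS := measurable_hs2 hS.
have nT t : D t -> (0 <= hs2 (T (circ t)))%E by move=> _; exact: hs2_ge0.
have nS t : D t -> (0 <= hs2 (S (circ t)))%E by move=> _; exact: hs2_ge0.
rewrite (ge0_integralD mu (@measurable_unit_itv R)); first last.
- exact: measurable_funeM.
- by move=> t Dt; rewrite mule_ge0 ?nS.
- exact: measurable_funeM.
- by move=> t Dt; rewrite mule_ge0 ?nT // lee_fin ltW.
rewrite (ge0_integralZl_EFin mu (@measurable_unit_itv R) nT mT) ?(ltW v0) //.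
rewrite (ge0_integralZl_EFin mu (@measurable_unit_itv R) nS mS) //.
rewrite EFinD [(v * r)%:E]EFinM [(v^-1 * s)%:E]EFinM.
by apply: leeD; apply: lee_wpmul2l => //; rewrite lee_fin // ltW.
Qed.

Let m_term (T S : C -> B) (v : R) : weakly_measurable T -> weakly_measurable S ->
  measurable_fun D (fun t => v%:E * hs2 (T (circ t)) + (v^-1)%:E * hs2 (S (circ t)))%E.
Proof.
move=> hT hS; apply: emeasurable_funD; apply: measurable_funeM; exact: measurable_hs2.
Qed.

(** With f_d and g_d the partial sums, f y g - f_d y g_d is the sum of (f - f_d) y g, of f y
    (g - g_d) and of the opposite of (f - f_d) y (g - g_d). The weights of [trnorm_sum_le] are
    dl^-1, dl and 1: the small factors (f - f_d) and (g - g_d), whose squared norms are at most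
    [ep], compensate for the bounded ones. A single dominating function [r] serves for the trace
    norm and for the matrix coefficients. *)
Lemma product_error (e : R) : 0 < e -> exists N, forall d, (N <= d)%N -> exists r : R -> \bar R,
  [/\ measurable_fun D r, (forall t, (0 <= r t)%E), (\int[mu]_(t in D) r t <= e%:E)%E,
    (forall t, (trnorm (w (circ t) - op_poly (d + d) (truncated_conv d) (circ t))%R <= r t)%E) &
    forall t u v, ((`|Re (innerp ((w (circ t) - op_poly (d + d) (truncated_conv d) (circ t) : B) u) v)| +
        `|Im (innerp ((w (circ t) - op_poly (d + d) (truncated_conv d) (circ t) : B) u) v)|)%:E <=
        (2 * (rnorm u * rnorm v) + 1)%:E * r t)%E].
Proof.
move=> e0.
have [_ ff _ fc] := fa; have [_ gf _ gc] := gb.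
have [F F0 FE] := fin_ereal (H2sq_ge0 f) ff.
have [G G0 GE] := fin_ereal (H2sq_ge0 g) gf.
pose Y := opnorm y ^+ 2; have Y0 : 0 <= Y by exact: sqr_ge0.
have YG : 0 <= Y * G by exact: mulr_ge0.
(* Then dl and dl^-1 * ep are small compared with e; the denominators leave room for six terms. *)
pose dl := e / (6 * (Y * G + F + 1 + e)).
have den : 0 < 6 * (Y * G + F + 1 + e) by rewrite mulr_gt0 // ltr_wpDl // addr_ge0 // addr_ge0.
have dl0 : 0 < dl by rewrite divr_gt0.
have dlE : dl * (6 * (Y * G + F + 1 + e)) = e by rewrite divfK // gt_eqF.
have p1 : 0 <= dl * (Y * G) by rewrite mulr_ge0 // ltW.
have p2 : 0 <= dl * F by rewrite mulr_ge0 // ltW.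
have p3 : 0 < dl * e by rewrite mulr_gt0.
have dlx : 6 * (dl * (Y * G)) + 6 * (dl * F) + 6 * dl + 6 * (dl * e) = e by rewrite -[RHS]dlE; ring.
have dle : dl <= 1.
  rewrite leNgt; apply/negP => d1; have : e < dl * e by rewrite ltr_pMl.
  lra.
pose ep := dl * e / (6 * (1 + Y)).
have Y1 : 0 < 6 * (1 + Y) by rewrite mulr_gt0 // ltr_pwDl.
have ep0 : 0 < ep by rewrite divr_gt0.
have epE : ep * (6 * (1 + Y)) = dl * e by rewrite divfK // gt_eqF.
have epx : 6 * ep + 6 * (Y * ep) = dl * e by rewrite -epE; ring.
have pY : 0 <= Y * ep by rewrite mulr_ge0 // ltW.
clearbody ep; clearbody dl.
have b1 : dl^-1 * ep <= e / 6.
  by rewrite ler_pdivrMl // mulrA; lra.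
have b2 : dl^-1 * (Y * ep) <= e / 6.
  by rewrite ler_pdivrMl // mulrA; lra.
have dee : dl * e <= e by rewrite ler_piMl // ltW.
have [N1 hN1] := fc ep ep0; have [N2 hN2] := gc ep ep0.
exists (maxn N1 N2) => d; rewrite geq_max => /andP[d1 d2].
have fs := hN1 d d1; have gs := hN2 d d2.
have wt0 i : 0 < wt dl i.
  by rewrite /wt; case: (i == 0)%N; rewrite ?invr_gt0 //; case: (i == 1)%N.
exists (rho dl d); split.
- rewrite /rho; apply: emeasurable_sum => i.
  exact: (@m_term _ _ (wt dl i) (wm_Af i d) (wm_Bf i d)).
- move=> t; rewrite /rho; apply: sume_ge0 => i _; apply: adde_ge0; apply: mule_ge0; rewrite ?hs2_ge0 // lee_fin.
    exact: ltW.
  by rewrite invr_ge0 ltW.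
- have gwS : weakly_measurable (fun z => g z - op_poly d b z) by apply: wmB => //; exact: wm_op_poly.
  have fwS : weakly_measurable (fun z => f z - op_poly d a z) by apply: wmB => //; exact: wm_op_poly.
  have A0 : (H2sq (fun z => Af d z 0%N) <= ep%:E)%E by exact: fs.
  have A1 : (H2sq (fun z => Af d z 1%N) <= F%:E)%E by rewrite -FE.
  have A2 : (H2sq (fun z => Af d z 2) <= ep%:E)%E by exact: fs.
  have B0 : (H2sq (fun z => Bf d z 0%N) <= (Y * G)%:E)%E.
    by apply: (H2sq_comp_le gwm); rewrite GE.
  have B1 : (H2sq (fun z => Bf d z 1%N) <= (Y * ep)%:E)%E by exact: (H2sq_comp_le gwS gs).
  have B2 : (H2sq (fun z => Bf d z 2) <= (Y * ep)%:E)%E.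
    apply: le_trans B1; rewrite /H2sq le_eqVlt; apply/orP; left; apply/eqP.
    by apply: eq_integral => t _; exact: hs2N.
  have nn i t : D t -> (0 <= (wt dl i)%:E * hs2 (Af d (circ t) i) + ((wt dl i)^-1)%:E * hs2 (Bf d (circ t) i))%E.
    move=> _; apply: adde_ge0; apply: mule_ge0; rewrite ?hs2_ge0 // lee_fin; first exact: ltW.
    by rewrite invr_ge0 ltW.
  have mn i : measurable_fun D (fun t => (wt dl i)%:E * hs2 (Af d (circ t) i) + ((wt dl i)^-1)%:E * hs2 (Bf d (circ t) i))%E.
    exact: (@m_term _ _ (wt dl i) (wm_Af i d) (wm_Bf i d)).
  rewrite /rho (ge0_integral_sum mu (@measurable_unit_itv R)
    (f := fun (i : 'I_3) t => (wt dl i)%:E * hs2 (Af d (circ t) i) + ((wt dl i)^-1)%:E * hs2 (Bf d (circ t) i))%E) //.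
  rewrite !big_ord_recr big_ord0 /= add0e.
  apply: (@le_trans _ _ ((dl^-1 * ep + dl^-1^-1 * (Y * G))%:E + (dl * F + dl^-1 * (Y * ep))%:E + (1 * ep + 1^-1 * (Y * ep))%:E)%E).
    apply: leeD; first apply: leeD.
    + exact: (int_term (wt0 0%N) (wm_Af 0%N d) (wm_Bf 0%N d) A0 B0).
    + exact: (int_term (wt0 1%N) (wm_Af 1%N d) (wm_Bf 1%N d) A1 B1).
    + exact: (int_term (wt0 2) (wm_Af 2 d) (wm_Bf 2 d) A2 B2).
  rewrite -!EFinD lee_fin invrK invr1 !mul1r.
  clear -b1 b2 dee dlx epx p1 p2 p3 dl0 ep0 pY; lra.
  + by move=> i; exact: (mn i).
  + by move=> i t Dt; exact: (nn i t Dt).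
- move=> t; exact: (@trnorm_sum_le R 3 (Af d (circ t)) (Bf d (circ t)) (wt dl) _ wt0 (error_sum d (circ t))).
- move=> t u v; exact: (@pairing_bound 3 (Af d (circ t)) (Bf d (circ t)) (wt dl) _ u v wt0 (error_sum d (circ t))).
Qed.

End Product.
End HardyProducts.

(** * Products of two elements of H^2(S_2) *)

Section HardyProductTheorem.
Variable R : realType.
Local Notation C := R[i].
Local Notation Re := (@complex.Re R).
Local Notation Im := (@complex.Im R).
Local Notation mu := (@lebesgue_measure R).
Local Notation D := (@unit_itv R).
Local Notation E := (ell2 R).
Local Notation B := (bop E E).

Lemma cvge0_eps (u : nat -> \bar R) : (forall j, (0 <= u j)%E) ->
  (forall e : R, 0 < e -> exists N, forall j, (N <= j)%N -> (u j <= e%:E)%E) -> u @ \oo --> 0%E.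
Proof.
move=> u0 h; have fin e j : (u j <= e%:E)%E -> exists2 r, 0 <= r & u j = r%:E.
  by move=> uj; apply: fin_ereal => //; apply: le_lt_trans uj (ltry _).
apply/fine_cvgP; split.
  have [N hN] := h 1 ltr01; exists N => // j Nj /=.
  by have [r _ ->] := fin _ _ (hN j Nj).
apply/cvgrPdist_le => e e0; have [N hN] := h e e0; exists N => // j Nj /=.
have uj := hN j Nj; have [r r0 rE] := fin _ _ uj.
by move: uj; rewrite rE lee_fin sub0r normrN /= ger0_norm.
Qed.

Lemma fourier_coef_trig_poly d (c : nat -> C) n : (n < d)%N ->
  cintg (fun t => (circ t)^* ^+ n * trig_poly d c t) /\ fourier_coef (trig_poly d c) n = c n.
Proof.
move=> nd.
have i1 p : cintg (fun t : R => (circ t)^* ^+ n * circ t ^+ p).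
  apply: (@cintg_bounded _ _ 1) => [|t _].
    by apply: cmeasM; [exact: cmeas_cconjX|exact: cmeas_circX].
  by rewrite nsqM circX_nsq -rmorphXn /= nsq_conj circX_nsq mulr1.
have [s1 s2] := cintg_sum (n := d) (F := fun p t => c p * ((circ t)^* ^+ n * circ t ^+ p))
  (fun p _ => cintgZ (c p) (i1 p)).
have e : (fun t => (circ t)^* ^+ n * trig_poly d c t) =
   (fun t => \sum_(p < d) c p * ((circ t)^* ^+ n * circ t ^+ p)).
  by apply/funext => t; rewrite /trig_poly mulr_sumr; apply: eq_bigr => p _; rewrite mulrCA.
rewrite /fourier_coef e; split => //; rewrite s2 (bigD1 (Ordinal nd)) //= big1 ?addr0.
  by rewrite cintZ // cint_circ_orth eqxx mulr1.
by move=> p pn; rewrite cintZ // cint_circ_orth (_ : _ == _ = false) ?mulr0 //; apply/negbTE.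
Qed.

Lemma unimod_Re_Im (s z : C) : nsq s = 1 ->
  `|Re (s * z)| <= `|Re z| + `|Im z| /\ `|Im (s * z)| <= `|Re z| + `|Im z|.
Proof.
case: s z => [p q] [x y]; rewrite /nsq /= => h.
have one (r k : R) : r ^+ 2 + k ^+ 2 = 1 -> `|r| <= 1.
  move=> hr; rewrite -(@ler_pXn2r _ 2) ?nnegrE // real_normK ?num_real // expr1n -hr.
  by rewrite lerDl sqr_ge0.
have p1 := one p q h; have q1 : `|q| <= 1 by apply: (one q p); rewrite addrC.
have m (r k : R) : `|r| <= 1 -> `|r * k| <= `|k| by move=> hr; rewrite normrM ler_piMl.
split.
  by apply: le_trans (ler_normB _ _) _; apply: lerD; exact: m.
by apply: le_trans (ler_normD _ _) _; rewrite addrC; apply: lerD; exact: m.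
Qed.

Variables (f g : C -> B) (a b : nat -> B) (y : B).
Hypotheses (fa : L2conv f a) (gb : L2conv g b).
Let w z := bcomp (f z) (bcomp y (g z)).

Lemma product_wm : weakly_measurable w.
Proof.
by apply: wm_comp; [case: fa|apply: (wm_comp (f := fun=> y)); [exact: wm_cst|case: gb]].
Qed.

Lemma truncated_conv_trnorm d n : (trnorm (truncated_conv a b y d n) < +oo)%E.
Proof.
pose Bf p : B := if (p <= n)%N && (n - p < d)%N then bcomp y (b (n - p)%N) else 0.
have pE u : truncated_conv a b y d n u = \sum_(p < d) a p (Bf p u) by rewrite /truncated_conv bopsumE.
apply: (le_lt_trans (@trnorm_sum_le R d a Bf (fun=> 1) _ (fun=> ltr01) pE)).
apply: lte_sum_pinfty => p _; rewrite invr1 !mul1e.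
have [_ _ ha _] := fa; have [_ _ hb _] := gb.
apply: lte_add_pinfty; first exact: ha.
rewrite /Bf; case: ifP => _; last by rewrite hs2_0 ltry.
apply: le_lt_trans (hs2_comp_le _ _) _.
have [r r0 ->] := fin_ereal (hs2_ge0 (b (n - p)%N)) (hb _).
by rewrite -EFinM ltry.
Qed.

(** The approximating polynomials are the products of the partial sums. *)
Theorem product_H1S1 : H1S1 w.
Proof.
split; first exact: product_wm.
exists (fun j => op_poly (j + j) (truncated_conv a b y j)); split.
  by move=> j; exists (j + j)%N, (truncated_conv a b y j); split => // n; exact: truncated_conv_trnorm.
apply: cvge0_eps.
  by move=> j; apply: integral_ge0 => t _; exact: trnorm_ge0.
move=> e e0; have [N hN] := product_error y fa gb e0; exists N => j Nj.
have [r [_ _ re tr _]] := hN j Nj.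
apply: le_trans re; apply: le_integral_nonneg => t _; [exact: trnorm_ge0|exact: tr].
Qed.

Definition conv_coef n : B := \sum_(p < n.+1) bcomp (a p) (bcomp y (b (n - p)%N)).

Lemma truncated_conv_conv d n : (n < d)%N -> truncated_conv a b y d n = conv_coef n.
Proof.
move=> nd; rewrite /truncated_conv /conv_coef.
rewrite [RHS](big_ord_widen d (fun p => bcomp (a p) (bcomp y (b (n - p)%N))) nd) [RHS]big_mkcond /=.
apply: eq_bigr => p _; rewrite ltnS; have [pn|pn] := leqP p n => /=.
  by rewrite (leq_ltn_trans (leq_subr p n) nd).
by apply: val_inj; apply/funext => u /=; exact: bop0.
Qed.

(** As soon as [n < d], the coefficient of index [n] of the product of the partial sums of degree
    less than [d] is [conv_coef n], and these products converge in L^1 against every pair of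
    vectors. *)
Theorem product_fourier : has_fourier w conv_coef.
Proof.
move=> n u v; rewrite circle_intE.
set K := 2 * (rnorm u * rnorm v) + 1.
have K0 : 0 < K by rewrite ltr_wpDl // mulr_ge0 // mulr_ge0 ?rnorm_ge0.
pose P t := (circ t)^* ^+ n * innerp (w (circ t) u) v.
rewrite -/P; set J := cint _; set L := innerp _ _.
suff key (e : R) : 0 < e -> `|Re (J - L)| <= K * e /\ `|Im (J - L)| <= K * e.
  have z (x : R) : (forall e, 0 < e -> `|x| <= K * e) -> x = 0.
    move=> h; apply/eqP; rewrite -normr_le0; apply/ler_addgt0Pl => e e0.
    have := h (K^-1 * e); rewrite mulrA divff ?gt_eqF // mul1r addr0; apply.
    by rewrite mulr_gt0 // invr_gt0.
  apply/esym/eqP; rewrite -subr_eq0 eq_complex /=; apply/andP; split; apply/eqP; apply: z => e e0.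
    exact: (key e e0).1.
  exact: (key e e0).2.
move=> e0.
have [N hN] := product_error y fa gb e0.
pose d := maxn N n.+1.
have [r [mr r0 re _ rb]] := hN d (leq_maxl _ _).
have nd : (n < d)%N by rewrite leq_maxr.
pose c m := innerp (truncated_conv a b y d m u) v.
have oE t : innerp (op_poly (d + d) (truncated_conv a b y d) (circ t) u) v = trig_poly (d + d) c t.
  rewrite /op_poly bopsumE (semi_suml (@innerp_lin R E)); apply: eq_bigr => p _.
  by rewrite bopscaleE (semiZl (@innerp_lin R E)) mulrC.
have [i1 s1] := fourier_coef_trig_poly c (leq_trans nd (leq_addr d d)).
have cL : c n = L by rewrite /c truncated_conv_conv.
pose Q t := P t - (circ t)^* ^+ n * trig_poly (d + d) c t.
have QE t : Q t = (circ t)^* ^+ n * innerp ((w (circ t) - op_poly (d + d) (truncated_conv a b y d) (circ t) : B) u) v.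
  by rewrite bopsubE (semiBl (@innerp_lin R E)) oE mulrBr.
have mP : cmeas P by apply: cmeasM; [exact: cmeas_cconjX|exact: (wm_inner u v product_wm)].
have mQ : cmeas Q.
  by apply: cmeasB => //; apply: cmeasM; [exact: cmeas_cconjX|exact: cmeas_trig_poly].
have un t : nsq ((circ t)^* ^+ n : C) = 1 by rewrite -rmorphXn /= nsq_conj circX_nsq.
pose G t := (K%:E * r t)%E.
have mG : measurable_fun D G by exact: measurable_funeM.
have QR t : D t -> (`|Re (Q t)|%:E <= G t)%E.
  move=> _; apply: le_trans (rb t u v); rewrite lee_fin QE.
  exact: (unimod_Re_Im _ (un t)).1.
have QI t : D t -> (`|Im (Q t)|%:E <= G t)%E.
  move=> _; apply: le_trans (rb t u v); rewrite lee_fin QE.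
  exact: (unimod_Re_Im _ (un t)).2.
have iG : (\int[mu]_(t in D) G t <= (K * e)%:E)%E.
  rewrite /G (ge0_integralZl_EFin mu (@measurable_unit_itv R)) ?(ltW K0) //.
  by rewrite EFinM; apply: lee_wpmul2l => //; rewrite lee_fin ltW.
have iQ : cintg Q.
  by apply: (cintg_dom mQ mG QR QI); apply: le_lt_trans iG (ltry _).
have JL : J - L = cint Q.
  have PE t : P t = Q t + (circ t)^* ^+ n * trig_poly (d + d) c t by rewrite /Q subrK.
  rewrite /J (cint_ext (fun t _ => PE t)) cintD // -/(fourier_coef (trig_poly (d + d) c) n) s1 cL.
  by rewrite addrK.
rewrite JL; split.
  exact: (Rintegral_dom mQ.1 mG QR iG).
exact: (Rintegral_dom mQ.2 mG QI iG).
Qed.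

End HardyProductTheorem.

(** * Tensor products in coordinates indexed by pairs *)

Section PairIndexing.
Variable R : realType.
Local Notation C := R[i].
Local Notation E := (ell2 R).
Local Notation B := (bop E E).
Local Notation fst_ s := (nunpair s).1.
Local Notation snd_ s := (nunpair s).2.

(** A bound for both components of the pairs numbered below [S]. *)
Definition pair_rank S := \max_(s < S) (maxn (fst_ s) (snd_ s)).+1.

Lemma pair_sum (V : nmodType) (h : nat -> V) S N : (pair_rank S <= N)%N ->
  \sum_(s < S) h s =
  \sum_(p < N) \sum_(q < N) if (npair (p : nat, q : nat) < S)%N then h (npair (p : nat, q : nat)) else 0.
Proof.
move=> SN; rewrite pair_big /=.
have bnd (s : 'I_S) : ((fst_ s < N) /\ (snd_ s < N))%N.
  have : ((maxn (fst_ s) (snd_ s)).+1 <= N)%N.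
    by apply: leq_trans SN; exact: (@leq_bigmax _ (fun s : 'I_S => (maxn (fst_ s) (snd_ s)).+1)).
  by rewrite gtn_max => /andP[].
under [RHS]eq_bigr => pq _.
  rewrite -(@big_ord1_eq V 0 +%R h _ S) big_mkcond /=; over.
rewrite exchange_big /=; apply: eq_bigr => s _.
have [b1 b2] := bnd s.
rewrite (bigD1 (Ordinal b1, Ordinal b2)) //= big1 => [|[p q] pq].
  by rewrite -surjective_pairing nunpairK eqxx addr0.
case: eqP => // e; case/eqP: pq; move: e => /(congr1 nunpair); rewrite npairK => e.
by congr (_, _); apply: val_inj; rewrite /= e.
Qed.

Lemma pair_sum_le (f : nat -> nat -> R) S N : (pair_rank S <= N)%N -> (forall p q, 0 <= f p q) ->
  \sum_(s < S) f (fst_ s) (snd_ s) <= \sum_(p < N) \sum_(q < N) f p q.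
Proof.
move=> SN f0; rewrite (pair_sum (fun s => f (fst_ s) (snd_ s)) SN).
apply: ler_sum => p _; apply: ler_sum => q _.
by case: ifP => // _; rewrite npairK.
Qed.

(** The tensor product of the two matrices is the product of an amplification of each; the two
    bounds are applied in succession, one for each component of the indices. *)
Lemma mbound_tensor (M Y : nat -> nat -> C) (c d : R) : 0 <= c -> mbound M c -> mbound Y d ->
  mbound (fun s t => M (fst_ s) (fst_ t) * Y (snd_ s) (snd_ t)) (c * d).
Proof.
move=> c0 hM hY S T u.
pose N := maxn (pair_rank S) (pair_rank T).
have SN : (pair_rank S <= N)%N by exact: leq_maxl.
have TN : (pair_rank T <= N)%N by exact: leq_maxr.
(* The given vector, extended by 0 to a square of pairs. *)
pose v b n := if (npair (b, n) < T)%N then u (npair (b, n)) else 0.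
have hv : \sum_(t < T) nsq (u t) = \sum_(b < N) \sum_(n < N) nsq (v b n).
  rewrite (pair_sum (fun t => nsq (u t)) TN); apply: eq_bigr => b _; apply: eq_bigr => n _.
  by rewrite /v; case: ifP => // _; rewrite nsq0.
have ht a m : \sum_(t < T) M a (fst_ t) * Y m (snd_ t) * u t =
    \sum_(b < N) M a b * \sum_(n < N) Y m n * v b n.
  rewrite (pair_sum (fun t => M a (fst_ t) * Y m (snd_ t) * u t) TN).
  apply: eq_bigr => b _; rewrite mulr_sumr; apply: eq_bigr => n _.
  by rewrite /v; case: ifP => _; rewrite ?npairK ?mulr0 // mulrA.
apply: (@le_trans _ _ (\sum_(a < N) \sum_(m < N) nsq (\sum_(b < N) M a b * \sum_(n < N) Y m n * v b n))).
  apply: le_trans (pair_sum_le (f := fun a m => nsq (\sum_(b < N) M a b * \sum_(n < N) Y m n * v b n)) SN _).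
    by apply: ler_sum => s _; rewrite ht.
  by move=> a m; exact: nsq_ge0.
rewrite exchange_big /=.
apply: (@le_trans _ _ (\sum_(m < N) c * \sum_(b < N) nsq (\sum_(n < N) Y m n * v b n))).
  by apply: ler_sum => m _; exact: (hM N N (fun b => \sum_(n < N) Y m n * v b n)).
rewrite -mulr_sumr -mulrA ler_wpM2l // exchange_big hv mulr_sumr /=.
by apply: ler_sum => b _; exact: (hY N N (v b)).
Qed.

(** The space ell_2 is identified with ell_2 tensor ell_2 through the numbering of pairs; this is
    the embedding of ell_2 as the summand of index [b]. *)
Lemma embed_exists b : exists T : B, forall v s, T v s = if fst_ s == b then v (snd_ s) else 0.
Proof.
have h (v : E) : exists w : E, (forall s, w s = if fst_ s == b then v (snd_ s) else 0) /\ rnorm w ^+ 2 <= rnorm v ^+ 2.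
  apply: mk_ell2 => S; set N := pair_rank S.
  pose f p q := if p == b then nsq (v q) else 0 : R.
  apply: (@le_trans _ _ (\sum_(p < N) \sum_(q < N) f p q)).
    apply: le_trans (pair_sum_le (f := f) (leqnn _) _).
      by apply: ler_sum => s _; rewrite /f; case: ifP => _; rewrite ?nsq0.
    by move=> p q; rewrite /f; case: ifP => _; rewrite ?nsq_ge0.
  apply: (@le_trans _ _ (\sum_(p < N | (p : nat) == b) rnorm v ^+ 2)).
    rewrite [leRHS]big_mkcond; apply: ler_sum => p _; rewrite /f; case: ifP => _.
      exact: ell2_partial_sum.
    by rewrite big1.
  by rewrite (big_ord1_eq +%R (fun=> rnorm v ^+ 2) b N); case: ifP => _; rewrite ?sqr_ge0.
have [f hf] := choice h.
have fl : linear f.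
  move=> a u v; apply: ell2_eq => s; rewrite ell2_valD ell2_valZ !(hf _).1 ell2_valD ell2_valZ.
  by case: ifP => _; rewrite ?mulr0 ?addr0.
have fb u : rnorm (f u) ^+ 2 <= 1 ^+ 2 * rnorm u ^+ 2 by rewrite expr1n mul1r; exact: (hf u).2.
have [T [hT _]] := @mk_bop R E E f 1 ler01 fl fb.
by exists T => v s; rewrite hT (hf v).1.
Qed.

End PairIndexing.

(** * Tensoring a factorization with a matrix representation *)

Section Dilation.
Variable R : realType.
Local Notation C := R[i].
Local Notation E := (ell2 R).
Local Notation Bop := (bop E E).
Local Notation e_ := (ebasis R).
Local Notation fst_ s := (nunpair s).1.
Local Notation snd_ s := (nunpair s).2.
Variables (F : nat -> nat -> nat -> C) (al be : nat -> R).
Variables (A : nat -> nat -> C) (B : nat -> nat -> nat -> C) (D : nat -> nat -> C) (nb : nat -> nat -> nat).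
Hypothesis rep : matrix_rep F al be A B D nb.

(** [G], [Y] and [H] are the row, matrix and column of the representation tensored with [g], [y]
    and [h]. The scalar and operator parts of the product separate, and the scalar part is
    [F p k q]. *)
Lemma dilated_product (g y h G Y H : Bop) p k q :
  (forall s m, G (e_ s) m = A p (fst_ s) * g (e_ (snd_ s)) m) ->
  (forall s t, Y (e_ t) s = B k (fst_ s) (fst_ t) * y (e_ (snd_ t)) (snd_ s)) ->
  (forall l s, H (e_ l) s = D q (fst_ s) * h (e_ l) (snd_ s)) ->
  forall u, G (Y (H u)) = F p k q *: g (y (h u)).
Proof.
move=> hG hY hH.
have [io hio] := choice (@embed_exists R).
have io_e b n : io b (e_ n) = e_ (npair (b, n)).
  apply: ell2_eq => s; rewrite hio !ebasisE.
  have -> : (s == npair (b, n)) = (fst_ s == b) && (snd_ s == n).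
    apply/eqP/andP => [->|[/eqP <- /eqP <-]]; first by rewrite npairK.
    by rewrite -surjective_pairing nunpairK.
  by case: (fst_ s == b).
have io_sum n (c : nat -> C) (w : E) s :
    (\sum_(a < n) c a *: io a w) s = if (fst_ s < n)%N then c (fst_ s) * w (snd_ s) else 0.
  rewrite ell2_val_sum -(big_ord1_eq +%R (fun a => c a * w (snd_ s)) (fst_ s) n) [RHS]big_mkcond.
  by apply: eq_bigr => a _; rewrite ell2_valZ hio [in RHS]eq_sym; case: ifP => _; rewrite ?mulr0.
have Gio a v : G (io a v) = A p a *: g v.
  apply: (bop_ext (S := bcomp G (io a)) (T := A p a *: g)) => n.
  apply: ell2_eq => m; rewrite bopscaleE ell2_valZ.
  by rewrite -[LHS]/(G (io a (e_ n)) m) io_e hG npairK.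
have [_ _ _ [nzB nzD] FE] := rep.
have Yio b v : Y (io b v) = \sum_(a < nb k b) B k a b *: io a (y v).
  transitivity ((\sum_(a < nb k b) B k a b *: bcomp (io a) y : Bop) v); last first.
    by rewrite bopsumE; apply: eq_bigr => a _; rewrite bopscaleE.
  apply: (bop_ext (S := bcomp Y (io b))) => n; apply: ell2_eq => s.
  transitivity ((\sum_(a < nb k b) B k a b *: io a (y (e_ n))) s); last first.
    by rewrite bopsumE; congr (ell2_val _ s); apply: eq_bigr => a _; rewrite bopscaleE.
  rewrite (io_sum _ (fun a => B k a b)) -[LHS]/(Y (io b (e_ n)) s) io_e hY npairK.
  by case: ltnP => // /nzB ->; rewrite mul0r.
have Hd v : H v = \sum_(b < q.+1) D q b *: io b (h v).
  transitivity ((\sum_(b < q.+1) D q b *: bcomp (io b) h : Bop) v); last first.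
    by rewrite bopsumE; apply: eq_bigr => a _; rewrite bopscaleE.
  apply: bop_ext => l; apply: ell2_eq => s.
  transitivity ((\sum_(b < q.+1) D q b *: io b (h (e_ l))) s); last first.
    by rewrite bopsumE; congr (ell2_val _ s); apply: eq_bigr => a _; rewrite bopscaleE.
  rewrite (io_sum _ (D q)) hH.
  by case: ltnP => // /nzD ->; rewrite mul0r.
move=> u; rewrite Hd !bop_sum FE scaler_suml; apply: eq_bigr => b _.
rewrite !bopZ Yio bop_sum mulrC -scalerA; congr (_ *: _).
rewrite scaler_suml; apply: eq_bigr => a _.
by rewrite bopZ Gio scalerA mulrC.
Qed.

End Dilation.

(** * The tensored factors in H^2(S_2) *)

Section DilatedFactors.
Variable R : realType.
Local Notation C := R[i].
Local Notation mu := (@lebesgue_measure R).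
Local Notation D := (@unit_itv R).
Local Notation E := (ell2 R).
Local Notation Bop := (bop E E).
Local Notation e_ := (ebasis R).
Local Notation fst_ s := (nunpair s).1.
Local Notation snd_ s := (nunpair s).2.

Lemma nsq_scaled_esum (c : C) (v : E) :
  (\sum_(0 <= m <oo) (nsq (c * v m))%:E = (nsq c * rnorm v ^+ 2)%:E)%E.
Proof.
rewrite -rnormZ -ell2_esum; apply: eq_eseriesr => m _.
by rewrite ell2_valZ.
Qed.

Lemma pair_series_le (P Q : nat -> R) (a : R) : 0 <= a -> (forall p, 0 <= P p) -> (forall q, 0 <= Q q) ->
  (forall n, \sum_(p < n) P p <= a) ->
  (\sum_(0 <= s <oo) (P (fst_ s) * Q (snd_ s))%:E <= a%:E * \sum_(0 <= q <oo) (Q q)%:E)%E.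
Proof.
move=> a0 P0 Q0 Pa.
apply: nneseries_le => [s|S]; first by rewrite lee_fin mulr_ge0.
rewrite sumEFin; set N := pair_rank S.
apply: (@le_trans _ _ (a * \sum_(q < N) Q q)%:E); last first.
  rewrite EFinM -sumEFin; apply: lee_wpmul2l; rewrite ?lee_fin //.
  by apply: (nneseries_partial (f := fun q => (Q q)%:E)) => q; rewrite lee_fin.
rewrite lee_fin.
apply: le_trans (pair_sum_le (f := fun p q => P p * Q q) (leqnn N) _) _.
  by move=> p q; rewrite mulr_ge0.
under eq_bigr do rewrite -mulr_sumr.
by rewrite -mulr_suml ler_wpM2r // sumr_ge0.
Qed.

(** The coefficients are the rows [A p] tensored with those of [g], and have Hilbert-Schmidt norm
    at most [a] times larger. *)
Lemma left_factor (A : nat -> nat -> C) (a : R) (g : C -> Bop) (gc : nat -> Bop) :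
  (forall p n, \sum_(l < n) nsq (A p l) <= a ^+ 2) ->
  (H2sq g < +oo)%E -> (\sum_(0 <= p <oo) hs2 (gc p) <= H2sq g)%E ->
  exists G Gc, [/\ L2conv G Gc,
    forall p s m, Gc p (e_ s) m = A p (fst_ s) * gc p (e_ (snd_ s)) m &
    (H2sq G <= (a ^+ 2)%:E * H2sq g)%E].
Proof.
move=> hA gf hg.
have [r r0 rE] := fin_ereal (H2sq_ge0 g) gf.
apply: (operator_riesz_fischer (G := fun p m s => A p (fst_ s) * gc p (e_ (snd_ s)) m)).
  by rewrite rE -EFinM ltry.
apply: (@le_trans _ _ ((a ^+ 2)%:E * \sum_(0 <= p <oo) hs2 (gc p))%E); last first.
  by apply: lee_wpmul2l => //; rewrite lee_fin sqr_ge0.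
rewrite -nneseriesZl; last by move=> p _; exact: hs2_ge0.
apply: lee_nneseries => [p _ _|p _].
  by apply: double_esum_ge0 => n m; rewrite lee_fin nsq_ge0.
rewrite /double_esum; under eq_eseriesr do rewrite nsq_scaled_esum.
apply: (pair_series_le (P := fun l => nsq (A p l)) (Q := fun n => rnorm (gc p (e_ n)) ^+ 2)).
- exact: sqr_ge0.
- by move=> l; exact: nsq_ge0.
- by move=> n; exact: sqr_ge0.
- exact: hA.
Qed.

(** The analogue of [left_factor] for columns. *)
Lemma right_factor (D' : nat -> nat -> C) (b : R) (h : C -> Bop) (hc : nat -> Bop) :
  (forall q n, \sum_(l < n) nsq (D' q l) <= b ^+ 2) ->
  (H2sq h < +oo)%E -> (\sum_(0 <= q <oo) hs2 (hc q) <= H2sq h)%E ->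
  exists H Hc, [/\ L2conv H Hc,
    forall q l s, Hc q (e_ l) s = D' q (fst_ s) * hc q (e_ l) (snd_ s) &
    (H2sq H <= (b ^+ 2)%:E * H2sq h)%E].
Proof.
move=> hD hf hh.
have [r r0 rE] := fin_ereal (H2sq_ge0 h) hf.
apply: (operator_riesz_fischer (G := fun q s l => D' q (fst_ s) * hc q (e_ l) (snd_ s))).
  by rewrite rE -EFinM ltry.
apply: (@le_trans _ _ ((b ^+ 2)%:E * \sum_(0 <= q <oo) hs2 (hc q))%E); last first.
  by apply: lee_wpmul2l => //; rewrite lee_fin sqr_ge0.
rewrite -nneseriesZl; last by move=> q _; exact: hs2_ge0.
apply: lee_nneseries => [q _ _|q _].
  by apply: double_esum_ge0 => l s; rewrite lee_fin nsq_ge0.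
rewrite /hs2 -nneseriesZl; last by move=> l _; rewrite lee_fin sqr_ge0.
apply: lee_nneseries => [l _ _|l _].
  by apply: nneseries_ge0 => s _ _; rewrite lee_fin nsq_ge0.
rewrite -ell2_esum; under eq_eseriesr do rewrite nsqM.
apply: (pair_series_le (P := fun b => nsq (D' q b)) (Q := fun n => nsq (hc q (e_ l) n))).
- exact: sqr_ge0.
- by move=> n; exact: nsq_ge0.
- by move=> n; exact: nsq_ge0.
- exact: hD.
Qed.

Lemma middle_factor (B : nat -> nat -> C) (y : Bop) : mbound B 1 ->
  exists Y : Bop, (forall s t, Y (e_ t) s = B (fst_ s) (fst_ t) * y (e_ (snd_ t)) (snd_ s)) /\
    opnorm Y <= opnorm y.
Proof.
move=> hB; apply: mx_bop; first exact: opnorm_ge0.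
have := mbound_tensor ler01 hB (bop_mbound y).
by rewrite mul1r.
Qed.

Lemma ae_mono (P Q : R -> Prop) : (forall t, P t -> Q t) -> {ae mu, forall t, P t} -> {ae mu, forall t, Q t}.
Proof. by move=> h; apply: (@filterS _ _ (ae_filter_ringOfSetsType mu)). Qed.

Lemma cint_ae (P Q : R -> C) : cmeas P -> cmeas Q -> {ae mu, forall t, D t -> P t = Q t} -> cint P = cint Q.
Proof.
move=> [p1 p2] [q1 q2] PQ; rewrite /cint /Rintegral.
have key (u v : R -> R) : measurable_fun D u -> measurable_fun D v ->
    {ae mu, forall t, D t -> u t = v t} ->
    (\int[mu]_(t in D) (u t)%:E = \int[mu]_(t in D) (v t)%:E)%E.
  move=> mu_ mv uv; apply: (@ae_eq_integral _ _ _ mu D (EFin \o v) (EFin \o u)).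
  - exact: measurable_unit_itv.
  - exact/measurable_EFinP.
  - exact/measurable_EFinP.
  - by apply: (@ae_mono (fun t => D t -> u t = v t)) uv => t h Dt /=; rewrite h.
by congr ((fine _) +i* (fine _))%C; apply: key => //; apply: (@ae_mono (fun t => D t -> P t = Q t)) PQ => t h Dt; rewrite h.
Qed.

Lemma H2sq0_ae (f : C -> Bop) : weakly_measurable f -> H2sq f = 0%E ->
  {ae mu, forall t, D t -> forall u, f (circ t) u = 0}.
Proof.
move=> hf f0.
have mf := measurable_hs2 hf.
have : (\int[mu]_(t in D) `|hs2 (f (circ t))|)%E = 0%E.
  by rewrite -f0; apply: eq_integral => t _; rewrite gee0_abs // hs2_ge0.
move/(ae_eq_integral_abs mu (@measurable_unit_itv R) mf).
apply: ae_mono => t h Dt u; apply: rnorm_eq0; apply/eqP.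
rewrite -sqrf_eq0 eq_le sqr_ge0 andbT -(mul0r (rnorm u ^+ 2)).
by apply: hs2_bound; rewrite h.
Qed.

Lemma L2conv0 : L2conv (fun=> 0 : Bop) (fun=> 0).
Proof.
have z : H2sq (fun=> 0 : Bop) = 0%E.
  by rewrite /H2sq; under eq_integral do rewrite hs2_0; exact: integral0.
split=> [||p|e e0]; rewrite ?z ?hs2_0 ?ltry //.
exists 0%N => d _.
rewrite (_ : (fun z => _) = (fun=> 0 : Bop)) ?z ?lee_fin ?ltW //.
by apply/funext => x; rewrite /op_poly big1 ?subr0 // => i _; rewrite scaler0.
Qed.

End DilatedFactors.

(** * The multiplier norm is at most the norm of M_3 *)

Section UpperBound.
Variable R : realType.
Local Notation C := R[i].
Local Notation mu := (@lebesgue_measure R).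
Local Notation D := (@unit_itv R).
Local Notation E := (ell2 R).
Local Notation Bop := (bop E E).

Lemma triple_product_finite (x y z : \bar R) (c : R) : (0 <= x)%E -> (0 <= y)%E -> (0 <= z)%E ->
  (x * y * z < c%:E)%E ->
  [/\ (x < +oo)%E, (y < +oo)%E & (z < +oo)%E] \/ [\/ x = 0%E, y = 0%E | z = 0%E].
Proof.
move=> x0 y0 z0 lt.
have [->|xn] := eqVneq x 0%E; first by right; constructor 1.
have [->|yn] := eqVneq y 0%E; first by right; constructor 2.
have [->|zn] := eqVneq z 0%E; first by right; constructor 3.
have xp : (0 < x)%E by rewrite lt0e xn.
have yp : (0 < y)%E by rewrite lt0e yn.
have zp : (0 < z)%E by rewrite lt0e zn.
left; split; rewrite ltey; apply: contraTneq lt => ->.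
- by rewrite gt0_mulye // gt0_mulye // -leNgt leey.
- by rewrite gt0_muley // gt0_mulye // -leNgt leey.
- by rewrite gt0_muley ?mule_gt0 // -leNgt leey.
Qed.

Lemma bop_eq (S T : Bop) : (forall u, S u = T u) -> S = T.
Proof. by move=> h; apply: val_inj; apply/funext. Qed.

Lemma opnorm0 (T : Bop) u : opnorm T <= 0 -> T u = 0.
Proof.
move=> T0; apply: rnorm_eq0; apply/eqP; rewrite eq_le rnorm_ge0 andbT.
by apply: le_trans (opnorm_ub T u) _; rewrite mulr_le0_ge0 ?rnorm_ge0.
Qed.

(** An infinite norm is compatible with a finite product only if another factor is 0. Then all the
    [x k] vanish almost everywhere, and zero factors serve. *)
Lemma finite_factorization (x : nat -> C -> Bop) (c : R) : 0 < c -> facnorm_lt x c ->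
  exists g y h, [/\ H2S2 g, H2S2 h, factorization x g y h &
    exists rg rh s : R, [/\ [/\ 0 <= rg, 0 <= rh & 0 <= s],
      H2sq g = rg%:E, H2sq h = rh%:E, (forall k, opnorm (y k) <= s) &
      Num.sqrt rg * s * Num.sqrt rh < c]].
Proof.
move=> c0 [g [y [h [hg hh fac lt]]]].
have n0 (f : C -> Bop) : (0 <= H2norm f)%E by rewrite H2normE sqrte_ge0.
have sq (f : C -> Bop) : (H2norm f < +oo)%E -> exists2 r, 0 <= r & H2sq f = r%:E.
  move=> hf; apply: fin_ereal; first exact: H2sq_ge0.
  by move: hf; rewrite H2normE; case: (H2sq f) => //= r _; rewrite ltry.
have [[f1 f2 f3]|zero] := triple_product_finite (n0 g) (supnorm_ge0 y) (n0 h) lt.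
  exists g, y, h; split => //.
  have [rg g0 gE] := sq _ f1; have [rh h0 hE] := sq _ f3.
  have [s s0 sE] := fin_ereal (supnorm_ge0 y) f2.
  exists rg, rh, s; split => //.
    by move=> k; rewrite -lee_fin -sE; exact: supnorm_ub.
  by move: lt; rewrite !H2normE gE hE sE /= -!EFinM lte_fin.
exists (fun=> 0), (fun=> 0), (fun=> 0); split.
- exact: L2conv_H2S2 (@L2conv0 R).
- exact: L2conv_H2S2 (@L2conv0 R).
- have x0 k : {ae mu, forall t, D t -> forall u, x k (circ t) u = 0}.
    have gw : weakly_measurable g by case: hg.
    have hw : weakly_measurable h by case: hh.
    case: zero => [z|z|z].
    + have gz : H2sq g = 0%E by rewrite -H2norm_sqr z expe2 mul0e.
      have ag := H2sq0_ae gw gz; have af := fac k.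
      apply: (@ae_mono R (fun t => (D t -> forall u, g (circ t) u = 0) /\
        (D t -> forall u, x k (circ t) u = g (circ t) (y k (h (circ t) u))))).
        by move=> t [h1 h2] Dt u; rewrite h2 // h1.
      exact: (@filterI _ _ (ae_filter_ringOfSetsType mu)).
    + apply: (ae_mono _ (fac k)) => t h2 Dt u; rewrite h2 //.
      have : ((opnorm (y k))%:E <= 0)%E by rewrite -z; exact: supnorm_ub.
      by rewrite lee_fin => yk; rewrite (opnorm0 _ yk) bop0.
    + have hz : H2sq h = 0%E by rewrite -H2norm_sqr z expe2 mul0e.
      have ah := H2sq0_ae hw hz; have af := fac k.
      apply: (@ae_mono R (fun t => (D t -> forall u, h (circ t) u = 0) /\
        (D t -> forall u, x k (circ t) u = g (circ t) (y k (h (circ t) u))))).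
        by move=> t [h1 h2] Dt u; rewrite h2 // h1 // !bop0.
      exact: (@filterI _ _ (ae_filter_ringOfSetsType mu)).
  by move=> k; apply: ae_mono (x0 k) => t h1 Dt u; rewrite h1.
- have z : H2sq (fun=> 0 : Bop) = 0%E.
    by rewrite /H2sq; under eq_integral do rewrite hs2_0; exact: integral0.
  exists 0, 0, 0; split=> [|||k|]; rewrite ?z //; last by rewrite mulr0 mul0r.
  apply: opnorm_le => // u.
  by rewrite (_ : (0 : Bop) u = 0) // rnorm0 mul0r.
Qed.

Lemma H2norm_ub (f : C -> Bop) (a : R) : 0 <= a -> (H2sq f <= (a ^+ 2)%:E)%E -> (H2norm f <= a%:E)%E.
Proof.
move=> a0; rewrite H2normE; have := H2sq_ge0 f.
case: (H2sq f) => [s| |] //; rewrite !lee_fin => s0 sr.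
have -> : a = Num.sqrt (a ^+ 2) by rewrite sqrtr_sqr ger0_norm.
by rewrite ler_sqrt // sqr_ge0.
Qed.

Lemma H2norm_le (f g : C -> Bop) (a r : R) : 0 <= a -> 0 <= r -> H2sq g = r%:E ->
  (H2sq f <= (a ^+ 2)%:E * H2sq g)%E -> (H2norm f <= (a * Num.sqrt r)%:E)%E.
Proof.
move=> a0 r0 -> h; apply: H2norm_ub; first by rewrite mulr_ge0 ?sqrtr_ge0.
by rewrite exprMn sqr_sqrtr.
Qed.

Lemma has_fourier_ae (x w : C -> Bop) a : weakly_measurable x -> weakly_measurable w ->
  {ae mu, forall t, D t -> forall u, x (circ t) u = w (circ t) u} ->
  has_fourier w a -> has_fourier x a.
Proof.
move=> mx mw ae hw n u v; rewrite (hw n u v) !circle_intE.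
apply: cint_ae.
- by apply: cmeasM; [exact: cmeas_cconjX|exact: wm_inner].
- by apply: cmeasM; [exact: cmeas_cconjX|exact: wm_inner].
- by apply: ae_mono ae => t h Dt; rewrite h.
Qed.

(** Tensor [g], the [y k] and [h] with a matrix representation of [phi]. The coefficient of index
    [n] of the new product is the sum of the g_p y_k h_q with p + q = n, each multiplied by
    phi(p + k + q), and this factor does not depend on [p]. *)
Theorem multiplier_bound phi (x : nat -> C -> Bop) (c : R) : (M3_norm phi < c%:E)%E ->
  (forall k, H1S1 (x k)) -> facnorm_lt x 1 ->
  exists2 w, is_mult phi x w & facnorm_lt w c.
Proof.
move=> /M3_norm_lt_kernel[a [b [a0 b0 abc /kernel_rep_matrix[A [B [D' [nb rep]]]]]]] hx.
move=> /(finite_factorization ltr01)[g [y [h [hg hh fac [rg [rh [s [[g0 h0 s0] gE hE ys lt]]]]]]]].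
have gf : (H2sq g < +oo)%E by rewrite gE ltry.
have hf : (H2sq h < +oo)%E by rewrite hE ltry.
have [gc [gL gS]] := H2S2_coefficients hg gf.
have [hc [hL hS]] := H2S2_coefficients hh hf.
have [hA hB hD _ _] := rep.
have [G [Gc [GL Ge Gn]]] := left_factor (hA : forall p n, _) gf gS.
have [H [Hc [HL He Hn]]] := right_factor (hD : forall p n, _) hf hS.
have [Y hY] := choice (fun k => middle_factor (y k) (hB k)).
pose w k z := bcomp (G z) (bcomp (Y k) (H z)).
pose x' k z := bcomp (g z) (bcomp (y k) (h z)).
exists w.
  move=> k; split; first exact: (product_H1S1 (Y k) GL HL).
  exists (conv_coef gc hc (y k)).
    apply: (@has_fourier_ae _ (x' k)).
    - by case: (hx k).
    - by case: (product_H1S1 (y k) gL hL).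
    - by apply: ae_mono (fac k) => t h1 Dt u; rewrite h1.
    - exact: (product_fourier (y k) gL hL).
  have -> : (fun n => phi (n + k)%N *: conv_coef gc hc (y k) n) = conv_coef Gc Hc (Y k).
    apply/funext => n; apply: bop_eq => u.
    rewrite bopscaleE /conv_coef !bopsumE scaler_sumr.
    apply: eq_bigr => p _.
    rewrite -[RHS]/(Gc p (Y k (Hc (n - p)%N u))).
    rewrite (dilated_product rep (Ge p) (hY k).1 (He _)).
    by rewrite addnAC subnKC // -ltnS.
  exact: (product_fourier (Y k) GL HL).
exists G, Y, H; split.
- exact: L2conv_H2S2 GL.
- exact: L2conv_H2S2 HL.
- by move=> k; apply: aeW => t Dt u.
have n0 (f : C -> Bop) : (0 <= H2norm f)%E by rewrite H2normE sqrte_ge0.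
have Gle := H2norm_le a0 g0 gE Gn; have Hle := H2norm_le b0 h0 hE Hn.
have Yle : (supnorm Y <= s%:E)%E by apply: supnorm_le => k; exact: le_trans (hY k).2 (ys k).
apply: (@le_lt_trans _ _ (((a * Num.sqrt rg)%:E * s%:E) * (b * Num.sqrt rh)%:E)%E).
  apply: lee_pmul => //; first by apply: mule_ge0; rewrite ?n0 ?supnorm_ge0.
  by apply: lee_pmul; rewrite ?n0 ?supnorm_ge0.
rewrite -!EFinM lte_fin; apply: le_lt_trans abc.
have -> : a * Num.sqrt rg * s * (b * Num.sqrt rh) = a * b * (Num.sqrt rg * s * Num.sqrt rh) by ring.
by rewrite ler_piMr ?mulr_ge0 // ltW.
Qed.

Corollary calM3_norm_le phi (c : R) : (M3_norm phi < c%:E)%E -> (calM3_norm phi <= c%:E)%E.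
Proof.
move=> hc; apply: ge_ereal_sup => _ [x [hx fx] <-].
have [w mw fw] := multiplier_bound hc hx fx.
apply: (@le_trans _ _ (facnorm w)); first by apply: ereal_inf_lbound; exists w.
by apply: ereal_inf_lbound; exists c.
Qed.

End UpperBound.

(** * Gram kernels of square-integrable vector functions *)

Section VectorFunctions.
Variable R : realType.
Local Notation C := R[i].
Local Notation Re := (@complex.Re R).
Local Notation mu := (@lebesgue_measure R).
Local Notation D := (@unit_itv R).
Local Notation E := (ell2 R).
Local Notation Bop := (bop E E).
Local Notation e_ := (ebasis R).
Implicit Types (U V : R -> E).

Definition vec_L2sq V : \bar R := (\int[mu]_(t in D) (rnorm (V t) ^+ 2)%:E)%E.
Definition vec_L2 V := (forall m, cmeas (fun t => V t m)) /\ (vec_L2sq V < +oo)%E.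

Lemma vec_L2sq_ge0 V : (0 <= vec_L2sq V)%E.
Proof. by apply: integral_ge0 => t _; rewrite lee_fin sqr_ge0. Qed.

Lemma measurable_rnorm2 V : (forall m, cmeas (fun t => V t m)) ->
  measurable_fun D (fun t => (rnorm (V t) ^+ 2)%:E).
Proof.
move=> mV; apply: (eq_measurable_fun (fun t => \sum_(0 <= m <oo) (nsq (V t m))%:E)%E).
  by move=> t _; rewrite ell2_esum.
apply: (ge0_emeasurable_sum (h := fun m t => (nsq (V t m))%:E)) => [m t Dt _|m _].
  by rewrite lee_fin nsq_ge0.
exact: measurable_nsqE.
Qed.

Lemma two_Re_le (z : C) (a b : R) : 0 <= a -> 0 <= b -> nsq z <= a * b -> 2 * Re z <= a + b.
Proof.
move=> a0 b0 h; have [z0|z0] := lerP (Re z) 0.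
  by apply: (@le_trans _ _ 0); [rewrite pmulr_rle0|exact: addr_ge0].
rewrite -(@ler_pXn2r _ 2) ?nnegrE ?addr_ge0 ?mulr_ge0 ?(ltW z0) //.
have zz : Re z ^+ 2 <= a * b by apply: le_trans h; rewrite /nsq lerDl sqr_ge0.
have -> : (2 * Re z) ^+ 2 = 4 * Re z ^+ 2 by ring.
have -> : (a + b) ^+ 2 = (a - b) ^+ 2 + 4 * (a * b) by ring.
have := sqr_ge0 (a - b); lra.
Qed.

Lemma cmeas_innerp U V : (forall m, cmeas (fun t => U t m)) -> (forall m, cmeas (fun t => V t m)) ->
  cmeas (fun t => innerp (U t) (V t)).
Proof.
move=> mU mV.
apply: (@cmeas_cvg _ (fun N t => \sum_(m < N) U t m * (V t m)^*)) => [N|t _]; last exact: innerp_cvg.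
apply: (@cmeas_sum R N (fun m t => U t m * (V t m)^*)) => m.
by apply: cmeasM => //; apply: cmeas_conj.
Qed.

Lemma vec_L2_inner U V : vec_L2 U -> vec_L2 V -> cintg (fun t => innerp (U t) (V t)).
Proof.
move=> [mU fU] [mV fV].
have [u u0 uE] := fin_ereal (vec_L2sq_ge0 U) fU; have [v v0 vE] := fin_ereal (vec_L2sq_ge0 V) fV.
have [] // := @cint_CS R (fun t => innerp (U t) (V t)) (fun t => (rnorm (U t) ^+ 2)%:E)
  (fun t => (rnorm (V t) ^+ 2)%:E) u v (cmeas_innerp mU mV) (measurable_rnorm2 mU) (measurable_rnorm2 mV).
- by move=> t _; rewrite lee_fin sqr_ge0.
- by move=> t _; rewrite lee_fin sqr_ge0.
- move=> t c _; rewrite -EFinM -EFinD lee_fin; apply: two_Re_le; [by rewrite mulr_ge0 ?sqr_ge0 ?nsq_ge0|exact: sqr_ge0|].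
  by rewrite nsqM -mulrA ler_wpM2l ?nsq_ge0 // innerp_CS.
- by rewrite -/(vec_L2sq U) uE.
- by rewrite -/(vec_L2sq V) vE.
Qed.

Lemma Re_cintE (P : R -> C) : cintg P -> (Re (cint P))%:E = (\int[mu]_(t in D) (Re (P t))%:E)%E.
Proof.
move=> [h _]; rewrite /= /Rintegral fineK //.
by apply: integrable_fin_num => //; exact: measurable_unit_itv.
Qed.

Lemma cint_rnorm2 V : vec_L2 V -> (Re (cint (fun t => innerp (V t) (V t))))%:E = vec_L2sq V.
Proof.
move=> hV; rewrite (Re_cintE (vec_L2_inner hV hV)).
by apply: eq_integral => t _; rewrite -rnorm_innerp.
Qed.

(** The Gram kernel in the L^2 space of ell_2-valued functions. *)
Definition kgram (U : nat -> R -> E) (p q : nat) : C := cint (fun t => innerp (U p t) (U q t)).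

Section Gram.
Variable U : nat -> R -> E.
Hypothesis hU : forall p, vec_L2 (U p).

(** The integral of the squared norm of a combination, expanded. *)
Lemma kgram_sum S (c : nat -> C) :
  vec_L2 (fun t => \sum_(s < S) c s *: U s t) /\
  (kform (kgram U) S c)%:E = vec_L2sq (fun t => \sum_(s < S) c s *: U s t).
Proof.
pose W t := \sum_(s < S) c s *: U s t.
have mW m : cmeas (fun t => W t m).
  apply: (cmeas_ext (P := fun t => \sum_(s < S) c s * U s t m)) => [t _|].
    by rewrite ell2_val_sum; apply: eq_bigr => s _; rewrite ell2_valZ.
  by apply: (@cmeas_sum R S (fun s t => c s * U s t m)) => s; apply: cmeasZ; case: (hU s).
have in_ s s' : cintg (fun t => c s * (c s')^* * innerp (U s t) (U s' t)).
  by apply: cintgZ; exact: vec_L2_inner.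
have in2 s : cintg (fun t => \sum_(s' < S) c s * (c s')^* * innerp (U s t) (U s' t)) /\
    cint (fun t => \sum_(s' < S) c s * (c s')^* * innerp (U s t) (U s' t)) =
    \sum_(s' < S) c s * (c s')^* * kgram U s s'.
  have [h1 h2] := cintg_sum (n := S) (F := fun s' t => c s * (c s')^* * innerp (U s t) (U s' t)) (fun s' _ => in_ s s').
  split=> //; rewrite h2; apply: eq_bigr => s' _.
  by rewrite cintZ //; exact: vec_L2_inner.
have [i1 i2] := cintg_sum (n := S)
  (F := fun s t => \sum_(s' < S) c s * (c s')^* * innerp (U s t) (U s' t)) (fun s _ => (in2 s).1).
have WE t : innerp (W t) (W t) = \sum_(s < S) \sum_(s' < S) c s * (c s')^* * innerp (U s t) (U s' t).
  rewrite /W (semi_suml (@innerp_lin R E)); apply: eq_bigr => s _.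
  rewrite (semi_sumr (@innerp_lin R E) (@innerp_conj R E)); apply: eq_bigr => s' _.
  by rewrite (semiZl (@innerp_lin R E)) (semiZr (@innerp_lin R E) (@innerp_conj R E)) mulrA.
have iW : cintg (fun t => innerp (W t) (W t)).
  by rewrite (_ : (fun t => _) = (fun t => \sum_(s < S) \sum_(s' < S) c s * (c s')^* * innerp (U s t) (U s' t))) //;
    apply/funext => t; exact: WE.
have e : (kform (kgram U) S c)%:E = vec_L2sq W.
  have -> : kform (kgram U) S c = Re (cint (fun t => innerp (W t) (W t))).
    rewrite (cint_ext (fun t _ => WE t)) i2 /kform; congr Re.
    by apply: eq_bigr => s _; rewrite (in2 s).2.
  rewrite (Re_cintE iW).
  by apply: eq_integral => t _; rewrite -rnorm_innerp.
by split=> //; split=> //; rewrite -e ltry.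
Qed.

Lemma psd_kgram : psd_kernel (kgram U).
Proof.
split=> [p q|S c]; last by rewrite -lee_fin (kgram_sum S c).2 vec_L2sq_ge0.
rewrite /kgram -cint_conj; last exact: vec_L2_inner.
by apply: cint_ext => t _; rewrite -innerp_conj.
Qed.

Lemma kgram_diag p : (Re (kgram U p p))%:E = vec_L2sq (U p).
Proof. exact: cint_rnorm2. Qed.

End Gram.

Lemma vec_L2sq_bop (T : Bop) V : vec_L2 V -> vec_L2 (fun t => T (V t)) /\
  (vec_L2sq (fun t => T (V t)) <= (opnorm T ^+ 2)%:E * vec_L2sq V)%E.
Proof.
move=> [mV fV].
have b : (vec_L2sq (fun t => T (V t)) <= (opnorm T ^+ 2)%:E * vec_L2sq V)%E.
  apply: (@le_trans _ _ (\int[mu]_(t in D) ((opnorm T ^+ 2)%:E * (rnorm (V t) ^+ 2)%:E))%E).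
    apply: le_integral_nonneg => t _; first by rewrite lee_fin sqr_ge0.
    by rewrite -EFinM lee_fin; exact: opnorm_sqr.
  rewrite (ge0_integralZl_EFin mu (@measurable_unit_itv R)) ?sqr_ge0 //.
    by move=> t _; rewrite lee_fin sqr_ge0.
  exact: measurable_rnorm2.
split=> //; split=> [m|].
  apply: (@cmeas_cvg _ (fun N t => \sum_(n < N) V t n * T (e_ n) m)) => [N|t _]; last exact: bop_etrunc_cvg.
  apply: (@cmeas_sum R N (fun n t => V t n * T (e_ n) m)) => n.
  by apply: cmeasM => //; exact: cmeas_cst.
apply: le_lt_trans b _; have [v v0 ->] := fin_ereal (vec_L2sq_ge0 V) fV.
by rewrite -EFinM ltry.
Qed.

Lemma vec_L2sq_scale (f : R -> C) (M : R) V : 0 <= M -> cmeas f -> (forall t, nsq (f t) = M) -> vec_L2 V ->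
  vec_L2 (fun t => f t *: V t) /\ vec_L2sq (fun t => f t *: V t) = (M%:E * vec_L2sq V)%E.
Proof.
move=> M0 mf fM [mV fV].
have e : vec_L2sq (fun t => f t *: V t) = (M%:E * vec_L2sq V)%E.
  rewrite -(ge0_integralZl_EFin mu (@measurable_unit_itv R)) //; last 2 first.
  - by move=> t _; rewrite lee_fin sqr_ge0.
  - exact: measurable_rnorm2.
  by apply: eq_integral => t _; rewrite rnormZ fM EFinM.
split=> //; split=> [m|]; last first.
  by rewrite e; have [v v0 ->] := fin_ereal (vec_L2sq_ge0 V) fV; rewrite -EFinM ltry.
by apply: (cmeas_ext (P := fun t => f t * V t m)) => [t _|]; [rewrite ell2_valZ|exact: cmeasM].
Qed.

Lemma vec_L2sq_column (H : C -> Bop) j : weakly_measurable H -> (H2sq H < +oo)%E ->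
  vec_L2 (fun t => H (circ t) (e_ j)).
Proof.
move=> mH fH; split=> [m|]; first exact: wm_coord.
apply: le_lt_trans fH; apply: le_integral_nonneg => t _; first by rewrite lee_fin sqr_ge0.
by apply: (nneseries_term (a := fun n => (rnorm (H (circ t) (e_ n)) ^+ 2)%:E)) => n; rewrite lee_fin sqr_ge0.
Qed.

Lemma vec_L2sq_columns (H : C -> Bop) N : weakly_measurable H ->
  (\sum_(j < N) vec_L2sq (fun t => H (circ t) (e_ j)) <= H2sq H)%E.
Proof.
move=> mH.
apply: (@le_trans _ _ (\int[mu]_(t in D) \sum_(j < N) (rnorm (H (circ t) (e_ j)) ^+ 2)%:E)%E).
  rewrite (ge0_integral_sum mu (@measurable_unit_itv R)
    (f := fun (j : 'I_N) t => (rnorm (H (circ t) (e_ j)) ^+ 2)%:E)) //.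
    by move=> j; apply: measurable_rnorm2 => m; exact: wm_coord.
  by move=> j t _; rewrite lee_fin sqr_ge0.
apply: le_integral_nonneg => t _.
  by apply: sume_ge0 => j _; rewrite lee_fin sqr_ge0.
by apply: (nneseries_partial (f := fun j => (rnorm (H (circ t) (e_ j)) ^+ 2)%:E)) => j; rewrite lee_fin sqr_ge0.
Qed.

Section Rows.
Variable G : C -> Bop.
Hypothesis mG : weakly_measurable G.

(** The squared norm of row [i] of [G]. *)
Definition rowsq i (t : R) : \bar R := (\sum_(0 <= m <oo) (nsq (G (circ t) (e_ m) i))%:E)%E.

Lemma rowsq_ge0 i t : (0 <= rowsq i t)%E.
Proof. by apply: nneseries_ge0 => m _ _; rewrite lee_fin nsq_ge0. Qed.

Lemma measurable_rowsq i : measurable_fun D (rowsq i).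
Proof.
apply: (ge0_emeasurable_sum (h := fun m t => (nsq (G (circ t) (e_ m) i))%:E)) => [m t Dt _|m _].
  by rewrite lee_fin nsq_ge0.
by apply: measurable_nsqE; exact: wm_coord.
Qed.

(** The rows and the columns of a matrix have the same total of squares. *)
Lemma rows_le N : (\sum_(i < N) \int[mu]_(t in D) rowsq i t <= H2sq G)%E.
Proof.
apply: (@le_trans _ _ (\int[mu]_(t in D) \sum_(i < N) rowsq i t)%E).
  rewrite (ge0_integral_sum mu (@measurable_unit_itv R) (f := fun (i : 'I_N) t => rowsq i t)) //.
    by move=> i; exact: measurable_rowsq.
  by move=> i t _; exact: rowsq_ge0.
apply: le_integral_nonneg => t _; first by apply: sume_ge0 => i _; exact: rowsq_ge0.
rewrite hs2_double_esum /double_esum (@nneseries_interchange R (fun n m => (nsq (G (circ t) (e_ n) m))%:E) xpredT xpredT); last first.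
  by move=> n m; rewrite lee_fin nsq_ge0.
by apply: (nneseries_partial (f := fun i => rowsq i t)) => i; exact: rowsq_ge0.
Qed.

(** Cauchy-Schwarz, first in the row and then in the integral. The pairing with the row is a limit
    of finite sums. *)
Lemma row_pairing i (s : R -> C) (W : R -> E) (a b : R) : cmeas s -> (forall t, nsq (s t) = 1) -> vec_L2 W ->
  (\int[mu]_(t in D) rowsq i t <= a%:E)%E -> (vec_L2sq W <= b%:E)%E ->
  cintg (fun t => s t * G (circ t) (W t) i) /\ nsq (cint (fun t => s t * G (circ t) (W t) i)) <= a * b.
Proof.
move=> ms s1 [mW fW] ra Wb.
apply: (@cint_CS R _ (rowsq i) (fun t => (rnorm (W t) ^+ 2)%:E)) => //.
- apply: cmeasM => //.
  apply: (@cmeas_cvg _ (fun N t => \sum_(n < N) W t n * G (circ t) (e_ n) i)) => [N|t _]; last exact: bop_etrunc_cvg.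
  apply: (@cmeas_sum R N (fun n t => W t n * G (circ t) (e_ n) i)) => n.
  by apply: cmeasM => //; exact: wm_coord.
- exact: measurable_rowsq.
- exact: measurable_rnorm2.
- by move=> t _; exact: rowsq_ge0.
- by move=> t _; rewrite lee_fin sqr_ge0.
move=> t c _.
pose x N := \sum_(n < N) W t n * G (circ t) (e_ n) i.
have xb N : ((2 * Re (c * s t * x N))%:E <= (nsq c)%:E * rowsq i t + (rnorm (W t) ^+ 2)%:E)%E.
  apply: (@le_trans _ _ ((nsq c)%:E * (\sum_(n < N) nsq (G (circ t) (e_ n) i))%:E + (\sum_(n < N) nsq (W t n))%:E)%E).
    rewrite -EFinM -EFinD lee_fin; apply: two_Re_le.
    - by rewrite mulr_ge0 ?nsq_ge0 ?sumr_ge0 // => n _; rewrite nsq_ge0.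
    - by apply: sumr_ge0 => n _; exact: nsq_ge0.
    rewrite !nsqM s1 mulr1 -mulrA ler_wpM2l ?nsq_ge0 // [leRHS]mulrC.
    exact: (@nsq_CS R N (fun n => W t n) (fun n => G (circ t) (e_ n) i)).
  apply: leeD; last by rewrite lee_fin ell2_partial_sum.
  apply: lee_wpmul2l; first by rewrite lee_fin nsq_ge0.
  rewrite -sumEFin.
  by apply: (nneseries_partial (f := fun n => (nsq (G (circ t) (e_ n) i))%:E)) => n; rewrite lee_fin nsq_ge0.
have T0 : (0 <= (nsq c)%:E * rowsq i t + (rnorm (W t) ^+ 2)%:E)%E.
  by rewrite adde_ge0 ?lee_fin ?sqr_ge0 // mule_ge0 ?rowsq_ge0 // lee_fin nsq_ge0.
move: T0 xb; case: (_ + _)%E => [r| |] // _ xb; last by rewrite leey.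
have cv : ccvg (fun N => x N * (c * s t)) (G (circ t) (W t) i * (c * s t)).
  by apply: ccvgMr; exact: bop_etrunc_cvg.
have -> : c * (s t * G (circ t) (W t) i) = G (circ t) (W t) i * (c * s t) by rewrite mulrA mulrC.
rewrite lee_fin -ler_pdivlMl //.
apply: (cvgr_to_le cv.1); apply: nearW => N.
by rewrite /= ler_pdivlMl // mulrC mulrC -[x N * _]mulrC -lee_fin; exact: xb.
Qed.
End Rows.

End VectorFunctions.

(** * Test functions *)

Section TestFunctions.
Variable R : realType.
Local Notation C := R[i].
Local Notation E := (ell2 R).
Local Notation Bop := (bop E E).
Local Notation e_ := (ebasis R).

Lemma single_sum_le (x : R) m0 K : 0 <= x -> \sum_(m < K) (if m0 == m :> nat then x else 0) <= x.
Proof.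
move=> x0; under eq_bigr do rewrite eq_sym.
rewrite -big_mkcond (big_ord1_eq +%R (fun=> x) m0 K).
by case: ifP.
Qed.

Lemma truncated_sum_le (f : nat -> R) N K : (forall p, 0 <= f p) ->
  \sum_(p < K) (if (p < N)%N then f p else 0) <= \sum_(p < N) f p.
Proof.
move=> f0; have [KN|NK] := leqP K N.
  rewrite (big_ord_widen N (fun p => if (p < N)%N then f p else 0) KN) big_mkcond.
  by apply: ler_sum => p _; rewrite ltn_ord; case: ifP.
by rewrite (big_ord_widen K f (ltnW NK)) [leRHS]big_mkcond.
Qed.

(** These are the polynomials whose coefficients have a single nonzero entry. *)
Lemma sparse_factor (s : nat -> R) (n0 m0 : nat -> nat) N :
  exists f a, [/\ L2conv f a,
    forall p n m, a p (e_ n) m = if (p < N)%N && ((n0 p == n) && (m0 p == m)) then (s p)%:C%C else 0 &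
    (H2sq f <= (\sum_(p < N) s p ^+ 2)%:E)%E].
Proof.
apply: (operator_riesz_fischer (G := fun p m n => if (p < N)%N && ((n0 p == n) && (m0 p == m)) then (s p)%:C%C else 0)).
  exact: ltry.
have one p : (double_esum (fun n m => (nsq (if (p < N)%N && ((n0 p == n) && (m0 p == m)) then (s p)%:C%C else 0 : C))%:E)
    <= (if (p < N)%N then s p ^+ 2 else 0)%:E)%E.
  pose x := if (p < N)%N then s p ^+ 2 else 0.
  have x0 : 0 <= x by rewrite /x; case: ifP => _ //; exact: sqr_ge0.
  have xE n m : nsq (if (p < N)%N && ((n0 p == n) && (m0 p == m)) then (s p)%:C%C else 0 : C) =
      if n0 p == n then (if m0 p == m then x else 0) else 0.
    have e (q : bool) : nsq (if q then (s p)%:C%C else 0 : C) = if q then s p ^+ 2 else 0.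
      by case: q; [exact: nsq_real|exact: nsq0].
    by rewrite e /x; case: (p < N)%N; case: (n0 p == n); case: (m0 p == m).
  rewrite -/x; apply: nneseries_le => [n|K]; first by apply: nneseries_ge0 => m _ _; rewrite lee_fin nsq_ge0.
  apply: (@le_trans _ _ (\sum_(n < K) (if n0 p == n then x else 0))%:E); last first.
    by rewrite lee_fin; exact: single_sum_le.
  rewrite -sumEFin; apply: lee_sum => n _.
  apply: nneseries_le => [m|L]; first by rewrite lee_fin nsq_ge0.
  rewrite sumEFin lee_fin; under eq_bigr do rewrite xE.
  case: ifP => _; first exact: single_sum_le.
  by rewrite big1.
apply: nneseries_le => [p|K]; first by apply: double_esum_ge0 => n m; rewrite lee_fin nsq_ge0.
apply: (@le_trans _ _ (\sum_(p < K) (if (p < N)%N then s p ^+ 2 else 0))%:E).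
  by rewrite -sumEFin; apply: lee_sum => p _; exact: one.
by rewrite lee_fin; apply: (@truncated_sum_le (fun p => s p ^+ 2)) => p; exact: sqr_ge0.
Qed.

Lemma identity_bop : exists I : Bop, (forall u, I u = u) /\ opnorm I <= 1.
Proof.
apply: (@mk_bop R E E id 1 ler01) => // u.
by rewrite expr1n mul1r.
Qed.

(** Since [b q] vanishes on the basis vector [j] unless q = j, only the term p = i remains. *)
Lemma test_entry (a b : nat -> Bop) (I : Bop) (sl sm : nat -> R) N i j :
  (forall u, I u = u) ->
  (forall p n m, a p (e_ n) m = if (p < N)%N && ((0 == n)%N && (p == m)) then (sl p)%:C%C else 0) ->
  (forall q n m, b q (e_ n) m = if (q < N)%N && ((q == n) && (0 == m)%N) then (sm q)%:C%C else 0) ->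
  (i < N)%N -> (j < N)%N -> conv_coef a b I (i + j) (e_ j) i = (sm j)%:C%C * (sl i)%:C%C.
Proof.
move=> hI ha hb iN jN.
have bE q : b q (e_ j) = (if (q < N)%N && (q == j) then (sm q)%:C%C else 0) *: e_ 0.
  apply: ell2_eq => m; rewrite hb ell2_valZ ebasisE eq_sym [(m == _)]eq_sym.
  by case: (q < N)%N; case: (j == q); case: (0 == m)%N; rewrite /= ?mulr1 ?mulr0 // ?(eq_sym q) //.
rewrite /conv_coef bopsumE ell2_val_sum.
transitivity (\sum_(p < (i + j).+1) (if ((i + j - p < N) && (i + j - p == j))%N then (sm (i + j - p)%N)%:C%C else 0) *
    (if (p < N)%N && (p == i :> nat) then (sl p)%:C%C else 0)).
  apply: eq_bigr => p _; rewrite -[LHS]/(a p (I (b (i + j - p)%N (e_ j))) i) hI bE bopZ ell2_valZ ha.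
  by rewrite eqxx.
have ij : (i < (i + j).+1)%N by rewrite ltnS leq_addr.
rewrite (bigD1 (Ordinal ij)) //= big1 ?addr0; first by rewrite addKn jN iN !eqxx.
move=> p pi; have -> : (p == i :> nat) = false by apply/negbTE; exact: pi.
by rewrite andbF mulr0.
Qed.

Lemma kernel_rep_scale F al be (tau : R) : 0 < tau -> kernel_rep F al be ->
  kernel_rep F (fun i => tau * al i) (fun j => tau^-1 * be j).
Proof.
move=> t0 [K2 [K3 [p2 p3 h23 [a0 h1] h3]]].
have v0 : 0 <= tau^-1 by rewrite invr_ge0 ltW.
exists (fun s s' => (tau^-1)%:C%C * K2 s s'), (fun s s' => (tau^-1)%:C%C * K3 s s'); split.
- exact: psd_scale.
- exact: psd_scale.
- by move=> k S c; rewrite !kform_scale ler_wpM2l.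
- split=> [i|i S c]; first by rewrite mulr_ge0 // ltW.
  by rewrite kform_scale mulrACA divff ?gt_eqF // mul1r.
- by move=> j; rewrite ReM_real ler_wpM2l.
Qed.

(** Only the product of the bounds on [al] and [be] matters, as they can be rescaled in opposite
    ways by [kernel_rep_scale]. *)
Lemma balance (P Q m : R) : 0 <= P -> 0 <= Q -> 0 < m -> P * Q <= m ^+ 2 ->
  exists2 tau, 0 < tau & tau * P <= m /\ tau^-1 * Q <= m.
Proof.
move=> P0 Q0 m0 PQ; have [->|Pn] := eqVneq P 0.
  exists ((Q + 1) / m); first by rewrite divr_gt0 // ltr_wpDl.
  rewrite mulr0 ltW // invf_div; split => //.
  by rewrite mulrAC ler_pdivrMr ?ltr_wpDl // ler_wpM2l ?(ltW m0) // lerDl.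
have Pp : 0 < P by rewrite lt0r Pn.
exists (m / P); first by rewrite divr_gt0.
split; first by rewrite divfK.
by rewrite invf_div mulrAC ler_pdivrMr // -expr2.
Qed.

End TestFunctions.

(** * A kernel representation from a factorized multiplier *)

Section KernelOfMultiplier.
Variable R : realType.
Local Notation C := R[i].
Local Notation Re := (@complex.Re R).
Local Notation mu := (@lebesgue_measure R).
Local Notation D := (@unit_itv R).
Local Notation E := (ell2 R).
Local Notation Bop := (bop E E).
Local Notation e_ := (ebasis R).

Definition truncation (phi : nat -> C) N i k j : C :=
  if (i < N)%N && (j < N)%N then phi (i + k + j)%N else 0.

Section Kernel.
Variables (phi : nat -> C) (N : nat) (la ga : nat -> R) (rho : R).
Hypotheses (la0 : forall i, 0 < la i) (ga0 : forall j, 0 < ga j) (rho1 : 1 < rho).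
Variables (w : nat -> C -> Bop) (G H : C -> Bop) (Y : nat -> Bop) (rg rh s : R).
Hypotheses (wmw : forall k, weakly_measurable (w k)) (GH : H2S2 G) (HH : H2S2 H).
Hypotheses (fac : factorization w G Y H) (gE : H2sq G = rg%:E) (hE : H2sq H = rh%:E).
Hypotheses (s0 : 0 <= s) (Ys : forall k, opnorm (Y k) <= s).
Let sl i := rho^-1 * Num.sqrt (la i).
Let sm j := Num.sqrt (ga j).
Hypothesis coef : forall i k j, (i < N)%N -> (j < N)%N ->
  phi (i + k + j)%N * ((sm j)%:C%C * (sl i)%:C%C) =
  cint (fun t => (circ t)^* ^+ (i + j) * w k (circ t) (e_ j) i).

Let wG : weakly_measurable G. Proof. by case: GH. Qed.
Let wH : weakly_measurable H. Proof. by case: HH. Qed.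
Let rho0 : 0 < rho. Proof. exact: lt_trans ltr01 rho1. Qed.

Let hcol j : vec_L2 (fun t => H (circ t) (e_ j)).
Proof. by apply: vec_L2sq_column => //; rewrite hE ltry. Qed.

Let v j : R := if (j < N)%N then (sm j)^-1 else 0.
Let V j t : E := ((v j)%:C%C * (circ t)^* ^+ j) *: H (circ t) (e_ j).
Let U p t : E := Y (nunpair p).1 (V (nunpair p).2 t).

Let un n t : nsq ((circ t)^* ^+ n : C) = 1.
Proof. by rewrite -rmorphXn /= nsq_conj circX_nsq. Qed.

Let hV j : vec_L2 (V j) /\ vec_L2sq (V j) = ((v j ^+ 2)%:E * vec_L2sq (fun t => H (circ t) (e_ j)))%E.
Proof.
apply: vec_L2sq_scale; first exact: sqr_ge0.
- by apply: cmeasZ; exact: cmeas_cconjX.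
- by move=> t; rewrite nsqM nsq_real un mulr1.
- exact: hcol.
Qed.

Let hU p : vec_L2 (U p).
Proof. exact: (vec_L2sq_bop (Y (nunpair p).1) (hV (nunpair p).2).1).1. Qed.

Let a i : R := fine (\int[mu]_(t in D) rowsq G i t).

Let aE i : (\int[mu]_(t in D) rowsq G i t = (a i)%:E)%E.
Proof.
rewrite /a fineK // ge0_fin_numE; last by apply: integral_ge0 => t _; exact: rowsq_ge0.
have : (\sum_(l < i.+1) \int[mu]_(t in D) rowsq G l t < +oo)%E.
  by apply: le_lt_trans (rows_le wG i.+1) _; rewrite gE ltry.
apply: le_lt_trans; rewrite big_ord_recr /= leeDr // sume_ge0 // => l _.
by apply: integral_ge0 => t _; exact: rowsq_ge0.
Qed.

Let a0 i : 0 <= a i.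
Proof. by rewrite -lee_fin -aE; apply: integral_ge0 => t _; exact: rowsq_ge0. Qed.

Let row n i (W : R -> E) b : vec_L2 W -> (vec_L2sq W <= b%:E)%E ->
  cintg (fun t => (circ t)^* ^+ n * G (circ t) (W t) i) /\
  nsq (cint (fun t => (circ t)^* ^+ n * G (circ t) (W t) i)) <= a i * b.
Proof.
move=> hW Wb; apply: (row_pairing wG) => //.
- exact: cmeas_cconjX.
- by rewrite aE.
Qed.

Let rowW n i (W : R -> E) : vec_L2 W -> cintg (fun t => (circ t)^* ^+ n * G (circ t) (W t) i).
Proof.
move=> hW; have [r r0 rE] := fin_ereal (vec_L2sq_ge0 W) hW.2.
by have [] := row n i (b := r) hW _; rewrite ?rE.
Qed.

Let c_ i : C := (rho * (Num.sqrt (la i))^-1)%:C%C.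

Let entry i k j : (i < N)%N ->
  truncation phi N i k j = c_ i * cint (fun t => (circ t)^* ^+ i * G (circ t) (U (npair (k, j)) t) i).
Proof.
move=> iN; rewrite /truncation iN /=.
have UE t : (circ t)^* ^+ i * G (circ t) (U (npair (k, j)) t) i =
   (v j)%:C%C * ((circ t)^* ^+ (i + j) * G (circ t) (Y k (H (circ t) (e_ j))) i).
  rewrite /U npairK /V !bopZ ell2_valZ exprD; ring.
rewrite (cint_ext (fun t _ => UE t)).
have mGYH : weakly_measurable (fun z => bcomp (G z) (bcomp (Y k) (H z))).
  by apply: wm_comp => //; apply: (wm_comp (f := fun=> Y k)) => //; exact: wm_cst.
have ae : cint (fun t => (circ t)^* ^+ (i + j) * G (circ t) (Y k (H (circ t) (e_ j))) i) =
    cint (fun t => (circ t)^* ^+ (i + j) * w k (circ t) (e_ j) i).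
  apply: cint_ae.
  - by apply: cmeasM; [exact: cmeas_cconjX|exact: (wm_coord (e_ j) i mGYH)].
  - by apply: cmeasM; [exact: cmeas_cconjX|exact: (wm_coord (e_ j) i (wmw k))].
  - by apply: ae_mono (fac k) => t h Dt; rewrite h.
have [jN|jN] := ltnP j N; last first.
  have -> : v j = 0 by rewrite /v ltnNge jN.
  under cint_ext do rewrite mul0r.
  by rewrite cint0 mulr0.
rewrite cintZ; last exact: (rowW (i + j) i (vec_L2sq_bop (Y k) (hcol j)).1).
rewrite ae -coef // /c_ /v jN /sl /sm.
have l0 : Num.sqrt (la i) != 0 by rewrite gt_eqF // sqrtr_gt0.
have m0 : Num.sqrt (ga j) != 0 by rewrite gt_eqF // sqrtr_gt0.
have r0' : rho != 0 by rewrite gt_eqF.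
have key : (rho * (Num.sqrt (la i))^-1)%:C%C *
    (((Num.sqrt (ga j))^-1)%:C%C * ((Num.sqrt (ga j))%:C%C * (rho^-1 * Num.sqrt (la i))%:C%C)) = 1 :> C.
  rewrite -!rmorphM -[RHS](rmorph1 (real_complex R)); congr (real_complex R _).
  by field; rewrite l0 m0 r0'.
rewrite -[LHS]mulr1 -key; ring.
Qed.

(** The truncation at (i, k, j) is a multiple of the integral of conj(z)^(i+j) times the entry
    (i, j) of w_k = G Y_k H. It is the pairing of row i of G with the function U_(k,j) = Y_k V_j,
    where V_j is conj(z)^j H e_j divided by the square root of [ga j]; the kernels are the Gram
    kernels of the U_(k,j) and of the V_j, the latter multiplied by [s ^+ 2] to make the Y_k
    contractions. The weights turn the sums of all rows of G and of all columns of H into weighted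
    sums of the bounds. *)
Lemma multiplier_kernel : exists al be, [/\ kernel_rep (truncation phi N) al be,
  forall i, (N <= i)%N -> al i = 0 /\ be i = 0,
  \sum_(i < N) la i * al i <= rho ^+ 2 * rg & \sum_(j < N) ga j * be j <= s ^+ 2 * rh].
Proof.
pose al i : R := if (i < N)%N then rho ^+ 2 / la i * a i else 0.
pose K3 p q := (s ^+ 2)%:C%C * kgram V p q : C.
pose be j := Re (K3 j j).
have al0 i : 0 <= al i.
  by rewrite /al; case: ifP => // _; rewrite mulr_ge0 // divr_ge0 ?sqr_ge0 // ltW.
have hV1 j := (hV j).1.
have beE j : be j = s ^+ 2 * (v j ^+ 2 * fine (vec_L2sq (fun t => H (circ t) (e_ j)))).
  have <- : Re (kgram V j j) = v j ^+ 2 * fine (vec_L2sq (fun t => H (circ t) (e_ j))).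
    have := kgram_diag hV1 j; rewrite (hV j).2.
    have [r r0 ->] := fin_ereal (vec_L2sq_ge0 (fun t => H (circ t) (e_ j))) (hcol j).2.
    by rewrite -EFinM => -[].
  exact: ReM_real.
exists al, be; split.
- exists (kgram U), K3; split.
  + exact: psd_kgram.
  + by apply: psd_scale; [exact: sqr_ge0|exact: psd_kgram].
  + move=> k S c; have K3E : (kform K3 S c)%:E = ((s ^+ 2)%:E * vec_L2sq (fun t => \sum_(j < S) c j *: V j t)%R)%E.
      by rewrite -(kgram_sum hV1 S c).2 -EFinM; congr EFin; exact: kform_scale.
    rewrite -lee_fin K3E.
    have -> : kform (fun j j' => kgram U (npair (k, j)) (npair (k, j'))) S c =
        kform (kgram (fun j t => Y k (V j t))) S c.
      congr (kform _ S c); apply/funext => j; apply/funext => j'.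
      by rewrite /kgram /U !npairK.
    rewrite (kgram_sum (fun j => (vec_L2sq_bop (Y k) (hV1 j)).1) S c).2.
    have -> : (fun t => \sum_(j < S) c j *: Y k (V j t)) = (fun t => Y k (\sum_(j < S) c j *: V j t)).
      by apply/funext => t; rewrite bop_sum; apply: eq_bigr => j _; rewrite [RHS]bopZ.
    apply: le_trans (vec_L2sq_bop (Y k) (kgram_sum hV1 S c).1).2 _.
    apply: lee_wpmul2r; first exact: vec_L2sq_ge0.
    by rewrite lee_fin ler_pXn2r ?nnegrE ?opnorm_ge0.
  + split=> // i S c.
    have [iN|iN] := ltnP i N; last first.
      rewrite big1 ?nsq0 => [|p _]; last by rewrite /truncation ltnNge iN mulr0.
      apply: mulr_ge0; [exact: al0|exact: ((psd_kgram hU).2 S c)].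
    pose W t := \sum_(p < S) c p *: U p t.
    have [hW WE] := kgram_sum hU S c.
    have [] := row i i (W := W) (b := kform (kgram U) S c) hW _; first by rewrite WE.
    move=> iW nW.
    have [_ i2] := cintg_sum (n := S) (F := fun p t => c p * ((circ t)^* ^+ i * G (circ t) (U p t) i))
      (fun p _ => cintgZ (c p) (rowW i i (hU p))).
    have -> : \sum_(p < S) c p * truncation phi N i (nunpair p).1 (nunpair p).2 =
       c_ i * cint (fun t => (circ t)^* ^+ i * G (circ t) (W t) i).
      have e t : (circ t)^* ^+ i * G (circ t) (W t) i =
          \sum_(p < S) c p * ((circ t)^* ^+ i * G (circ t) (U p t) i).
        rewrite /W bop_sum ell2_val_sum mulr_sumr; apply: eq_bigr => p _.
        by rewrite bopZ ell2_valZ mulrCA.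
      rewrite (cint_ext (fun t _ => e t)) i2 mulr_sumr; apply: eq_bigr => p _.
      have q : npair ((nunpair p).1, (nunpair p).2) = p by rewrite -surjective_pairing nunpairK.
      have := entry (nunpair p).1 (nunpair p).2 iN; rewrite q => ->.
      by rewrite (cintZ (c p) (rowW i i (hU p))) mulrCA.
    have -> : al i * kform (kgram U) S c = rho ^+ 2 / la i * (a i * kform (kgram U) S c).
      by rewrite /al iN mulrA.
    have cE : nsq (c_ i) = rho ^+ 2 / la i by rewrite /c_ nsq_real exprMn exprVn sqr_sqrtr // ltW.
    by rewrite nsqM cE ler_wpM2l // divr_ge0 ?sqr_ge0 // ltW.
  + by move=> j.
- by move=> i iN; rewrite beE /al /v ltnNge iN /= expr0n /= mul0r mulr0.
- apply: (@le_trans _ _ (rho ^+ 2 * \sum_(i < N) a i)).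
    rewrite mulr_sumr; apply: ler_sum => i _; rewrite /al ltn_ord.
    by rewrite mulrA mulrCA divff ?mulr1 // gt_eqF.
  rewrite ler_wpM2l ?sqr_ge0 // -lee_fin -gE -sumEFin.
  by under eq_bigr do rewrite -aE; exact: rows_le.
- apply: (@le_trans _ _ (s ^+ 2 * \sum_(j < N) fine (vec_L2sq (fun t => H (circ t) (e_ j))))).
    rewrite mulr_sumr; apply: ler_sum => j _; rewrite beE.
    rewrite /v ltn_ord /sm exprVn sqr_sqrtr ?(ltW (ga0 _)) //.
    by rewrite mulrCA [ga j * _]mulrA divff ?mul1r // gt_eqF.
  rewrite ler_wpM2l ?sqr_ge0 // -lee_fin -hE -sumEFin.
  under eq_bigr => j _.
    rewrite fineK; last first.
      rewrite ge0_fin_numE ?vec_L2sq_ge0 //.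
      exact: (hcol j).2.
    over.
  exact: vec_L2sq_columns.
Qed.

End Kernel.
End KernelOfMultiplier.

(** * The norm of M_3 is at most the multiplier norm *)

Section LowerBound.
Variable R : realType.
Local Notation C := R[i].
Local Notation E := (ell2 R).
Local Notation Bop := (bop E E).
Local Notation e_ := (ebasis R).
Implicit Type phi : nat -> C.

(** Apply the hypothesis to x_k = g h, independent of [k], where g is the sum of the z^i e_(i,0)
    with coefficients the square roots of the weights [la i], divided by [rho], and h is the sum
    of the z^j e_(0,j) with those of the [ga j]. The weights have sum at most 1, and the factor
    [rho] makes the product of the norms strictly less than 1. *)
Lemma kernel_of_bound phi (c : R) N (la ga : nat -> R) (rho : R) : 0 < c -> (calM3_norm phi < c%:E)%E ->
  (forall i, 0 < la i) -> (forall j, 0 < ga j) -> 1 < rho ->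
  \sum_(i < N) la i <= 1 -> \sum_(j < N) ga j <= 1 ->
  exists al be, [/\ kernel_rep (truncation phi N) al be,
    forall i, (N <= i)%N -> al i = 0 /\ be i = 0,
    \sum_(i < N) la i * al i <= rho * c & \sum_(j < N) ga j * be j <= rho * c].
Proof.
move=> c0 hc la0 ga0 rho1 la1 ga1.
have rho0 : 0 < rho by exact: lt_trans ltr01 rho1.
pose sl i := rho^-1 * Num.sqrt (la i); pose sm j := Num.sqrt (ga j).
have [g [a [gL ha gn]]] := sparse_factor sl (fun=> 0%N) id N.
have [h [b [hL hb hn]]] := sparse_factor sm id (fun=> 0%N) N.
have [I [hI In]] := identity_bop R.
pose x (k : nat) z := bcomp (g z) (bcomp I (h z)).
have Ng : (H2norm g <= (rho^-1)%:E)%E.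
  apply: H2norm_ub; first by rewrite invr_ge0 ltW.
  apply: le_trans gn _; rewrite lee_fin.
  rewrite (eq_bigr (fun p : 'I_N => rho^-1 ^+ 2 * la p)) => [|p _]; last first.
    by rewrite /sl exprMn sqr_sqrtr // ltW.
  by rewrite -mulr_sumr ler_piMr ?sqr_ge0.
have Nh : (H2norm h <= 1%:E)%E.
  apply: H2norm_ub => //; apply: le_trans hn _; rewrite lee_fin expr1n.
  rewrite (eq_bigr (fun p : 'I_N => ga p)) // => p _.
  by rewrite /sm sqr_sqrtr // ltW.
have n0 (f : C -> Bop) : (0 <= H2norm f)%E by rewrite H2normE sqrte_ge0.
have fx : facnorm_lt x 1.
  exists g, (fun=> I), h; split.
  - exact: L2conv_H2S2 gL.
  - exact: L2conv_H2S2 hL.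
  - by move=> k; apply: aeW => t Dt u.
  apply: (@le_lt_trans _ _ ((rho^-1)%:E * 1%:E * 1%:E)%E).
    apply: lee_pmul => //; first by rewrite mule_ge0 ?supnorm_ge0.
    apply: lee_pmul; rewrite ?supnorm_ge0 //.
    exact: supnorm_le.
  by rewrite !mule1 lte_fin invf_lt1.
have xH k : H1S1 (x k) by exact: (product_H1S1 I gL hL).
have : (mult_facnorm phi x < c%:E)%E.
  by apply: le_lt_trans hc; apply: ereal_sup_ubound; exists x.
move=> /ereal_inf_lt[_ [w mw <-]] /ereal_inf_lt[_ [c' [G' [Y' [H' [p1 p2 p3 p4]]]] <-] c'c].
have fw : facnorm_lt w c by exists G', Y', H'; split => //; exact: lt_trans p4 c'c.
have [G [Y [H [GH HH fac [rg [rh [s [[g0 h0 s0] gE hE Ys lt]]]]]]]] := finite_factorization c0 fw.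
have coef i k j : (i < N)%N -> (j < N)%N -> phi (i + k + j)%N * ((sm j)%:C%C * (sl i)%:C%C) =
    cint (fun t => (circ t)^* ^+ (i + j) * w k (circ t) (e_ j) i).
  move=> iN jN; have [_ [a' xa wa]] := mw k.
  have e1 := wa (i + j)%N (e_ j) (e_ i).
  rewrite circle_intE bopscaleE innerp_ebasis ell2_valZ in e1.
  have e2 := xa (i + j)%N (e_ j) (e_ i).
  rewrite -(product_fourier I gL hL) !innerp_ebasis (test_entry hI ha hb iN jN) in e2.
  rewrite addnAC -e2 e1; apply: cint_ext => t _.
  by rewrite innerp_ebasis.
have wmw k : weakly_measurable (w k) by have [[]] := mw k.
have [al [be [rep z sal sbe]]] := multiplier_kernel la0 ga0 rho1 wmw GH HH fac gE hE s0 Ys coef.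
have rc0 : 0 < rho * c by exact: mulr_gt0.
have PQ : (rho ^+ 2 * rg) * (s ^+ 2 * rh) <= (rho * c) ^+ 2.
  have -> : (rho ^+ 2 * rg) * (s ^+ 2 * rh) = (rho * (Num.sqrt rg * s * Num.sqrt rh)) ^+ 2.
    by rewrite -[in LHS](sqr_sqrtr g0) -[in LHS](sqr_sqrtr h0); ring.
  rewrite ler_pXn2r ?nnegrE ?mulr_ge0 ?sqrtr_ge0 ?(ltW rho0) ?(ltW c0) //.
  by rewrite ler_wpM2l // ltW.
have [tau t0 [b1 b2]] := balance (mulr_ge0 (sqr_ge0 rho) g0) (mulr_ge0 (sqr_ge0 s) h0) rc0 PQ.
exists (fun i => tau * al i), (fun j => tau^-1 * be j); split.
- exact: kernel_rep_scale.
- by move=> i /z[-> ->]; rewrite !mulr0.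
- apply: le_trans b1; under eq_bigr do rewrite mulrCA.
  by rewrite -mulr_sumr ler_wpM2l // ltW.
- apply: le_trans b2; under eq_bigr do rewrite mulrCA.
  by rewrite -mulr_sumr ler_wpM2l // invr_ge0 ltW.
Qed.

Lemma kernel_rep_mono F (al be al' be' : nat -> R) : (forall i, al i <= al' i) -> (forall j, be j <= be' j) ->
  kernel_rep F al be -> kernel_rep F al' be'.
Proof.
move=> hal hbe [K2 [K3 [p2 p3 h23 [a0 h1] h3]]]; exists K2, K3; split => //.
- split=> [i|i S c]; first exact: le_trans (a0 i) (hal i).
  by apply: le_trans (h1 i S c) _; rewrite ler_wpM2r //; apply: p2.2.
- by move=> j; exact: le_trans (h3 j) (hbe j).
Qed.

(** The bounds of [kernel_of_bound] hold on average, for all weights; the admissible bounds form a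
    convex set, so [minimax_convex] gives bounds that hold at every index, up to [d]. *)
Lemma uniform_kernel phi (c m d : R) n : 0 < c -> (calM3_norm phi < c%:E)%E -> c < m -> 0 < d ->
  kernel_rep (truncation phi n.+1) (fun=> m + d) (fun=> m + d).
Proof.
move=> c0 hc cm d0; set N := n.+1.
have m0 : 0 < m by exact: lt_trans cm.
pose S := [set s : 'I_N + 'I_N -> R | exists al be, [/\ kernel_rep (truncation phi N) al be,
  forall i, (N <= i)%N -> al i = 0 /\ be i = 0,
  forall i : 'I_N, al i = s (inl i) & forall j : 'I_N, be j = s (inr j)]].
have [s [al [be [rep z hal hbe]]] sle] : exists2 s, S s & forall i, s i <= m + d.
  apply: (@minimax_convex R _ S m) => //; first exact: ltW.
  - move=> s s' t [al [be [rep z hal hbe]]] [al' [be' [rep' z' hal' hbe']]] t01.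
    exists (fun i => al i + t * (al' i - al i)), (fun j => be j + t * (be' j - be j)); split.
    + exact: kernel_rep_convex.
    + by move=> i iN; have [-> ->] := z i iN; have [-> ->] := z' i iN; rewrite subrr mulr0 addr0.
    + by move=> i; rewrite hal hal'.
    + by move=> j; rewrite hbe hbe'.
  - move=> s i [al [be [[K2 [K3 [p2 p3 h23 [a0 h1] h3]]] z hal hbe]]].
    case: i => i; first by rewrite -hal.
    by rewrite -hbe; apply: le_trans (h3 i); rewrite -kform_single; apply: p3.2.
  - move=> nu nu0.
    pose La := \sum_(i < N) nu (inl i); pose Ga := \sum_(j < N) nu (inr j).
    have La0 : 0 < La.
      by rewrite /La big_ord_recl ltr_pwDl // sumr_ge0 // => i _; exact: ltW.
    have Ga0 : 0 < Ga.
      by rewrite /Ga big_ord_recl ltr_pwDl // sumr_ge0 // => i _; exact: ltW.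
    have rho1 : 1 < m / c by rewrite ltr_pdivlMr // mul1r.
    have la1 : \sum_(i < N) nu (inl (inord i)) / La <= 1.
      rewrite -mulr_suml; under eq_bigr do rewrite inord_val.
      by rewrite divff // gt_eqF.
    have ga1 : \sum_(j < N) nu (inr (inord j)) / Ga <= 1.
      rewrite -mulr_suml; under eq_bigr do rewrite inord_val.
      by rewrite divff // gt_eqF.
    have [al [be [rep z sal sbe]]] := kernel_of_bound (la := fun p => nu (inl (inord p)) / La)
      (ga := fun p => nu (inr (inord p)) / Ga) c0 hc
      (fun i => divr_gt0 (nu0 _) La0) (fun j => divr_gt0 (nu0 _) Ga0) rho1 la1 ga1.
    have mE : m / c * c = m by rewrite divfK // gt_eqF.
    exists (fun i : 'I_N + 'I_N => match i with inl i => al i | inr j => be j end); first by exists al, be; split.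
    rewrite !big_sumType /= mulrDr; apply: lerD.
    + rewrite -ler_pdivrMr // -/La -[leRHS]mE; apply: le_trans sal.
      by rewrite mulr_suml; apply: ler_sum => i _; rewrite inord_val mulrAC.
    + rewrite -ler_pdivrMr // -/Ga -[leRHS]mE; apply: le_trans sbe.
      by rewrite mulr_suml; apply: ler_sum => i _; rewrite inord_val mulrAC.
have md0 : 0 <= m + d by rewrite addr_ge0 // ltW.
apply: kernel_rep_mono rep => i; have [iN|iN] := ltnP i N.
- by have := hal (Ordinal iN); rewrite /= => ->.
- by rewrite (z i iN).1.
- by have := hbe (Ordinal iN); rewrite /= => ->.
- by rewrite (z i iN).2.
Qed.

(** The representations of the truncations have bounds independent of their size, so they have a
    limit, which represents [phi] and is turned into matrices. *)
Theorem M3_norm_le phi (c : R) : 0 < c -> (calM3_norm phi < c%:E)%E -> (M3_norm phi <= c%:E)%E.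
Proof.
move=> c0 hc; apply/lee_addgt0Pr => e e0.
rewrite -EFinD; set M := c + e.
have M0 : 0 <= M by rewrite addr_ge0 // ltW.
have ME : M = Num.sqrt M ^+ 2 by rewrite sqr_sqrtr.
have rep : kernel_rep (fun i k j => phi (i + k + j)%N) (fun=> Num.sqrt M ^+ 2) (fun=> Num.sqrt M ^+ 2).
  apply: (@kernel_rep_limit R (fun n => truncation phi n.+1)) => [n|i k j].
    rewrite -ME (_ : M = (c + e / 2) + e / 2); last by rewrite /M; lra.
    by apply: (uniform_kernel n c0 hc); lra.
  exists (maxn i j) => n; rewrite geq_max => /andP[iN jN].
  by rewrite /truncation !ltnS iN jN.
have [A [B [D' [nb /matrix_rep_M3]]]] := kernel_rep_matrix rep.
have s0 := sqrtr_ge0 M.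
by move=> /(_ s0 s0); rewrite -expr2 -ME.
Qed.

Lemma calM3_norm_ge0 phi : (0 <= calM3_norm phi)%E.
Proof.
pose o : C -> Bop := fun=> 0; have oL : L2conv o (fun=> 0) := @L2conv0 R.
have n0 : H2norm o = 0%E.
  apply/eqP; rewrite eq_le; apply/andP; split; last by rewrite H2normE sqrte_ge0.
  apply: H2norm_ub => //; rewrite expr0n /= /H2sq; under eq_integral do rewrite hs2_0.
  by rewrite integral0.
pose x (k : nat) z := bcomp (o z) (bcomp (0 : Bop) (o z)).
apply: (@le_trans _ _ (mult_facnorm phi x)); last first.
  apply: ereal_sup_ubound; exists x => //; split; first by move=> k; exact: (product_H1S1 0 oL oL).
  exists o, (fun=> 0), o; split.
  - exact: L2conv_H2S2 oL.
  - exact: L2conv_H2S2 oL.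
  - by move=> k; apply: aeW => t Dt u.
  by rewrite n0 mule0 lte_fin.
apply: le_ereal_inf_tmp => _ [w _ <-]; apply: le_ereal_inf_tmp => _ [r [g [y [h [_ _ _ lt]]]] <-].
apply: ltW; apply: le_lt_trans lt.
by rewrite !mule_ge0 ?supnorm_ge0 // H2normE sqrte_ge0.
Qed.

Lemma le_of_real_bounds (x y : \bar R) : (forall c : R, (x < c%:E)%E -> (y <= c%:E)%E) -> (y <= x)%E.
Proof.
case: x => [r| |] h; last 2 first.
- exact: leey.
- rewrite leeNy_eq; apply/eqP; case: y h => [s| |] // h.
  + by exfalso; have := h (s - 1) (ltNyr _); rewrite lee_fin; lra.
  + by have := h 0 (ltNyr _).
apply/lee_addgt0Pr => e e0; rewrite -EFinD; apply: h.
by rewrite lte_fin ltrDl.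
Qed.

End LowerBound.

Theorem theorem3p3 (R : realType) (phi : nat -> R[i]) : M3_norm phi = calM3_norm phi.
Proof.
apply/eqP; rewrite eq_le; apply/andP; split; apply: le_of_real_bounds => c hc.
  apply: M3_norm_le => //; rewrite -lte_fin.
  exact: le_lt_trans (calM3_norm_ge0 phi) hc.
exact: calM3_norm_le.
Qed.
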